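(* Let $k,n\ge1$, let $\bar\alpha=(\alpha_1,\dots,\alpha_n)$ and $\bar z=(z_1,\dots,z_k)$ be sequences of pairwise distinct complex numbers, and let $(\boldsymbol l,\boldsymbol m)\in\mathcal Z_{kn}$ with $\boldsymbol l=(l_1,\dots,l_k)$, $\boldsymbol m=(m_1,\dots,m_n)$. Put $\mu^{(i)}=(m_i,0,0,\dots)$ and $\lambda^{(a)}=(1,\dots,1,0,\dots)$ with $l_a$ ones. Let $V$ be a space of quasi-exponentials with data $(\bar\mu,\bar\lambda;\bar\alpha,\bar z)$, let $D_V^{\mathrm{aug}}=(d/dx)^n+\sum_{i=1}^n b_i(x)(d/dx)^{n-i}$, and let $v\in\mathfrak P_{kn}[\boldsymbol l,\boldsymbol m]$ be a nonzero vector with $\pi^{\langle n\rangle}_{\bar z}(B^{\langle n\rangle}_i(x))\,v=b_i(x)\,v$ for $i=1,\dots,n$ (an equality of series in $x^{-1}$, with $b_i$ expanded at $x=\infty$). Let $\widetilde D_V$ be defined by $$\widetilde D_V=(-1)^{M'}\prod_{i=1}^n(x+\alpha_i)^{(\mu^{(i)})'_1}\,\bigl(D_V^{-1}\bigr)^{\#}\,\prod_{a=1}^k\Bigl(\frac d{dx}-z_a\Bigr)^{\lambda^{(a)}_1},\qquad M'=\dim V,$$ let $\tilde V=\ker\widetilde D_V$ and $\widetilde D_V^{\mathrm{aug}}=\widetilde D_V\prod_{a:\,l_a=0}(d/dx-z_a)=(d/dx)^k+\sum_{a=1}^k\tilde b_a(x)(d/dx)^{k-a}$. Then, for generic $\bar\alpha,\bar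 z$, the vector $v$ is an eigenvector of the action $\pi^{\langle k\rangle}_{-\bar\alpha}$ of $\mathcal B^{\langle k\rangle}_{\bar z}$ corresponding to $\tilde V$, that is, $\pi^{\langle k\rangle}_{-\bar\alpha}(B^{\langle k\rangle}_a(x))\,v=\tilde b_a(x)\,v$ for $a=1,\dots,k$.
   Context: $\mathfrak P_{kn}$ is the space of polynomials in pairwise anticommuting variables $\xi_{ai}$ ($a\le k$, $i\le n$); $\partial_{ai}$ is the left derivation: on a monomial $\xi_{c_1}\cdots\xi_{c_l}$ it gives $(-1)^{s-1}$ times the monomial with the $s$-th factor removed if $c_s=(a,i)$, and $0$ otherwise. $\mathcal Z_{kn}$ is the set of pairs $(\boldsymbol l,\boldsymbol m)\in\mathbb Z_{\ge0}^k\times\mathbb Z_{\ge0}^n$ with $l_a\le n$, $m_i\le k$, $\sum l_a=\sum m_i$; $\mathfrak P_{kn}[\boldsymbol l,\boldsymbol m]$ is the span of monomials $\prod\xi_{ai}^{d_{ai}}$ ($d_{ai}\in\{0,1\}$) with $\sum_a d_{ai}=m_i$ and $\sum_i d_{ai}=l_a$. Actions: $\pi^{\langle n\rangle}_{\bar z}(e^{\langle n\rangle}_{ij}\otimes t^s)=\sum_a z_a^s\xi_{ai}\partial_{aj}$, $\pi^{\langle k\rangle}_{-\bar\alpha}(e^{\langle k\rangle}_{ab}\otimes t^s)=\sum_i(-\alpha_i)^s\xi_{ai}\partial_{bi}$. Bethe algebra: for $\mathfrak{gl}_N[t]$ with generators $e_{ij}$, $g(x)=\sum_{s\ge0}(g\otimes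 t^s)x^{-s-1}$; for pairwise distinct $\bar\beta\in\mathbb C^N$, $\operatorname{rdet}\bigl((\tfrac d{dx}-\beta_i)\delta_{ij}-e_{ji}(x)\bigr)_{i,j=1}^N=(d/dx)^N+\sum_{i=1}^N B_i(x)(d/dx)^{N-i}$ (powers of $d/dx$ moved to the right; $\operatorname{rdet}A=\sum_\sigma(-1)^\sigma a_{1\sigma(1)}\cdots a_{N\sigma(N)}$), $B_i(x)=\sum_{j\ge0}B_{ij}x^{-j}$; $\mathcal B^{\langle N\rangle}_{\bar\beta}$ is generated by $B_{ij}$, $j\ge1$. Here $B^{\langle n\rangle}_i$ is built with $\bar\beta=\bar\alpha$ and $B^{\langle k\rangle}_a$ with $\bar\beta=\bar z$. Partitions, conjugates $\mu'$, spaces of quasi-exponentials: for pairwise distinct $\alpha_i$, $z_a$ and partitions $\mu^{(i)},\lambda^{(a)}$, $V$ is a space of quasi-exponentials with data $(\bar\mu,\bar\lambda;\bar\alpha,\bar z)$ if it has a basis $q_{ij}(x)e^{\alpha_ix}$ ($\mu^{(i)}\ne0$, $j\le(\mu^{(i)})'_1$) with $\deg q_{ij}=(\mu^{(i)})'_1+\mu^{(i)}_j-j$, its singular points are exactly the $z_a$ with $\lambda^{(a)}\ne0$, and its exponents at such $z_a$ are $M'+\lambda^{(a)}_j-j$, $j=1,\dots,M'$, $M'=\dim V$ (exponents at $z$: integers $e_1>\dots>e_{M'}$ with $f_j\in V$, $f_j=(x-z)^{e_j}(1+o(1))$; $z$ singular if exponents $\ne\{0,\dots,M'-1\}$). $D_V$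 is the monic order-$M'$ differential operator with kernel $V$; $D_V^{\mathrm{aug}}=D_V\prod_{i:\,\mu^{(i)}=0}(d/dx-\alpha_i)$. $\Psi\mathfrak D$ is the algebra of pseudodifferential operators $\sum_{m\le M}\sum_{k\le K}C_{km}x^k(d/dx)^m$ with $(d/dx)^mx^k=\sum_{j\ge0}\frac{(m)_j(k)_j}{j!}x^{k-j}(d/dx)^{m-j}$; rational coefficients are replaced by Laurent series at infinity; $(\sum C_{km}x^k(d/dx)^m)^\dagger=\sum C_{km}(-d/dx)^mx^k$, $(\sum C_{km}x^k(d/dx)^m)^\ddagger=\sum C_{km}x^m(d/dx)^k$, $D^\#=(D^\dagger)^\ddagger$. *)

(* Defs.v *)
From HB Require Import structures.
From mathcomp Require Import all_boot all_order all_algebra fingroup perm.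
From mathcomp Require Import reals.
From mathcomp.analysis Require Import sequences exp trigo.
From mathcomp Require Import complex.
From mathcomp Require Import mpoly.
Set Implicit Arguments.
Unset Strict Implicit.
Unset Printing Implicit Defensive.
Import Order.TTheory GRing.Theory Num.Theory.
Local Open Scope ring_scope.

Definition ffz (m : int) (r : nat) : int := \prod_(i < r) (m - (i : nat)%:Z).
Definition binz (m : int) (r : nat) : int := (ffz m r %/ (r`!)%:Z)%Z.

(* Pseudodifferential operators  sum_{m<=M} sum_{k<=K} C_{km} x^k (d/dx)^m
   with coefficients in a ring A (x and d/dx commute with A).
   Representation: (kb, mb, c) with C_{kb-i, mb-j} = c i j (i j : nat);
   all other coefficients vanish.  Elements are compared via [coefPD].   *)
Definition PsiD (A : Type) := (int * int * (nat -> nat -> A))%type.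

Section PsiDef.
Context {A : pzRingType}.
Implicit Types P Q : PsiD A.

Definition pd_kb P : int := P.1.1.
Definition pd_mb P : int := P.1.2.
Definition pd_c P : nat -> nat -> A := P.2.

Definition coefPD P (K M : int) : A :=
  if (K <= pd_kb P) && (M <= pd_mb P)
  then pd_c P (absz (pd_kb P - K)) (absz (pd_mb P - M)) else 0.

Definition mkPD (kb mb : int) (f : int -> int -> A) : PsiD A :=
  (kb, mb, fun i j => f (kb - i%:Z) (mb - j%:Z)).

Definition monoPD (a : A) (k m : int) : PsiD A :=
  mkPD k m (fun K M => if (K == k) && (M == m) then a else 0).
Definition zeroPD : PsiD A := mkPD 0 0 (fun _ _ => 0).
Definition onePD : PsiD A := monoPD 1 0 0.
Definition constPD (a : A) : PsiD A := monoPD a 0 0.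
Definition xPD : PsiD A := monoPD 1 1 0.
Definition dPD : PsiD A := monoPD 1 0 1.

Definition addPD P Q : PsiD A :=
  mkPD (Num.max (pd_kb P) (pd_kb Q)) (Num.max (pd_mb P) (pd_mb Q))
       (fun K M => coefPD P K M + coefPD Q K M).

Definition scalePD (a : A) P : PsiD A :=
  mkPD (pd_kb P) (pd_mb P) (fun K M => a * coefPD P K M).

(* product, using (d/dx)^m x^k = sum_j (m)_j (k)_j / j! x^(k-j) (d/dx)^(m-j) *)
Definition mulPD P Q : PsiD A :=
  (pd_kb P + pd_kb Q, pd_mb P + pd_mb Q, fun i j =>
    \sum_(r < (minn i j).+1) \sum_(i1 < (i - r).+1) \sum_(j1 < (j - r).+1)
      pd_c P i1 j1 * pd_c Q (i - r - i1)%N (j - r - j1)%N *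
      ((binz (pd_mb P - j1%:Z) r * ffz (pd_kb Q - (i - r - i1)%N%:Z) r)%:~R)).

Definition powPD P (e : nat) : PsiD A := iter e (mulPD P) onePD.

Definition eqPD P Q : Prop := forall K M, coefPD P K M = coefPD Q K M.

(* dagger: sum C x^k (d/dx)^m  |->  sum C (-d/dx)^m x^k  (then normal-ordered) *)
Definition daggerPD P : PsiD A :=
  mkPD (pd_kb P) (pd_mb P) (fun K M =>
    \sum_(r < (absz (pd_kb P - K)).+1)
      (((-1) ^+ (absz (M + r%:Z)) * binz (M + r%:Z) r * ffz (K + r%:Z) r)%:~R)
        * coefPD P (K + r%:Z) (M + r%:Z)).

Definition ddaggerPD P : PsiD A :=
  mkPD (pd_mb P) (pd_kb P) (fun K M => coefPD P M K).

Definition sharpPD P : PsiD A := ddaggerPD (daggerPD P).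

(* Bethe algebra generators in a representation.
   beta i : A is the image of beta_i (times identity), E i j s : A is the
   image of e_{ij} (x) t^s.  Matrix entry (i,j):
     (d/dx - beta_i) delta_{ij} - e_{ji}(x),  e_{ji}(x) = sum_s (e_{ji} t^s) x^(-s-1). *)
Definition betheEntry (N : nat) (beta : 'I_N -> A) (E : 'I_N -> 'I_N -> nat -> A)
    (i j : 'I_N) : PsiD A :=
  mkPD 0 1 (fun K M =>
    if M == 1 then (if (K == 0) && (i == j) then 1 else 0)
    else if M == 0 then
      (if K == 0 then (if i == j then - beta i else 0)
       else if K < 0 then - E j i (absz (K + 1))   (* K = -s-1 *)
       else 0)
    else 0).

Definition rdetPD (N : nat) (Mx : 'I_N -> 'I_N -> PsiD A) : PsiD A :=
  \big[addPD/zeroPD]_(s : 'S_N)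
     scalePD ((-1) ^+ s) (\big[mulPD/onePD]_(i < N) Mx i (s i)).

Definition betheB (N : nat) (beta : 'I_N -> A) (E : 'I_N -> 'I_N -> nat -> A)
    (i : nat) (K : int) : A :=
  coefPD (rdetPD (betheEntry beta E)) K (N - i)%N%:Z.

End PsiDef.

(* The Grassmann algebra P_{kn}: basis = monomials xi_{c_1}...xi_{c_l} with
   c_1 < ... < c_l (order = enum_rank on 'I_k * 'I_n), indexed by subsets. *)
Section Grassmann.
Variables (C : fieldType) (k n : nat).

Definition Idx := ('I_k * 'I_n)%type.
Definition gdim : nat := #|{set Idx}|.
Definition gset (p : 'I_gdim) : {set Idx} := enum_val p.

Definition gsign (S : {set Idx}) (c : Idx) : C :=
  (-1) ^+ #|[set c' in S | (enum_rank c' < enum_rank c)%N]|.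

(* left multiplication by xi_c *)
Definition xiM (c : Idx) : 'M[C]_gdim :=
  \matrix_(p, q) (if (c \notin gset q) && (gset p == c |: gset q)
                  then gsign (gset q) c else 0).
(* left derivation d_c *)
Definition dM (c : Idx) : 'M[C]_gdim :=
  \matrix_(p, q) (if (c \in gset q) && (gset p == gset q :\ c)
                  then gsign (gset q) c else 0).

Definition in_weight (l : 'I_k -> nat) (m : 'I_n -> nat) (v : 'cV[C]_gdim) : Prop :=
  forall p, v p 0 != 0 ->
    (forall a, #|[set i | (a, i) \in gset p]| = l a) /\
    (forall i, #|[set a | (a, i) \in gset p]| = m i).

Definition piN (z : 'I_k -> C) (i j : 'I_n) (s : nat) : 'M[C]_gdim :=
  \sum_(a < k) (z a ^+ s) *: (xiM (a, i) *m dM (a, j)).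
Definition piK (al : 'I_n -> C) (a b : 'I_k) (s : nat) : 'M[C]_gdim :=
  \sum_(i < n) ((- al i) ^+ s) *: (xiM (a, i) *m dM (b, i)).

Definition BetheN (al : 'I_n -> C) (z : 'I_k -> C) (i : nat) (K : int) : 'M[C]_gdim :=
  betheB (fun j => (al j)%:M) (piN z) i K.
Definition BetheK (al : 'I_n -> C) (z : 'I_k -> C) (a : nat) (K : int) : 'M[C]_gdim :=
  betheB (fun b => (z b)%:M) (piK al) a K.

End Grassmann.

Section QE.
Variable R : realType.
Local Notation C := R[i].

Definition cexp (w : C) : C :=
  Complex (expR (complex.Re w) * cos (complex.Im w)) (expR (complex.Re w) * sin (complex.Im w)).

(* (d/dx)(p(x) e^{al x}) = (p' + al p)(x) e^{al x} *)
Definition qe_shift (al : C) (p : {poly C}) : {poly C} := p^`() + al *: p.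

(* r-th derivative at w of p(x) e^{al x} *)
Definition qe_der (al : C) (p : {poly C}) (r : nat) (w : C) : C :=
  cexp (al * w) * (iter r (qe_shift al) p).[w].

Variable n : nat.
Implicit Types (al : 'I_n -> C) (m : 'I_n -> nat) (q : 'I_n -> {poly C}).

(* dim V: V has basis q_i(x) e^{alpha_i x}, i with mu^(i) <> 0, i.e. m_i > 0 *)
Definition dimV m : nat := #|[set i | (0 < m i)%N]|.

Definition Vder al m q (c : 'I_n -> C) (r : nat) (w : C) : C :=
  \sum_(i < n | (0 < m i)%N) c i * qe_der (al i) (q i) r w.

(* e is an exponent of V at w: some f in V with f = const*(x-w)^e (1 + o(1)),
   const <> 0 *)
Definition exponent_at al m q (w : C) (e : nat) : Prop :=
  exists c : 'I_n -> C,
    (forall r, (r < e)%N -> Vder al m q c r w = 0) /\ Vder al m q c e w != 0.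

(* V = span{q_i e^{alpha_i x}} is a space of quasi-exponentials with data
   (mu, lambda; alpha, z), mu^(i) = (m_i), lambda^(a) = (1^{l_a}):
   deg q_i = (mu^(i))'_1 + mu^(i)_1 - 1 = m_i; at z_a with l_a <> 0 the
   exponents are M' + lambda^(a)_j - j (j = 1..M'); all other points are
   non-singular (exponents 0, ..., M'-1). *)
Definition is_qe_space (k : nat) al (z : 'I_k -> C) m (l : 'I_k -> nat) q : Prop :=
  (forall i, (0 < m i)%N -> size (q i) = (m i).+1) /\
  (forall a, (0 < l a)%N -> forall e : nat, exponent_at al m q (z a) e <->
       exists j : nat, [/\ (1 <= j)%N, (j <= dimV m)%N &
                           e = (dimV m + (j <= l a) - j)%N]) /\
  (forall w : C, (forall a, (0 < l a)%N -> w != z a) ->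
       forall e : nat, exponent_at al m q w e <-> (e < dimV m)%N).

Definition laurent_poly_mul (L : int -> C) (p : {poly C}) (K : int) : C :=
  \sum_(j < size p) L (K - j%:Z) * p`_j.

(* L is the expansion at infinity of a rational function p/q *)
Definition is_rat_laurent (L : int -> C) : Prop :=
  exists p qq : {poly C}, qq != 0 /\
    forall K, laurent_poly_mul L qq K = (if K < 0 then 0 else p`_(absz K)).

(* D is D_V: a monic differential operator of order M' = dim V with rational
   coefficients (expanded at infinity) whose kernel is V, i.e. which
   annihilates the basis q_i e^{alpha_i x} of V. *)
Definition is_DV (D : PsiD C) al m q : Prop :=
  [/\ forall K M, ((M < 0) || ((dimV m)%:Z < M)) -> coefPD D K M = 0,
      forall K, coefPD D K (dimV m)%:Z = (K == 0)%:R,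
      forall M, is_rat_laurent (fun K => coefPD D K M) &
      forall i, (0 < m i)%N -> forall K,
        \sum_(M < (dimV m).+1)
           laurent_poly_mul (fun K' => coefPD D K' M%:Z)
                            (iter M (qe_shift (al i)) (q i)) K = 0].

End QE.

(* Main.v *)
Require Import Defs.
From HB Require Import structures.
From mathcomp Require Import all_boot all_order all_algebra fingroup perm.
From mathcomp Require Import reals.
From mathcomp.analysis Require Import sequences exp trigo.
From mathcomp Require Import complex.
From mathcomp Require Import mpoly.
From mathcomp Require ssrcomplements.
From mathcomp Require Import boolp.
From mathcomp Require Import zify ring.
Import Order.TTheory GRing.Theory Num.Theory.
Local Open Scope ring_scope.

(* Write u_a = d/dx - z_a and y_i = x + alpha_i, so that [u_a, y_i] = 1, and let
   # be the automorphism x |-> d/dx, d/dx |-> -x.  Let D_k and D_n be the row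
   determinants generating the two Bethe algebras, with coefficients in the
   endomorphisms of the Grassmann algebra.  For all alpha and z,
     D_k (prod_a u_a)^-1 (D_n)^# = (-1)^n prod_i y_i.
   Modulo the left ideal of operators killing v, D_n is the scalar operator
   D_V^aug, and # preserves this ideal; solving the identity for D_k gives the
   theorem.  No genericity is needed, so the polynomial P is 1.

   The identity is rdet K * rdet L = prod_i y_i * prod_a u_a with
     K_ab = u_a delta_ab - sum_i y_i^-1 xi_bi d_ai,
     L_ij = y_i delta_ij - sum_a u_a^-1 d_ai xi_aj,
   the two Schur complements of a super Manin matrix.  Adjoin odd elements
   psi_a, chi_i and central elements s_i, and put
     phi_a = u_a psi_a + sum_i d_ai s_i,
     theta_i = y_i s_i - sum_b xi_bi psi_b,
     kap_j = sum_i L_ji chi_i.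
   The phi's anticommute, the kap's anticommute, and the theta's commute with
   the phi's.  Switching on the s_i one at a time changes
     prod_a phi_a * prod_j (kap_j or y_j chi_j)
   only by elements of the right ideal spanned by the theta_i.  The
   substitution s_i |-> y_i^-1 sum_b xi_bi psi_b kills this right ideal and
   turns prod_a phi_a into rdet K * prod_a psi_a. *)

(** * Integer binomial identities *)

Section IntegerBinomials.
Implicit Types a b c m k : int.

(** Odd generators help since a row determinant is the coefficient of a product of row sums, and
    such products are reordered through anticommutators. The [s_i] stand for
    [y_i^-1 sum_b xi_bi psi_b]. They are kept as indeterminates because each stage of the argument
    first gives an equality multiplied by some [s_i]: an indeterminate can be cancelled, whereas its
    value is nilpotent. The price is a substitution whose values do not commute with the
    coefficients. It is additive, and multiplicative for left factors whose value commutes with all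
    substituted elements; the [phi_a] meet this condition, and so do the two terms that make up
    [theta_i]. The passage from [(D_n)^#] to [L] has its own obstacle, the order of [xi] and [d] in
    the entries; the correction is absorbed by conjugation with [prod_a u_a]. At the end [psi] and
    [chi] are realised in a second Grassmann algebra, twisted by the parity of the first; some entry
    of their full product is invertible, so the wedge can be removed. *)

Lemma ffz0 m : ffz m 0 = 1.
Proof. by rewrite /ffz big_ord0. Qed.

Lemma ffzSr m r : ffz m r.+1 = ffz m r * (m - r%:Z).
Proof. by rewrite /ffz big_ord_recr. Qed.

Lemma ffzD m r q : ffz m (r + q) = ffz m r * ffz (m - r%:Z) q.
Proof.
elim: q => [|q IH]; first by rewrite addn0 ffz0 mulr1.
by rewrite addnS !ffzSr IH -mulrA; congr (_ * (_ * _)); rewrite PoszD opprD addrA.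
Qed.

Lemma ffzSl m r : ffz m r.+1 = m * ffz (m - 1) r.
Proof. by rewrite -add1n ffzD ffzSr ffz0 subr0 mul1r. Qed.

Lemma ffz_pascal m r : ffz (m + 1) r.+1 = ffz m r.+1 + r.+1%:Z * ffz m r.
Proof.
rewrite ffzSl addrK ffzSr mulrC -[r.+1]addn1 PoszD.
rewrite [(r%:Z + _) * _]mulrC -mulrDr; congr (_ * _).
by rewrite addrA subrK.
Qed.

(** Exponents range over all integers, so Pascal's rule has to be run both upwards and downwards
    from zero. *)
Lemma int_bidir (P : int -> Prop) :
  P 0 -> (forall a, P a <-> P (a + 1)) -> forall a, P a.
Proof.
move=> P0 PS; elim/int_rec => [//|n /PS|n Pn]; first by rewrite -addn1 PoszD.
by apply/PS; rewrite -addn1 PoszD opprD subrK.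
Qed.

(** Makes the integer division in [binz] exact. Pascal's rule carries divisibility from [m] to
    [m + 1] and back, starting at [m = 0], where the product has a zero factor. *)
Lemma dvdz_ffz m r : ((r`!)%:Z %| ffz m r)%Z.
Proof.
elim: r m => [|r IH] m; first by rewrite ffz0.
elim/int_bidir: m => [|a]; first by rewrite ffzSl mul0r dvdz0.
by rewrite ffz_pascal rpredDr // factS PoszM dvdz_mul // IH.
Qed.

Lemma binzK m r : binz m r * (r`!)%:Z = ffz m r.
Proof. exact: divzK (dvdz_ffz m r). Qed.

Lemma factz_neq0 r : (r`!)%:Z != 0.
Proof. by rewrite -lt0n fact_gt0. Qed.

Lemma binz0 m : binz m 0 = 1.
Proof. by apply: (mulIf (factz_neq0 0)); rewrite binzK ffz0 fact0. Qed.

Lemma binzS m r : binz (m + 1) r.+1 = binz m r.+1 + binz m r.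
Proof.
apply: (mulIf (factz_neq0 r.+1)); rewrite mulrDl !binzK ffz_pascal.
by rewrite factS PoszM mulrCA binzK.
Qed.

Lemma binz0n r : binz 0 r = (r == 0%N)%:R.
Proof.
case: r => [|r]; first by rewrite binz0.
by apply: (mulIf (factz_neq0 r.+1)); rewrite binzK ffzSl !mul0r.
Qed.

Lemma binz_trinomial b r v :
  binz b r * binz (b - r%:Z) v = binz b (r + v) * 'C(r + v, r)%:Z.
Proof.
apply: (mulIf (factz_neq0 r)); apply: (mulIf (factz_neq0 v)).
transitivity (ffz b (r + v)).
  by rewrite ffzD -!binzK; rewrite -!mulrA; congr (_ * _); rewrite mulrCA.
rewrite -binzK -!mulrA; congr (_ * _).
by rewrite -!PoszM -(bin_fact (leq_addr v r)) addKn.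
Qed.

(** Both sides satisfy Pascal's rule in [a] and agree at [a = 0]. *)
Lemma binz_vandermonde a b s :
  binz (a + b) s = \sum_(t < s.+1) binz a t * binz b (s - t)%N.
Proof.
pose V c q := \sum_(t < q.+1) binz c t * binz b (q - t)%N.
have V0 c : V c 0%N = 1 by rewrite /V big_ord1 !binz0 mulr1.
have VS c q : V (c + 1) q.+1 = V c q.+1 + V c q.
  rewrite /V big_ord_recl [X in _ = X + _]big_ord_recl !binz0 -addrA; congr (_ + _).
  rewrite -big_split /=; apply: eq_bigr => i _.
  by rewrite /bump /= add1n binzS mulrDl subSS.
rewrite -[RHS]/(V a s); elim/int_bidir: a s => [s|a].
  rewrite add0r /V big_ord_recl big1 => [|i _]; last by rewrite binz0n mul0r.
  by rewrite binz0 mul1r subn0 addr0.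
split=> H.
  case=> [|s]; first by rewrite V0 binz0.
  by rewrite VS -!H addrAC binzS.
(* Downwards, Pascal's rule gives the value at [(a, s + 1)] from those at [(a + 1, s + 1)] and
   [(a, s)], hence the inner induction on [s]. *)
elim=> [|s IH]; first by rewrite V0 binz0.
have := H s.+1; rewrite VS addrAC binzS IH; exact: addIr.
Qed.

Lemma ffz_vandermonde a b s :
  ffz (a + b) s = \sum_(t < s.+1) 'C(s, t)%:Z * ffz a t * ffz b (s - t)%N.
Proof.
rewrite -binzK binz_vandermonde mulr_suml; apply: eq_bigr => t _.
rewrite -!binzK -(bin_fact (ltn_ord t : (t <= s)%N)) !PoszM.
rewrite -!mulrA [RHS]mulrCA; congr (_ * _); rewrite [LHS]mulrCA.
by congr (_ * _); rewrite mulrCA.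
Qed.

(** The coefficient of [x^(k-r) (d/dx)^(m-r)] in [(d/dx)^m x^k], that is, the weight of [r]
    contractions. *)
Definition wt m k (r : nat) : int := binz m r * ffz k r.

Lemma wtC m k r : wt m k r = wt k m r.
Proof.
apply: (mulIf (factz_neq0 r)).
by rewrite /wt mulrAC binzK mulrAC binzK mulrC.
Qed.

Lemma wt0 m k : wt m k 0 = 1.
Proof. by rewrite /wt binz0 ffz0. Qed.

Lemma wt0l k r : wt 0 k r = (r == 0%N)%:R.
Proof. by rewrite /wt binz0n; case: r => [|r]; rewrite ?ffz0 // mul0r. Qed.

Lemma wt0r k r : wt k 0 r = (r == 0%N)%:R.
Proof. by rewrite wtC wt0l. Qed.

Lemma wt1 m k : wt m k 1 = m * k.
Proof. by rewrite /wt -[1%N]/(1`!)%N -[binz m 1]mulr1 binzK !ffzSr !ffz0 !mul1r !subr0. Qed.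

Lemma wt_nat_gt (p r : nat) k : (p < r)%N -> wt p%:Z k r = 0.
Proof.
move=> pr; rewrite wtC /wt /ffz (bigD1 (Ordinal pr)) //= subrr mul0r.
by rewrite mulr0.
Qed.

(** In the symmetric form over [r + t + q = N] the order of summation can be exchanged. *)
Lemma sum_tri (V : nmodType) N (G : nat -> nat -> nat -> V) :
  \sum_(r < N.+1) \sum_(t < (N - r).+1) G r t (N - r - t)%N =
  \sum_(r < N.+1) \sum_(t < N.+1) \sum_(q < N.+1 | (r + t + q)%N == N) G r t q.
Proof.
apply: eq_bigr => r _; have rN := ltn_ord r.
pose F t := \sum_(q < N.+1 | (r + t + q)%N == N) G r t q.
rewrite (big_ord_widen N.+1 (fun t => G r t (N - r - t)%N)); last by rewrite ltnS leq_subr.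
rewrite [LHS]big_mkcond /=; apply: eq_bigr => t _; case: ltnP => ht.
  have hq : (N - r - t < N.+1)%N by rewrite ltnS -subnDA leq_subr.
  rewrite (big_pred1 (Ordinal hq)) // => q; apply/eqP/eqP => [E|->] /=; last by lia.
  by apply/val_inj => /=; lia.
by rewrite big_pred0 // => q; apply/negbTE/eqP; lia.
Qed.

(** Associativity of [(d/dx)^j * x^k (d/dx)^l * x^p], read at a total of [N] contractions.
    Vandermonde turns both sides into one sum over [r + t + q = N], where [r] contractions join [j]
    to [k], [t] join [j] to [p], and [q] join [l] to [p]. *)
Lemma wt_assoc j k l p N :
  \sum_(r < N.+1) wt j k r * wt (j + l - r%:Z) p (N - r) =
  \sum_(q < N.+1) wt l p q * wt j (k + p - q%:Z) (N - q).
Proof.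
pose G r t q := binz j r * binz (j - r%:Z) t * binz l q * ffz k r * ffz p (t + q).
transitivity (\sum_(r < N.+1) \sum_(t < (N - r).+1) G r t (N - r - t)%N).
  apply: eq_bigr => r _; rewrite /wt addrAC binz_vandermonde mulr_suml mulr_sumr.
  apply: eq_bigr => t _; rewrite /G subnKC; last by rewrite -ltnS.
  timeout 20 ring.
transitivity (\sum_(q < N.+1) \sum_(r < (N - q).+1) G r (N - q - r)%N q); last first.
  apply: eq_bigr => q _; rewrite /wt -addrA ffz_vandermonde !mulr_sumr.
  apply: eq_bigr => r _; rewrite /G addnC ffzD -!mulrA.
  rewrite [LHS]mulrA binz_trinomial subnKC; last by rewrite -ltnS.
  timeout 20 ring.
rewrite sum_tri (sum_tri _ _ (fun q r t => G r t q)).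
rewrite [RHS]exchange_big /=; apply: eq_bigr => r _.
under eq_bigr => t _ do rewrite big_mkcond.
rewrite exchange_big /=; apply: eq_bigr => q _.
rewrite [RHS]big_mkcond; apply: eq_bigr => t _.
by rewrite addnC addnA.
Qed.

(** The coefficient of [t^w] in [(1+t)^(k+i) (1 - t/(1+t))^k = (1+t)^i]. The induction on [i] starts
    from [binz k w] times the expansion of [(1 - 1)^w]. *)
Lemma alt_binz_sum k i w :
  \sum_(r < w.+1) (-1) ^+ r * binz k r * binz (k + i - r%:Z) (w - r) = binz i w.
Proof.
pose S c q := \sum_(r < q.+1) (-1) ^+ r * binz k r * binz (k + c - r%:Z) (q - r).
have S0 c : S c 0%N = 1 by rewrite /S big_ord1 !binz0 !mulr1.
have SS c q : S (c + 1) q.+1 = S c q.+1 + S c q.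
  rewrite /S big_ord_recr [X in _ = X + _]big_ord_recr /= subnn !binz0 addrAC.
  congr (_ + _); rewrite -big_split /=; apply: eq_bigr => r _.
  have rq : (r <= q)%N by rewrite -ltnS.
  rewrite -mulrDr (subSn rq) (_ : k + (c + 1) - _ = k + c - r%:Z + 1); last by lia.
  by rewrite binzS.
rewrite -/(S i w); elim/int_bidir: i w => [w|a].
  rewrite /S binz0n.
  under eq_bigr => r _.
    rewrite addr0 -mulrA binz_trinomial subnKC; last by rewrite -ltnS.
    over.
  transitivity (binz k w * \sum_(r < w.+1) (-1) ^+ r * 'C(w, r)%:Z).
    by rewrite mulr_sumr; apply: eq_bigr => r _; rewrite mulrCA.
  have -> : \sum_(r < w.+1) (-1) ^+ r * 'C(w, r)%:Z = 0 ^+ w.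
    rewrite -[0](subrr 1) exprDn; apply: eq_bigr => r _.
    by rewrite expr1n mul1r -natz mulr_natr.
  by case: w => [|w]; rewrite ?binz0 ?mulr1 // expr0n mulr0.
split=> H.
  case=> [|w]; first by rewrite S0 binz0.
  by rewrite SS !H binzS.
elim=> [|w IH]; first by rewrite S0 binz0.
have := H w.+1; rewrite SS binzS IH; exact: addIr.
Qed.

(** Multiplicativity of # on [x^i (d/dx)^j] and [x^k (d/dx)^l], without the signs common to both
    sides. On the left the product is normally ordered before # is applied; on the right
    [(d/dx)^i x^j (d/dx)^k x^l] is normally ordered. *)
Lemma wt_sharp i j k l N :
  \sum_(r < N.+1) (-1) ^+ r * wt j k r * wt (j + l - r%:Z) (i + k - r%:Z) (N - r) =
  \sum_(w < N.+1) wt i j w * wt (i + k - w%:Z) l (N - w).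
Proof.
pose G r u t := (-1) ^+ r * binz k r * ffz j (r + u) * ffz l t *
  binz (k + i - r%:Z) u * binz (k + i - (r + u)%N%:Z) t.
transitivity (\sum_(r < N.+1) \sum_(u < (N - r).+1) G r u (N - r - u)%N).
  apply: eq_bigr => r _; rewrite (wtC j k) (wtC (j + l - _)) /wt.
  rewrite [j + l - _]addrAC ffz_vandermonde !mulr_sumr; apply: eq_bigr => u _.
  have us : (u <= N - r)%N by rewrite -ltnS.
  have := binz_trinomial (k + i - r%:Z) u (N - r - u); rewrite subnKC // => E.
  rewrite /G ffzD PoszD opprD addrA [i + k]addrC.
  rewrite -[RHS]mulrA E; timeout 20 ring.
transitivity (\sum_(t < N.+1) \sum_(r < (N - t).+1) G r (N - t - r)%N t).
  rewrite sum_tri (sum_tri _ _ (fun t r u => G r u t)).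
  rewrite [RHS]exchange_big /=; apply: eq_bigr => r _.
  under [RHS]eq_bigr => t _ do rewrite big_mkcond.
  rewrite [RHS]exchange_big /=; apply: eq_bigr => u _.
  rewrite [LHS]big_mkcond; apply: eq_bigr => t _.
  by rewrite addnC addnA.
(* With [w = N - t], the factor [binz i w] expands by the alternating sum into the terms with
   [r + u = w]. *)
rewrite [RHS](reindex_inj rev_ord_inj) /=; apply: eq_bigr => t _.
have tN : (t <= N)%N by rewrite -ltnS.
rewrite subSS subKn // /wt -[binz i _](alt_binz_sum k) !mulr_suml.
apply: eq_bigr => r _.
have rw : (r <= N - t)%N by rewrite -ltnS.
by rewrite /G subnKC // [i + k]addrC; timeout 20 ring.
Qed.

End IntegerBinomials.

(** * The ring of pseudodifferential operators *)

Section DownwardSums.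
Variable A : pzRingType.
Implicit Types (F : int -> A) (T : int -> int -> nat -> A).

Lemma sum_down_widen F k (B D : nat) :
  (forall K, K <= k - B%:Z -> F K = 0) ->
  \sum_(i < B + D) F (k - i%:Z) = \sum_(i < B) F (k - i%:Z).
Proof.
move=> F0; rewrite big_split_ord /= [X in _ + X]big1 ?addr0 // => i _.
by apply: F0; lia.
Qed.

Lemma sum_down_shift F k (e B : nat) :
  (forall K, k < K -> F K = 0) ->
  \sum_(i < e + B) F (k + e%:Z - i%:Z) = \sum_(i < B) F (k - i%:Z).
Proof.
move=> F0; rewrite big_split_ord /= big1 ?add0r; last by move=> [i /= ie] _; apply: F0; lia.
by apply: eq_bigr => i _; congr F; lia.
Qed.

Lemma sum_down_le F k (e B B' : nat) :
  (forall K, K <= k - B%:Z \/ k < K -> F K = 0) ->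
  (forall K, K <= k + e%:Z - B'%:Z -> F K = 0) ->
  \sum_(i < B') F (k + e%:Z - i%:Z) = \sum_(i < B) F (k - i%:Z).
Proof.
move=> F0 F0'; rewrite -(sum_down_widen F _ _ (e + B)%N F0') addnCA.
rewrite (sum_down_shift F) => [|K kK]; last by apply: F0; right.
by rewrite addnC sum_down_widen // => K kK; apply: F0; left.
Qed.

Lemma sum_down_eq F k k' (B B' : nat) :
  (forall K, K <= k - B%:Z \/ k < K -> F K = 0) ->
  (forall K, K <= k' - B'%:Z \/ k' < K -> F K = 0) ->
  \sum_(i < B) F (k - i%:Z) = \sum_(i < B') F (k' - i%:Z).
Proof.
have gen a b (X Y : nat) : a <= b ->
    (forall K, K <= a - X%:Z \/ a < K -> F K = 0) ->
    (forall K, K <= b - Y%:Z \/ b < K -> F K = 0) ->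
    \sum_(i < Y) F (b - i%:Z) = \sum_(i < X) F (a - i%:Z).
  move=> ab Fa Fb; have E : b = a + (absz (b - a))%:Z by lia.
  by rewrite {1}E; apply: sum_down_le => // K h; apply: Fb; left; lia.
move=> F0 F0'; have [le|/ltW le] := leP k k'; last exact: gen.
by apply/esym; apply: gen.
Qed.

Lemma sum_down1 F k (B : nat) X :
  (forall K, K != X -> F K = 0) ->
  (forall K, K <= k - B%:Z \/ k < K -> F K = 0) ->
  \sum_(i < B) F (k - i%:Z) = F X.
Proof.
move=> F0 F1; have [kX|kX] := boolP ((X <= k - B%:Z) || (k < X)).
  rewrite (F1 X); last by apply/orP.
  by rewrite big1 // => -[i /= iB] _; apply: F0; apply/eqP => E; move/orP: kX; lia.
have hi : (absz (k - X) < B)%N by lia.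
rewrite (bigD1 (Ordinal hi)) //= big1 ?addr0; first by congr F; lia.
by move=> i /eqP ne; apply: F0; apply/eqP => E; apply: ne; apply/val_inj => /=; lia.
Qed.

(** A sum over all exponents [(K, M)] and contraction numbers [r], cut off at the corner [(k, m)]
    and the size [B]; [in_box] says that the cut loses nothing. *)
Definition box k m (B : nat) T : A :=
  \sum_(i < B) \sum_(j < B) \sum_(r < B) T (k - i%:Z) (m - j%:Z) r.

Definition in_box k m (B : nat) T :=
  forall K M (r : nat), T K M r != 0 ->
    [/\ K <= k, M <= m, k - K + r%:Z < B%:Z & m - M + r%:Z < B%:Z].

Lemma in_boxP k m B T K M r : in_box k m B T ->
  [|| k < K, m < M, B%:Z <= k - K + r%:Z | B%:Z <= m - M + r%:Z] -> T K M r = 0.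
Proof.
move=> TB h; apply: contraTeq h => /TB[h1 h2 h3 h4].
by rewrite !ltNge h1 h2 !leNgt h3 h4.
Qed.

(** Both boxes contain the whole support. Products may therefore be computed with whatever degree
    bounds are convenient. *)
Lemma box_eq k m B k' m' B' T :
  in_box k m B T -> in_box k' m' B' T -> box k m B T = box k' m' B' T.
Proof.
move=> TB TB'; rewrite /box.
pose G K := \sum_(j < B) \sum_(r < B) T K (m - j%:Z) r.
pose G' K := \sum_(j < B') \sum_(r < B') T K (m' - j%:Z) r.
have GE K : G K = G' K.
  pose H M := \sum_(r < B) T K M r; pose H' M := \sum_(r < B') T K M r.
  have HE M : H M = H' M.
    have gen k1 m1 b k2 m2 b' : in_box k1 m1 b T -> in_box k2 m2 b' T ->
        (b <= b')%N -> \sum_(r < b) T K M r = \sum_(r < b') T K M r.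
      move=> Tb Tb' le; rewrite (big_ord_widen b' (T K M)) // [LHS]big_mkcond.
      apply: eq_bigr => r _; case: ltnP => // br; apply/esym/eqP/negPn/negP => /Tb.
      by case; lia.
    have [le|/ltnW le] := leqP B B'; first exact: gen TB TB' le.
    by apply/esym; exact: gen TB' TB le.
  rewrite /G /G' (sum_down_eq H _ m' _ B'); first by apply: eq_bigr => j _; apply: HE.
    by move=> M h; rewrite /H big1 // => r _; apply: (in_boxP _ _ _ _ _ _ _ TB); lia.
  move=> M h; rewrite HE /H' big1 // => r _; apply: (in_boxP _ _ _ _ _ _ _ TB'); lia.
rewrite (sum_down_eq G _ k' _ B'); first by apply: eq_bigr => i _; apply: GE.
  move=> K h; rewrite /G big1 // => j _; rewrite big1 // => r _.
  by apply: (in_boxP _ _ _ _ _ _ _ TB); lia.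
move=> K h; rewrite GE /G' big1 // => j _; rewrite big1 // => r _.
by apply: (in_boxP _ _ _ _ _ _ _ TB'); lia.
Qed.

End DownwardSums.

(** * Operators as coefficient functions bounded above in both exponents *)

Section PseudoDifferentialRing.
Variable A : pzRingType.

Definition xbound (f : int -> int -> A) (k : int) := forall K M, k < K -> f K M = 0.
Definition dbound (f : int -> int -> A) (m : int) := forall K M, m < M -> f K M = 0.

(** In [PsiD] one operator has many representations, with different bounds. Here the bounds are
    hidden in a proposition, so equality of coefficients is equality and a ring structure can be
    declared. *)
Record psd := Psd {
  psc :> int -> int -> A;
  psc_bounded : exists k m, xbound psc k /\ dbound psc m }.

HB.instance Definition _ := gen_eqMixin psd.
HB.instance Definition _ := gen_choiceMixin psd.

Implicit Types f g h : psd.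

Lemma psdP f g : (forall K M, f K M = g K M) -> f = g.
Proof.
case: f g => [f fP] [g gP] /= fg.
have E : f = g by apply/funext => K; apply/funext => M; apply: fg.
by rewrite {f}E in fP fg *; congr Psd; apply: Prop_irrelevance.
Qed.

Lemma common_bounds (s : seq psd) :
  exists k m, forall f, f \in s -> xbound f k /\ dbound f m.
Proof.
elim: s => [|f s [k [m IH]]]; first by exists 0, 0.
have [k' [m' [fk fm]]] := psc_bounded f.
exists (Num.max k k'), (Num.max m m') => g; rewrite in_cons => /predU1P[->|/IH[gk gm]].
  by split=> K M h; [apply: fk | apply: fm]; move: h; rewrite gt_max => /andP[].
by split=> K M h; [apply: gk | apply: gm]; move: h; rewrite gt_max => /andP[].
Qed.

Lemma psd_add_bounded f g : exists k m,
  xbound (fun K M => f K M + g K M) k /\ dbound (fun K M => f K M + g K M) m.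
Proof.
have [k [m H]] := common_bounds [:: f; g].
have [|fk fm] := H f; first by rewrite !inE eqxx.
have [|gk gm] := H g; first by rewrite !inE eqxx orbT.
by exists k, m; split=> K M h; [rewrite fk // gk // addr0 | rewrite fm // gm // addr0].
Qed.

Lemma psd_opp_bounded f :
  exists k m, xbound (fun K M => - f K M) k /\ dbound (fun K M => - f K M) m.
Proof.
have [k [m [fk fm]]] := psc_bounded f.
by exists k, m; split=> K M h; [rewrite fk // oppr0 | rewrite fm // oppr0].
Qed.

Lemma psd_mono_bounded (a : A) k m : exists k' m',
  xbound (fun K M => if (K == k) && (M == m) then a else 0) k' /\
  dbound (fun K M => if (K == k) && (M == m) then a else 0) m'.
Proof.
exists k, m; split=> K M h; first by rewrite gt_eqF.
by rewrite andbC gt_eqF.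
Qed.

Definition psd_add f g := Psd _ (psd_add_bounded f g).
Definition psd_opp f := Psd _ (psd_opp_bounded f).
Definition mono a k m := Psd _ (psd_mono_bounded a k m).

Lemma psd_addA : associative psd_add.
Proof. by move=> f g h; apply: psdP => K M /=; rewrite addrA. Qed.
Lemma psd_addC : commutative psd_add.
Proof. by move=> f g; apply: psdP => K M /=; rewrite addrC. Qed.
Lemma psd_add0 : left_id (mono 0 0 0) psd_add.
Proof. by move=> f; apply: psdP => K M /=; rewrite if_same add0r. Qed.
Lemma psd_addN : left_inverse (mono 0 0 0) psd_opp psd_add.
Proof. by move=> f; apply: psdP => K M /=; rewrite if_same addNr. Qed.

HB.instance Definition _ :=
  GRing.isZmodule.Build psd psd_addA psd_addC psd_add0 psd_addN.

Lemma pscD f g K M : (f + g) K M = f K M + g K M. Proof. by []. Qed.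
Lemma pscN f K M : (- f) K M = - f K M. Proof. by []. Qed.
Lemma psc0 K M : (0 : psd) K M = 0. Proof. by rewrite /= if_same. Qed.
Lemma psc_sum (I : Type) (s : seq I) (P : pred I) (F : I -> psd) K M :
  (\sum_(i <- s | P i) F i) K M = \sum_(i <- s | P i) F i K M.
Proof. by apply: (big_morph (fun f : psd => f K M)) => //; apply: psc0. Qed.

(** The exponents [(K1, M1)] come from [f]; those of [g] are forced, since [r] contractions lower
    both exponents of the product by [r]. *)
Definition mul_term f g K M K1 M1 r : A :=
  f K1 M1 * g (K - K1 + r%:Z) (M - M1 + r%:Z) *
    (wt M1 (K - K1 + r%:Z) r)%:~R.

Lemma mul_term_in_box f g k m k' m' (B : nat) K M :
  xbound f k -> dbound f m -> xbound g k' -> dbound g m' ->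
  k + k' - K < B%:Z -> m + m' - M < B%:Z ->
  in_box A k m B (mul_term f g K M).
Proof.
move=> fk fm gk gm kB mB K1 M1 r; rewrite /mul_term => nz.
have fnz : f K1 M1 != 0 by apply: contraNneq nz => ->; rewrite !mul0r.
have gnz : g (K - K1 + r%:Z) (M - M1 + r%:Z) != 0.
  by apply: contraNneq nz => ->; rewrite mulr0 mul0r.
have h1 : K1 <= k by rewrite leNgt; apply: contraNN fnz => /fk->.
have h2 : M1 <= m by rewrite leNgt; apply: contraNN fnz => /fm->.
have h3 : K - K1 + r%:Z <= k' by rewrite leNgt; apply: contraNN gnz => /gk->.
have h4 : M - M1 + r%:Z <= m' by rewrite leNgt; apply: contraNN gnz => /gm->.
by split=> //; lia.
Qed.

Lemma psd_bounds f : {km : int * int | xbound f km.1 /\ dbound f km.2}.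
Proof. by apply: cid; have [k [m H]] := psc_bounded f; exists (k, m). Qed.
Definition psk f : int := (sval (psd_bounds f)).1.
Definition psm f : int := (sval (psd_bounds f)).2.
Lemma psk_bound f : xbound f (psk f).
Proof. by rewrite /psk; case: (psd_bounds f) => km []. Qed.
Lemma psm_bound f : dbound f (psm f).
Proof. by rewrite /psm; case: (psd_bounds f) => km []. Qed.

(** The bounds are arbitrary chosen ones; the size exceeds the drop from the top exponents to
    [(K, M)], which limits every contributing index. [psd_mul_funE] allows other bounds. *)
Definition psd_mul_fun f g (K M : int) :=
  box A (psk f) (psm f) (absz (psk f + psk g - K)%R + absz (psm f + psm g - M)%R).+1%N
    (mul_term f g K M).

Lemma psd_mul_funE f g k m k' m' (B : nat) K M :
  xbound f k -> dbound f m -> xbound g k' -> dbound g m' ->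
  k + k' - K < B%:Z -> m + m' - M < B%:Z ->
  psd_mul_fun f g K M = box A k m B (mul_term f g K M).
Proof.
move=> fk fm gk gm kB mB; apply: box_eq; last exact: (mul_term_in_box _ _ _ _ k' m').
by apply: (mul_term_in_box _ _ _ _ _ _ _ _ _ (psk_bound f) (psm_bound f)
  (psk_bound g) (psm_bound g)); lia.
Qed.

Lemma psd_mul_xbound f g k k' :
  xbound f k -> xbound g k' -> xbound (psd_mul_fun f g) (k + k').
Proof.
move=> fk gk K M h; rewrite /psd_mul_fun /box !big1 // => i _; rewrite big1 // => j _.
rewrite big1 // => r _; rewrite /mul_term.
set K1 := psk f - _; have [/fk->|le] := ltP k K1; first by rewrite !mul0r.
by rewrite gk ?mulr0 ?mul0r //; lia.
Qed.

Lemma psd_mul_dbound f g m m' :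
  dbound f m -> dbound g m' -> dbound (psd_mul_fun f g) (m + m').
Proof.
move=> fm gm K M h; rewrite /psd_mul_fun /box !big1 // => i _; rewrite big1 // => j _.
rewrite big1 // => r _; rewrite /mul_term.
set M1 := psm f - _; have [/fm->|le] := ltP m M1; first by rewrite !mul0r.
by rewrite gm ?mulr0 ?mul0r //; lia.
Qed.

Lemma psd_mul_bounded f g : exists k m,
  xbound (psd_mul_fun f g) k /\ dbound (psd_mul_fun f g) m.
Proof.
exists (psk f + psk g), (psm f + psm g).
by split; [apply: psd_mul_xbound; apply: psk_bound | apply: psd_mul_dbound; apply: psm_bound].
Qed.
Definition psd_mul f g := Psd _ (psd_mul_bounded f g).

Lemma psd_mulDl : left_distributive psd_mul psd_add.
Proof.
move=> f1 f2 g; apply: psdP => K M /=.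
have [k [m H]] := common_bounds [:: f1; f2; psd_add f1 f2; g].
have [|f1k f1m] := H f1; first by rewrite !inE eqxx.
have [|f2k f2m] := H f2; first by rewrite !inE eqxx !orbT.
have [|fk fm] := H (psd_add f1 f2); first by rewrite !inE eqxx !orbT.
have [|gk gm] := H g; first by rewrite !inE eqxx !orbT.
pose B := (absz (k + k - K)%R + absz (m + m - M)%R).+1%N.
rewrite !(psd_mul_funE _ _ k m k m B) //; try lia.
rewrite /box -big_split; apply: eq_bigr => i _; rewrite -big_split; apply: eq_bigr => j _.
by rewrite -big_split; apply: eq_bigr => r _; rewrite /mul_term /= !mulrDl.
Qed.

Lemma psd_mulDr : right_distributive psd_mul psd_add.
Proof.
move=> f g1 g2; apply: psdP => K M /=.
have [k [m H]] := common_bounds [:: g1; g2; psd_add g1 g2; f].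
have [|g1k g1m] := H g1; first by rewrite !inE eqxx.
have [|g2k g2m] := H g2; first by rewrite !inE eqxx !orbT.
have [|gk gm] := H (psd_add g1 g2); first by rewrite !inE eqxx !orbT.
have [|fk fm] := H f; first by rewrite !inE eqxx !orbT.
pose B := (absz (k + k - K)%R + absz (m + m - M)%R).+1%N.
rewrite !(psd_mul_funE _ _ k m k m B) //; try lia.
rewrite /box -big_split; apply: eq_bigr => i _; rewrite -big_split; apply: eq_bigr => j _.
by rewrite -big_split; apply: eq_bigr => r _; rewrite /mul_term /= mulrDr mulrDl.
Qed.

(** A monomial factor pins both exponents, so that only the number of contractions remains to be
    summed. *)
Lemma mono_mulE a i j g k m (B : nat) K M : xbound g k -> dbound g m ->
  i + k - K < B%:Z -> j + m - M < B%:Z ->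
  psd_mul (mono a i j) g K M =
    \sum_(r < B) a * g (K - i + r%:Z) (M - j + r%:Z) * (wt j (K - i + r%:Z) r)%:~R.
Proof.
move=> gk gm iB jB; have [ik jm] : xbound (mono a i j) i /\ dbound (mono a i j) j.
  split=> K1 M1 h /=; first by rewrite gt_eqF.
  by rewrite andbC gt_eqF.
rewrite /= (psd_mul_funE _ _ i j k m B) //.
pose F K1 M1 := \sum_(r < B) mul_term (mono a i j) g K M K1 M1 r.
have F0 K1 M1 : (K1 != i) || (M1 != j) -> F K1 M1 = 0.
  by rewrite /F -negb_and => /negbTE h; rewrite big1 // => r _; rewrite /mul_term /= h !mul0r.
have FB K1 M1 : (K1 <= i - B%:Z) || (M1 <= j - B%:Z) -> F K1 M1 = 0.
  move=> h; rewrite /F big1 // => r _.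
  by apply: (in_boxP _ _ _ _ _ _ _ _ (mul_term_in_box _ _ i j k m B _ _ _ _ _ _ _ _)) => //; lia.
rewrite /box (sum_down1 _ (fun K1 => \sum_(j0 < B) F K1 (j - j0%:Z)) _ _ i).
- rewrite (sum_down1 _ (F i) _ _ j); first by rewrite /F /mul_term /= !eqxx.
  + by move=> M1 h; apply: F0; rewrite h orbT.
  move=> M1 [h|h]; first by apply: FB; rewrite h orbT.
  by apply: F0; rewrite (gt_eqF h) orbT.
- by move=> K1 h; rewrite big1 // => j0 _; apply: F0; rewrite h.
move=> K1 [h|h]; rewrite big1 // => j0 _; first by apply: FB; rewrite h.
by apply: F0; rewrite (gt_eqF h).
Qed.

Lemma mul_monoE f c p q k m (B : nat) K M : xbound f k -> dbound f m ->
  k + p - K < B%:Z -> m + q - M < B%:Z ->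
  psd_mul f (mono c p q) K M =
    \sum_(r < B) f (K - p + r%:Z) (M - q + r%:Z) * c * (wt (M - q + r%:Z) p r)%:~R.
Proof.
move=> fk fm pB qB; have [pk qm] : xbound (mono c p q) p /\ dbound (mono c p q) q.
  split=> K1 M1 h /=; first by rewrite gt_eqF.
  by rewrite andbC gt_eqF.
rewrite /= (psd_mul_funE _ _ k m p q B) //.
pose T := mul_term f (mono c p q) K M.
have TB : in_box A k m B T by apply: (mul_term_in_box _ _ _ _ p q).
have T0 K1 M1 (r : nat) : (K1 != K - p + r%:Z) || (M1 != M - q + r%:Z) -> T K1 M1 r = 0.
  move=> h; rewrite /T /mul_term /=; case: ifP => [/andP[/eqP h1 /eqP h2]|_].
    by move: h; case/orP => /eqP; lia.
  by rewrite mulr0 mul0r.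
have T0' K1 M1 r : (K1 <= k - B%:Z) \/ (k < K1) -> T K1 M1 r = 0.
  by move=> h; apply: (in_boxP _ _ _ _ _ _ _ _ TB); lia.
have T0'' K1 M1 r : (M1 <= m - B%:Z) \/ (m < M1) -> T K1 M1 r = 0.
  by move=> h; apply: (in_boxP _ _ _ _ _ _ _ _ TB); lia.
transitivity (\sum_(r < B) \sum_(i < B) \sum_(j < B) T (k - i%:Z) (m - j%:Z) r).
  rewrite [RHS]exchange_big /=; apply: eq_bigr => i _.
  by rewrite [RHS]exchange_big.
apply: eq_bigr => r _.
rewrite (sum_down1 _ (fun K1 => \sum_(j < B) T K1 (m - j%:Z) r) _ _ (K - p + r%:Z)).
- rewrite (sum_down1 _ (fun M1 => T _ M1 r) _ _ (M - q + r%:Z)).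
  + rewrite /T /mul_term; have -> : K - (K - p + r%:Z) + r%:Z = p by lia.
    have -> : M - (M - q + r%:Z) + r%:Z = q by lia.
    by rewrite /= !eqxx.
  + by move=> M1 h; apply: T0; rewrite h orbT.
  by move=> M1 h; apply: T0''.
- by move=> K1 h; rewrite big1 // => j _; apply: T0; rewrite h.
by move=> K1 h; rewrite big1 // => j _; apply: T0'.
Qed.

Lemma mono_bound a i j : xbound (mono a i j) i /\ dbound (mono a i j) j.
Proof.
split=> K M h /=; first by rewrite gt_eqF.
by rewrite andbC gt_eqF.
Qed.

(* Monomials are dense: it suffices to check them for an additive functional
   that ignores operators of low degree in [x] or in [d/dx]. *)
Lemma psd_ind (Phi : psd -> A) (K0 M0 : int) :
  (forall f g, Phi (f + g) = Phi f + Phi g) ->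
  (forall f, xbound f K0 -> Phi f = 0) -> (forall f, dbound f M0 -> Phi f = 0) ->
  (forall a k m, Phi (mono a k m) = 0) -> forall f, Phi f = 0.
Proof.
move=> PhiD Phix Phid Phi1 f.
have Phi0 : Phi 0 = 0 by apply: Phi1.
have PhiS (I : Type) (s : seq I) (F : I -> psd) :
  Phi (\sum_(i <- s) F i) = \sum_(i <- s) Phi (F i) by apply: (big_morph Phi).
have [k [m [fk fm]]] := psc_bounded f.
(* [f] is cut into a part of low degree in [x], a part of low degree in [d/dx], and finitely many
   monomials above both thresholds. *)
pose g0 K M := if K <= K0 then f K M else 0.
have gb : exists k m, xbound g0 k /\ dbound g0 m.
  by exists k, m; split=> K M h; rewrite /g0; case: ifP => // _; [apply: fk | apply: fm].
pose h0 K M := if (K0 < K) && (M <= M0) then f K M else 0.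
have hb : exists k m, xbound h0 k /\ dbound h0 m.
  by exists k, m; split=> K M h; rewrite /h0; case: ifP => // _; [apply: fk | apply: fm].
pose B := (absz (k - K0)%R).+1%N; pose C := (absz (m - M0)%R).+1%N.
pose F (i : 'I_B) (j : 'I_C) : psd :=
  let K := k - (val i)%:Z in let M := m - (val j)%:Z in
  mono (if (K0 < K) && (M0 < M) then f K M else 0) K M.
have -> : f = Psd _ gb + Psd _ hb + \sum_i \sum_j F i j.
  apply: psdP => K M; rewrite !pscD psc_sum; under eq_bigr => i _ do rewrite psc_sum.
  pose G K1 M1 := if (K == K1) && (M == M1) then
      (if (K0 < K1) && (M0 < M1) then f K1 M1 else 0) else 0.
  have -> : \sum_i \sum_j F i j K M = G K M.
    have G0 K1 M1 : (K1 != K) || (M1 != M) -> G K1 M1 = 0.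
      by rewrite /G -negb_and eq_sym [M1 == _]eq_sym => /negbTE->.
    have G1 K1 M1 : (K1 <= K0) || (k < K1) || (M1 <= M0) || (m < M1) -> G K1 M1 = 0.
      rewrite /G; case: ifP => // _; case: ifP => // h1 h2.
      have [h|h] : k < K1 \/ m < M1 by lia.
        exact: fk.
      exact: fm.
    transitivity (\sum_(i < B) \sum_(j < C) G (k - i%:Z) (m - j%:Z)) => //.
    rewrite (sum_down1 _ (fun K1 => \sum_(j < C) G K1 (m - j%:Z)) _ _ K).
    - rewrite (sum_down1 _ (G K) _ _ M) // => M1 h; first by apply: G0; rewrite h orbT.
      by apply: G1; lia.
    - by move=> K1 h; rewrite big1 // => j _; apply: G0; rewrite h.
    by move=> K1 h; rewrite big1 // => j _; apply: G1; lia.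
  rewrite /= /G /g0 /h0 !eqxx /= !ltNge.
  by case: (K <= K0); case: (M <= M0); rewrite /= ?addr0 ?add0r.
rewrite !PhiD PhiS big1 ?addr0 => [|i _]; last by rewrite PhiS big1 // => j _; apply: Phi1.
rewrite Phix ?add0r; last by move=> K M h; rewrite /= /g0 leNgt h.
by rewrite Phid // => K M h; rewrite /= /h0 [M <= _]leNgt h andbF.
Qed.

Lemma mono_mul0 a i g K M : psd_mul (mono a i 0) g K M = a * g (K - i) M.
Proof.
pose B := (absz (i + psk g - K)%R + absz (psm g - M)%R).+1%N.
rewrite (mono_mulE _ _ _ _ (psk g) (psm g) B); try exact: psk_bound; try exact: psm_bound; try lia.
rewrite /B big_ord_recl big1 => [|r _]; last by rewrite wt0l mulr0.
rewrite wt0 mulr1 addr0; congr (_ * psc _ _ _) => /=; lia.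
Qed.

Lemma mul_mono0 f c q K M : psd_mul f (mono c 0 q) K M = f K (M - q) * c.
Proof.
pose B := (absz (psk f - K)%R + absz (psm f + q - M)%R).+1%N.
rewrite (mul_monoE _ _ _ _ (psk f) (psm f) B); try exact: psk_bound; try exact: psm_bound; try lia.
rewrite /B big_ord_recl big1 => [|r _]; last by rewrite wt0r mulr0.
rewrite wt0 mulr1 addr0; congr (psc _ _ _ * _) => /=; lia.
Qed.

Lemma sum_pick (F : nat -> A) (B r0 : nat) :
  (r0 < B)%N -> (forall r, (r < B)%N -> r != r0 -> F r = 0) -> \sum_(r < B) F r = F r0.
Proof.
move=> rB F0; rewrite (bigD1 (Ordinal rB)) //= big1 ?addr0 // => r ne.
by apply: F0.
Qed.

Lemma mono_monoE a b i j k l K M : psd_mul (mono a i j) (mono b k l) K M =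
  if (K <= i + k) && (i + k - K == j + l - M)
  then a * b * (wt j k (absz (i + k - K)%R))%:~R else 0.
Proof.
pose B := (absz (i + k - K)%R + absz (j + l - M)%R).+1%N.
have [kb lb] := mono_bound b k l.
rewrite (mono_mulE _ _ _ _ k l B) //; try lia.
have [/andP[h1 /eqP h2]|ne] := ifP.
  rewrite (sum_pick (fun r => a * mono b k l (K - i + r%:Z) (M - j + r%:Z) *
     (wt j (K - i + r%:Z) r)%:~R) B (absz (i + k - K)%R)); last 2 first.
  - by rewrite /B; lia.
  - move=> r _ rne /=; case: ifP => [/andP[/eqP h3 _]|]; last by rewrite mulr0 mul0r.
    by case/eqP: rne; lia.
  have -> : K - i + (absz (i + k - K)%R)%:Z = k by lia.
  have -> : M - j + (absz (i + k - K)%R)%:Z = l by lia.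
  by rewrite /= !eqxx.
rewrite big1 // => r _ /=; case: ifP => [/andP[/eqP h3 /eqP h4]|]; last by rewrite mulr0 mul0r.
by move/negbT/negP: ne; case; apply/andP; split; [|apply/eqP]; lia.
Qed.

Lemma intr_comm (w : int) (a : A) : w%:~R * a = a * w%:~R.
Proof. by apply: esym; apply: commr_int. Qed.

(** [N] is the common drop of the two exponents; where the drops differ, the coefficient is zero.
    Collecting the weights into one integer reduces associativity to [wt_assoc]. *)
Lemma mono3lE a b c i j k l p q K M :
  psd_mul (psd_mul (mono a i j) (mono b k l)) (mono c p q) K M =
  let N := i + k + p - K in
  if (0 <= N) && (N == j + l + q - M) then
    a * b * c * (\sum_(r < (absz N).+1)
       wt j k r * wt (j + l - r%:Z) p (absz N - r)%N)%:~R
  else 0.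
Proof.
set f := psd_mul (mono a i j) (mono b k l); cbv zeta; set N := i + k + p - K.
have [ak al] := mono_bound a i j; have [bk bl] := mono_bound b k l.
have fk : xbound f (i + k) by apply: psd_mul_xbound.
have fl : dbound f (j + l) by apply: psd_mul_dbound.
pose B := (absz N + absz (j + l + q - M)%R).+1%N.
rewrite (mul_monoE _ _ _ _ (i + k) (j + l) B) //; try by rewrite /B /N; lia.
under eq_bigr => s _ do rewrite /f mono_monoE.
have [/andP[h1 /eqP h2]|ne] := ifP; last first.
  rewrite big1 // => s _; case: ifP => [/andP[h3 /eqP h4]|]; last by rewrite !mul0r.
  by move/negbT/negP: ne; case; apply/andP; rewrite /N; split; [|apply/eqP]; lia.
have NB : ((absz N).+1 <= B)%N by rewrite /B; lia.
transitivity (\sum_(s < (absz N).+1) a * b * c *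
   (wt j k (absz N - s)%N * wt (j + l - (absz N - s)%N%:Z) p s)%:~R).
  rewrite (big_ord_widen B (fun s => a * b * c *
   (wt j k (absz N - s)%N * wt (j + l - (absz N - s)%N%:Z) p s)%:~R) NB) [RHS]big_mkcond.
  apply: eq_bigr => s _; case: ltnP => sN.
    case: ifP => [_|/negbT/negP[]]; last first.
      by apply/andP; move: h1 h2; rewrite /N; split; [|apply/eqP]; lia.
    have -> : absz (i + k - (K - p + s%:Z))%R = (absz N - s)%N by move: h1; rewrite /N; lia.
    have -> : M - q + s%:Z = j + l - (absz N - s)%N%:Z by move: h1 h2; rewrite /N; lia.
    by rewrite intrM -!mulrA intr_comm -!mulrA; congr (_ * (_ * (_ * _))); rewrite intr_comm.
  case: ifP => [/andP[h3 _]|]; last by rewrite !mul0r.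
  by move: h1 h3 sN; rewrite /N; lia.
rewrite -mulr_sumr; congr (_ * _); rewrite rmorph_sum [RHS](reindex_inj rev_ord_inj) /=.
apply: eq_bigr => s _; rewrite subSS subKn //; by rewrite -ltnS.
Qed.

Lemma mono3rE a b c i j k l p q K M :
  psd_mul (mono a i j) (psd_mul (mono b k l) (mono c p q)) K M =
  let N := i + k + p - K in
  if (0 <= N) && (N == j + l + q - M) then
    a * b * c * (\sum_(r < (absz N).+1)
       wt l p r * wt j (k + p - r%:Z) (absz N - r)%N)%:~R
  else 0.
Proof.
set f := psd_mul (mono b k l) (mono c p q); cbv zeta; set N := i + k + p - K.
have [ak al] := mono_bound b k l; have [bk bl] := mono_bound c p q.
have fk : xbound f (k + p) by apply: psd_mul_xbound.
have fl : dbound f (l + q) by apply: psd_mul_dbound.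
pose B := (absz N + absz (j + l + q - M)%R).+1%N.
rewrite (mono_mulE _ _ _ _ (k + p) (l + q) B) //; try by rewrite /B /N; lia.
under eq_bigr => s _ do rewrite /f mono_monoE.
have [/andP[h1 /eqP h2]|ne] := ifP; last first.
  rewrite big1 // => s _; case: ifP => [/andP[h3 /eqP h4]|]; last by rewrite mulr0 mul0r.
  by move/negbT/negP: ne; case; apply/andP; rewrite /N; split; [|apply/eqP]; lia.
have NB : ((absz N).+1 <= B)%N by rewrite /B; lia.
transitivity (\sum_(s < (absz N).+1) a * b * c *
   (wt l p (absz N - s)%N * wt j (k + p - (absz N - s)%N%:Z) s)%:~R).
  rewrite (big_ord_widen B (fun s => a * b * c *
   (wt l p (absz N - s)%N * wt j (k + p - (absz N - s)%N%:Z) s)%:~R) NB) [RHS]big_mkcond.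
  apply: eq_bigr => s _; case: ltnP => sN.
    case: ifP => [_|/negbT/negP[]]; last first.
      by apply/andP; move: h1 h2; rewrite /N; split; [|apply/eqP]; lia.
    have -> : absz (k + p - (K - i + s%:Z))%R = (absz N - s)%N by move: h1; rewrite /N; lia.
    have -> : K - i + s%:Z = k + p - (absz N - s)%N%:Z by move: h1 h2; rewrite /N; lia.
    by rewrite intrM !mulrA.
  case: ifP => [/andP[h3 _]|]; last by rewrite mulr0 mul0r.
  by move: h1 h3 sN; rewrite /N; lia.
rewrite -mulr_sumr; congr (_ * _); rewrite rmorph_sum [RHS](reindex_inj rev_ord_inj) /=.
apply: eq_bigr => s _; rewrite subSS subKn //; by rewrite -ltnS.
Qed.

Lemma mul_xbound f g k k' :
  xbound f k -> xbound g k' -> xbound (psd_mul f g) (k + k').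
Proof. exact: psd_mul_xbound. Qed.
Lemma mul_dbound f g m m' :
  dbound f m -> dbound g m' -> dbound (psd_mul f g) (m + m').
Proof. exact: psd_mul_dbound. Qed.

(** Density reduces the three factors to monomials one after the other; what is left is
    [wt_assoc]. *)
Lemma psd_mulA : associative psd_mul.
Proof.
move=> f g h; apply: psdP => K M; apply/eqP; rewrite -subr_eq0; apply/eqP.
(* With these thresholds, a first factor of degree at most [X] in [x], or at most [Y] in [d/dx],
   contributes nothing at [(K, M)]. *)
pose X := (- psk g - psk h + K - 1); pose Y := (- psm g - psm h + M - 1).
apply: (psd_ind (fun f => psd_mul f (psd_mul g h) K M - psd_mul (psd_mul f g) h K M) X Y).
- move=> f1 f2; rewrite !(psd_mulDl, pscD) opprD addrACA //.
- move=> f1 f1k; rewrite (mul_xbound _ _ X (psk g + psk h)) ?sub0r //.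
  + rewrite (mul_xbound _ _ (X + psk g) (psk h)) ?oppr0 //; try exact: psk_bound.
      by apply: mul_xbound => //; apply: psk_bound.
    by rewrite /X; lia.
  + by apply: mul_xbound; apply: psk_bound.
  by rewrite /X; lia.
- move=> f1 f1k; rewrite (mul_dbound _ _ Y (psm g + psm h)) ?sub0r //.
  + rewrite (mul_dbound _ _ (Y + psm g) (psm h)) ?oppr0 //; try exact: psm_bound.
      by apply: mul_dbound => //; apply: psm_bound.
    by rewrite /Y; lia.
  + by apply: mul_dbound; apply: psm_bound.
  by rewrite /Y; lia.
move=> a i j {f X Y}.
have [ai aj] := mono_bound a i j.
pose X := (- i - psk h + K - 1); pose Y := (- j - psm h + M - 1).
apply: (psd_ind (fun g => psd_mul (mono a i j) (psd_mul g h) K M -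
   psd_mul (psd_mul (mono a i j) g) h K M) X Y).
- by move=> g1 g2; rewrite !(psd_mulDl, psd_mulDr, pscD) opprD addrACA.
- move=> f1 f1k; rewrite (mul_xbound _ _ i (X + psk h)) ?sub0r //.
  + rewrite (mul_xbound _ _ (i + X) (psk h)) ?oppr0 //; try exact: psk_bound.
      by apply: mul_xbound.
    by rewrite /X; lia.
  + by apply: mul_xbound => //; apply: psk_bound.
  by rewrite /X; lia.
- move=> f1 f1k; rewrite (mul_dbound _ _ j (Y + psm h)) ?sub0r //.
  + rewrite (mul_dbound _ _ (j + Y) (psm h)) ?oppr0 //; try exact: psm_bound.
      by apply: mul_dbound.
    by rewrite /Y; lia.
  + by apply: mul_dbound => //; apply: psm_bound.
  by rewrite /Y; lia.
move=> b k l {g X Y}.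
have [bk bl] := mono_bound b k l.
pose X := (- i - k + K - 1); pose Y := (- j - l + M - 1).
apply: (psd_ind (fun h => psd_mul (mono a i j) (psd_mul (mono b k l) h) K M -
   psd_mul (psd_mul (mono a i j) (mono b k l)) h K M) X Y).
- by move=> g1 g2; rewrite !(psd_mulDr, pscD) opprD addrACA.
- move=> f1 f1k; rewrite (mul_xbound _ _ i (k + X)) ?sub0r //.
  + rewrite (mul_xbound _ _ (i + k) X) ?oppr0 //; first by apply: mul_xbound.
    by rewrite /X; lia.
  + by apply: mul_xbound.
  by rewrite /X; lia.
- move=> f1 f1k; rewrite (mul_dbound _ _ j (l + Y)) ?sub0r //.
  + rewrite (mul_dbound _ _ (j + l) Y) ?oppr0 //; first by apply: mul_dbound.
    by rewrite /Y; lia.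
  + by apply: mul_dbound.
  by rewrite /Y; lia.
move=> c p q {h X Y}.
by rewrite mono3rE mono3lE /= wt_assoc subrr.
Qed.

Lemma psd_mul1 : left_id (mono 1 0 0) psd_mul.
Proof. by move=> f; apply: psdP => K M; rewrite mono_mul0 mul1r subr0. Qed.
Lemma psd_mulr1 : right_id (mono 1 0 0) psd_mul.
Proof. by move=> f; apply: psdP => K M; rewrite mul_mono0 mulr1 subr0. Qed.

HB.instance Definition _ := GRing.Zmodule_isPzRing.Build psd
  psd_mulA psd_mul1 psd_mulr1 psd_mulDl psd_mulDr.

End PseudoDifferentialRing.

Arguments psc {A} _ _ _.
Arguments psdP {A f g} _.
Arguments mono {A} a k m.
Arguments xbound {A} f k.
Arguments dbound {A} f m.
Arguments box {A} k m B T.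

(** * The automorphism # *)

Section Sharp.
Variable A : pzRingType.
Implicit Types f g : psd A.

Lemma psd_mulE f g : f * g = psd_mul A f g. Proof. by []. Qed.
Lemma psd_1E : (1 : psd A) = mono 1 0 0. Proof. by []. Qed.

(** # sends [x^(M+r) (d/dx)^(K+r)] to [(-1)^(K+r) (d/dx)^(M+r) x^(K+r)]; this is the contribution of
    that monomial at [x^K (d/dx)^M], up to the symmetry of [wt]. *)
Definition sharp_term f (K M : int) (r : nat) : A :=
  ((-1) ^+ absz (K + r%:Z)%R * wt (K + r%:Z) (M + r%:Z) r)%:~R * f (M + r%:Z) (K + r%:Z).

Definition sharp_fun f (K M : int) : A :=
  \sum_(r < (absz (psk A f - M)%R).+1) sharp_term f K M r.

Lemma sharp_funE f k (B : nat) K M : xbound f k -> k - M < B%:Z ->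
  sharp_fun f K M = \sum_(r < B) sharp_term f K M r.
Proof.
move=> fk kB; rewrite /sharp_fun; set B' := (absz _).+1.
have gen (C D : nat) : k - M < C%:Z \/ psk A f - M < C%:Z -> (C <= D)%N ->
    \sum_(r < C) sharp_term f K M r = \sum_(r < D) sharp_term f K M r.
  move=> hC CD; rewrite (big_ord_widen D _ CD) [LHS]big_mkcond.
  apply: eq_bigr => r _; case: ltnP => // Cr; rewrite /sharp_term.
  case: hC => hC; first by rewrite fk ?mulr0 //; lia.
  by rewrite (psk_bound A f) ?mulr0 //; lia.
have [le|/ltnW le] := leqP B' B; first by apply: gen => //; right; rewrite /B'; lia.
by apply/esym/gen => //; left.
Qed.

Lemma sharp_fun_dbound f k : xbound f k -> dbound (sharp_fun f) k.
Proof.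
move=> fk K M h; rewrite /sharp_fun big1 // => r _.
by rewrite /sharp_term fk ?mulr0 //; lia.
Qed.

Lemma sharp_fun_xbound f m : dbound f m -> xbound (sharp_fun f) m.
Proof.
move=> fm K M h; rewrite /sharp_fun big1 // => r _.
by rewrite /sharp_term fm ?mulr0 //; lia.
Qed.

Lemma sharp_bounded f : exists k m, xbound (sharp_fun f) k /\ dbound (sharp_fun f) m.
Proof.
exists (psm A f), (psk A f).
by split; [apply/sharp_fun_xbound/psm_bound | apply/sharp_fun_dbound/psk_bound].
Qed.

Definition sharp f : psd A := Psd A _ (sharp_bounded f).

Lemma sharp_dbound f k : xbound f k -> dbound (sharp f) k.
Proof. exact: sharp_fun_dbound. Qed.
Lemma sharp_xbound f m : dbound f m -> xbound (sharp f) m.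
Proof. exact: sharp_fun_xbound. Qed.

Lemma sharpE f k (B : nat) K M : xbound f k -> k - M < B%:Z ->
  sharp f K M = \sum_(r < B) sharp_term f K M r.
Proof. exact: sharp_funE. Qed.

Lemma sharpD f g : sharp (f + g) = sharp f + sharp g.
Proof.
apply: psdP => K M; rewrite pscD.
have [k [m H]] := common_bounds A [:: f; g; f + g].
have [|fk _] := H f; first by rewrite !inE eqxx.
have [|gk _] := H g; first by rewrite !inE eqxx !orbT.
have [|fgk _] := H (f + g); first by rewrite !inE eqxx !orbT.
pose B := (absz (k - M)%R).+1%N; have kB : k - M < B%:Z by lia.
rewrite (sharpE _ _ _ _ _ fk kB) (sharpE _ _ _ _ _ gk kB) (sharpE _ _ _ _ _ fgk kB).
by rewrite -big_split; apply: eq_bigr => r _; rewrite /sharp_term pscD mulrDr.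
Qed.

Lemma mono_mul0l (a b : A) i k l : mono a i 0 * mono b k l = mono (a * b) (i + k) l.
Proof.
apply: psdP => K M; rewrite mono_mul0 /= (_ : (K - i == k) = (K == i + k)).
  by case: ifP; rewrite ?mulr0.
by rewrite subr_eq addrC.
Qed.

Lemma mono_mul0r (a b : A) i j l : mono a i j * mono b 0 l = mono (a * b) i (j + l).
Proof.
apply: psdP => K M; rewrite mul_mono0 /= (_ : (M - l == j) = (M == j + l)).
  by case: ifP; rewrite ?mul0r.
by rewrite subr_eq.
Qed.

Lemma sharp_monoE (a : A) i j K M : sharp (mono a i j) K M =
  if (M <= i) && (i - M == j - K)
  then ((-1) ^+ absz j * wt j i (absz (i - M)%R))%:~R * a else 0.
Proof.
have [ik _] := mono_bound A a i j.
rewrite (sharpE _ i (absz (i - M)%R).+1%N) //; last by lia.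
case: ifP => [/andP[h1 /eqP h2]|ne].
  rewrite (sum_pick _ (sharp_term (mono a i j) K M) _ (absz (i - M)%R)) //.
    rewrite /sharp_term; have -> : K + (absz (i - M)%R)%:Z = j by lia.
    have -> : M + (absz (i - M)%R)%:Z = i by lia.
    by rewrite /= !eqxx.
  move=> r _ rne; rewrite /sharp_term /=; case: ifP; last by rewrite mulr0.
  by case/andP => /eqP h3 _; case/eqP: rne; lia.
rewrite big1 // => r _; rewrite /sharp_term /=; case: ifP; last by rewrite mulr0.
case/andP => /eqP h3 /eqP h4; move/negbT/negP: ne; case; apply/andP.
by split; [|apply/eqP]; lia.
Qed.

Lemma sharp_mono (a : A) i j :
  sharp (mono a i j) = mono a 0 i * mono ((-1) ^+ absz j) j 0.
Proof.
apply: psdP => K M; rewrite sharp_monoE mono_monoE add0r addr0.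
have [/andP[h1 /eqP h2]|ne] := ifP.
  rewrite ifT; last by apply/andP; split; [|apply/eqP]; lia.
  rewrite -h2 wtC intrM rmorphXn rmorphN1 -mulrA !intr_comm mulrA; congr (_ * _).
  by rewrite -signr_odd; case: odd; rewrite ?expr0 ?expr1 ?mulrN1 ?mulN1r ?mulr1 ?mul1r.
rewrite ifF //; apply: contraFF ne => /andP[h1 /eqP h2].
by apply/andP; split; [|apply/eqP]; lia.
Qed.

Lemma signr_absz_sub (x : int) (r : nat) :
  (-1) ^+ absz (x - r%:Z)%R = (-1) ^+ absz x * (-1) ^+ r :> int.
Proof.
rewrite -exprD -signr_odd -[in RHS]signr_odd; congr (_ ^+ _).
have h : (2 %| absz (x - r%:Z)%R)%N = (2 %| absz x + r)%N by apply/idP/idP; lia.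
by move: h; rewrite !dvdn2 => /(congr1 negb); rewrite !negbK => ->.
Qed.

Lemma sharpM_mono (a b : A) i j k l :
  sharp (mono a i j * mono b k l) = sharp (mono a i j) * sharp (mono b k l).
Proof.
rewrite !sharp_mono mulrA -(mulrA (mono a 0 i)) mono_mul0l addr0 !psd_mulE.
apply: psdP => K M; rewrite mono3lE; cbv zeta; rewrite !addr0 add0r.
have [ak _] := mono_bound A a i j; have [bk _] := mono_bound A b k l.
have fk := mul_xbound A _ _ _ _ ak bk.
pose B := (absz (i + k - M)%R + absz (j + l - K)%R).+1%N.
rewrite (sharpE _ (i + k) B) //; last by lia.
under eq_bigr => s _ do rewrite /sharp_term mono_monoE.
have [/andP[h1 /eqP h2]|ne] := ifP; last first.
  rewrite big1 // => s _; case: ifP => [/andP[h3 /eqP h4]|]; last by rewrite mulr0.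
  by move/negbT/negP: ne; case; apply/andP; split; [|apply/eqP]; lia.
set N := absz (j + l - K)%R.
have NB : (N.+1 <= B)%N by rewrite /B /N; lia.
transitivity (\sum_(s < N.+1) a * b * ((-1) ^+ absz (j + l)%R * ((-1) ^+ (N - s) *
   wt j k (N - s) * wt (j + l - (N - s)%N%:Z) (i + k - (N - s)%N%:Z) s))%:~R).
  rewrite (big_ord_widen B (fun s => a * b * ((-1) ^+ absz (j + l)%R * ((-1) ^+ (N - s) *
   wt j k (N - s) * wt (j + l - (N - s)%N%:Z) (i + k - (N - s)%N%:Z) s))%:~R) NB).
  rewrite [RHS]big_mkcond /=; apply: eq_bigr => s _; case: ltnP => sN.
    rewrite ifT; last by apply/andP; move: h1 h2 sN; rewrite /N; split; [|apply/eqP]; lia.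
    have -> : absz (i + k - (M + s%:Z))%R = (N - s)%N by move: h1 h2; rewrite /N; lia.
    have -> : K + s%:Z = j + l - (N - s)%N%:Z by move: h1 sN; rewrite /N; lia.
    have -> : M + s%:Z = i + k - (N - s)%N%:Z by move: h1 h2 sN; rewrite /N; lia.
    rewrite intr_comm -mulrA -intrM signr_absz_sub; congr (_ * _%:~R); ring.
  case: ifP => [/andP[h3 _]|]; last by rewrite mulr0.
  by move: h1 h2 h3 sN; rewrite /N; lia.
rewrite -mulr_sumr -rmorph_sum -mulr_sumr -wt_sharp.
rewrite (reindex_inj rev_ord_inj) /=.
transitivity (a * b * (((-1) ^+ absz (j + l)%R) * \sum_(r < N.+1) (-1) ^+ r * wt j k r *
   wt (j + l - r%:Z) (i + k - r%:Z) (N - r))%:~R).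
  congr (_ * (_ * _)%:~R); apply: eq_bigr => s _; rewrite subSS subKn //.
  by rewrite -ltnS.
rewrite intrM mulrA; congr (_ * _).
have -> : (-1) ^+ absz (j + l)%R = (-1) ^+ absz j * (-1) ^+ absz l :> int.
  rewrite -exprD -signr_odd -[in RHS]signr_odd; congr (_ ^+ _).
  have h : (2 %| absz (j + l)%R)%N = (2 %| absz j + absz l)%N by apply/idP/idP; lia.
  by move: h; rewrite !dvdn2 => /(congr1 negb); rewrite !negbK => ->.
rewrite intrM !rmorphXn !rmorphN1 -!mulrA; congr (_ * _); rewrite !mulrA; congr (_ * _).
by rewrite -signr_odd; case: odd; rewrite ?expr0 ?expr1 ?mulrN1 ?mulN1r ?mulr1 ?mul1r.
Qed.

(** By density it suffices to treat monomials, where the claim is [wt_sharp]. As # exchanges the two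
    degrees, the threshold [X] in [x] is tuned to [M] and the threshold [Y] in [d/dx] to [K]. *)
Lemma sharpM f g : sharp (f * g) = sharp f * sharp g.
Proof.
apply: psdP => K M; apply/eqP; rewrite -subr_eq0; apply/eqP.
pose X := (M - psk A g - 1); pose Y := (K - psm A g - 1).
apply: (psd_ind A (fun f => sharp (f * g) K M - (sharp f * sharp g) K M) X Y).
- by move=> f1 f2; rewrite mulrDl !sharpD mulrDl !pscD opprD addrACA.
- move=> f1 f1k; rewrite (sharp_dbound _ (X + psk A g)) ?sub0r //.
  + rewrite (mul_dbound _ _ _ X (psk A g)) ?oppr0 //; first exact: sharp_dbound.
      by apply: sharp_dbound; apply: psk_bound.
    by rewrite /X; lia.
  + by apply: mul_xbound => //; apply: psk_bound.
  by rewrite /X; lia.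
- move=> f1 f1k; rewrite (sharp_xbound _ (Y + psm A g)) ?sub0r //.
  + rewrite (mul_xbound _ _ _ Y (psm A g)) ?oppr0 //; first exact: sharp_xbound.
      by apply: sharp_xbound; apply: psm_bound.
    by rewrite /Y; lia.
  + by apply: mul_dbound => //; apply: psm_bound.
  by rewrite /Y; lia.
move=> a i j {f X Y}.
have [ai aj] := mono_bound A a i j.
pose X := (M - i - 1); pose Y := (K - j - 1).
apply: (psd_ind A (fun g => sharp (mono a i j * g) K M -
  (sharp (mono a i j) * sharp g) K M) X Y).
- by move=> f1 f2; rewrite mulrDr !sharpD mulrDr !pscD opprD addrACA.
- move=> f1 f1k; rewrite (sharp_dbound _ (i + X)) ?sub0r //.
  + rewrite (mul_dbound _ _ _ i X) ?oppr0 //; try exact: sharp_dbound.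
    by rewrite /X; lia.
  + by apply: mul_xbound.
  by rewrite /X; lia.
- move=> f1 f1k; rewrite (sharp_xbound _ (j + Y)) ?sub0r //.
  + rewrite (mul_xbound _ _ _ j Y) ?oppr0 //; try exact: sharp_xbound.
    by rewrite /Y; lia.
  + by apply: mul_dbound.
  by rewrite /Y; lia.
by move=> b k l; rewrite sharpM_mono subrr.
Qed.

Lemma sharp_const (a : A) : sharp (mono a 0 0) = mono a 0 0.
Proof. by rewrite sharp_mono mono_mul0l expr0 mulr1. Qed.

Lemma sharp_x : sharp (mono 1 1 0) = mono 1 0 1.
Proof. by rewrite sharp_mono mono_mul0r expr0 mulr1 addr0. Qed.

Lemma sharp_d : sharp (mono 1 0 1) = - mono 1 1 0.
Proof.
rewrite sharp_mono mono_mul0l expr1 mul1r add0r; apply: psdP => K M.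
by rewrite pscN /=; case: ifP; rewrite ?oppr0.
Qed.

Lemma sharp1 : sharp 1 = 1. Proof. exact: sharp_const. Qed.
Lemma sharp0 : sharp 0 = 0. Proof. exact: sharp_const. Qed.
Lemma sharpN f : sharp (- f) = - sharp f.
Proof. by apply/eqP; rewrite -addr_eq0 -sharpD addNr sharp0. Qed.
Lemma sharpB : {morph sharp : f g / f - g}.
Proof. by move=> f g; rewrite sharpD sharpN. Qed.

HB.instance Definition _ := GRing.isZmodMorphism.Build _ _ sharp sharpB.
HB.instance Definition _ :=
  GRing.isMonoidMorphism.Build _ _ sharp (conj sharp1 sharpM).

Definition cst (a : A) : psd A := mono a 0 0.

Lemma cstB : {morph cst : a b / a - b}.
Proof. by move=> a b; apply: psdP => K M; rewrite pscD pscN /=; case: ifP; rewrite ?subr0. Qed.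
Lemma cstM : {morph cst : a b / a * b}.
Proof. by move=> a b; rewrite /cst mono_mul0l. Qed.

HB.instance Definition _ := GRing.isZmodMorphism.Build _ _ cst cstB.
HB.instance Definition _ :=
  GRing.isMonoidMorphism.Build _ _ cst (conj (erefl : cst 1 = 1) cstM).

Lemma cst_mulE a f K M : (cst a * f) K M = a * f K M.
Proof. by rewrite mono_mul0 subr0. Qed.
Lemma mul_cstE a f K M : (f * cst a) K M = f K M * a.
Proof. by rewrite mul_mono0 subr0. Qed.

Definition psx : psd A := mono 1 1 0.
Definition psD : psd A := mono 1 0 1.

Lemma psD_psx : psD * psx = psx * psD + 1.
Proof.
rewrite /psx mono_mul0l mul1r addr0; apply: psdP => K M; rewrite mono_monoE pscD /=.
have [/andP[h1 /eqP h2]|ne] := ifP; last first.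
  case: ifP => [/andP[/eqP h3 /eqP h4]|_]; last case: ifP => [/andP[/eqP h3 /eqP h4]|_].
  - by move/negbT/negP: ne; case; apply/andP; split; [|apply/eqP]; lia.
  - by move/negbT/negP: ne; case; apply/andP; split; [|apply/eqP]; lia.
  by rewrite addr0.
have [K1|hK] := eqVneq K 1.
  have -> : M = 1 by lia.
  by rewrite K1 /= wt0 addr0 !mulr1.
have [K0|hK'] := eqVneq K 0.
  have -> : M = 0 by lia.
  by rewrite K0 /= wt1 add0r !mulr1.
by rewrite (wt_nat_gt 1) ?mulr0z ?mulr0 /= ?addr0 //; lia.
Qed.

Lemma psx_cst a : psx * cst a = cst a * psx.
Proof. by rewrite /psx /cst !mono_mul0l mul1r mulr1 addr0 add0r. Qed.
Lemma psD_cst a : psD * cst a = cst a * psD.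
Proof. by rewrite /psD /cst mono_mul0r mono_mul0l mul1r mulr1 !add0r. Qed.

Section InverseOfLinear.
Variable z : A.

Definition inv_fun (K M : int) : A :=
  if (K < 0) && (M == 0) then z ^+ absz (K + 1)%R else 0.
Lemma inv_bounded : exists k m, xbound inv_fun k /\ dbound inv_fun m.
Proof.
exists 0, 0; split=> K M h; rewrite /inv_fun; last by rewrite andbC gt_eqF.
by rewrite ltNge ltW.
Qed.
(* The expansion at infinity of [1/(x - z)]. *)
Definition psinv : psd A := Psd A _ inv_bounded.

Lemma psinvK : (psx - cst z) * psinv = 1.
Proof.
apply: psdP => K M; rewrite mulrBl pscD pscN cst_mulE mono_mul0 mul1r /= /inv_fun.
have [_|_] := eqVneq M 0; last by rewrite !andbF mulr0 subr0.
rewrite !andbT; case: (ltrgt0P K) => h.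
- by rewrite ifF; [rewrite mulr0 subr0 | lia].
- rewrite ifT; last by lia.
  by rewrite -exprS; (have -> : absz (K - 1 + 1)%R = (absz (K + 1)%R).+1 by lia); rewrite subrr.
by rewrite h mulr0 subr0.
Qed.

Lemma psinvKr : psinv * (psx - cst z) = 1.
Proof.
apply: psdP => K M; rewrite mulrBr pscD pscN mul_cstE.
rewrite (_ : (psinv * psx) K M = psinv (K - 1) M); last first.
  have [ik im] : xbound psinv 0 /\ dbound psinv 0.
    split=> K1 M1 h; rewrite /= /inv_fun; last by rewrite andbC gt_eqF.
    by rewrite ltNge ltW.
  rewrite psd_mulE /psx (mul_monoE _ _ _ _ _ 0 0 (absz K + absz M).+2) //; try lia.
  rewrite big_ord_recl big1 => [|r _].
    by rewrite wt0 !mulr1 addr0; congr (psinv _ _) => /=; lia.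
  rewrite [psinv _ _]/= /inv_fun; case: eqVneq => [h|_]; last by rewrite andbF !mul0r.
  by rewrite h wt0l mulr0.
rewrite /= /inv_fun; have [_|_] := eqVneq M 0; last by rewrite !andbF mul0r subr0.
rewrite !andbT; case: (ltrgt0P K) => h.
- by rewrite ifF; [rewrite mul0r subr0 | lia].
- rewrite ifT; last by lia.
  by rewrite -exprSr; (have -> : absz (K - 1 + 1)%R = (absz (K + 1)%R).+1 by lia); rewrite subrr.
by rewrite h mul0r subr0.
Qed.

End InverseOfLinear.

End Sharp.

Arguments cst {A} a.
Arguments sharp {A} f.
Arguments psx {A}.
Arguments psD {A}.
Arguments psinv {A} z.

(** * Comparison with the representation PsiD *)

Section Link.
Variable A : pzRingType.
Implicit Types P Q : PsiD A.

Lemma coefPD_bounded P :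
  exists k m, xbound (coefPD P) k /\ dbound (coefPD P) m.
Proof.
exists (pd_kb P), (pd_mb P); split=> K M h; rewrite /coefPD; first by rewrite leNgt h.
by rewrite [M <= _]leNgt h andbF.
Qed.
Definition cls P : psd A := Psd A _ (coefPD_bounded P).

Lemma coef_mkPD kb mb (f : int -> int -> A) K M :
  coefPD (mkPD kb mb f) K M = if (K <= kb) && (M <= mb) then f K M else 0.
Proof.
rewrite /coefPD /mkPD /pd_kb /pd_mb /pd_c /=; case: ifP => // /andP[h1 h2].
by congr f; lia.
Qed.

Lemma cls_mono a k m : cls (monoPD a k m) = mono a k m.
Proof.
apply: psdP => K M; rewrite /= coef_mkPD; case: ifP => //.
by case: ifP => // /andP[/eqP-> /eqP->]; rewrite !lexx.
Qed.

Lemma cls_add P Q : cls (addPD P Q) = cls P + cls Q.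
Proof.
apply: psdP => K M; rewrite /= coef_mkPD !le_max; case: ifP => // /negbT.
rewrite negb_and !negb_or => h; rewrite /coefPD.
by case/orP: h => /andP[/negbTE-> /negbTE->]; rewrite ?andbF ?addr0.
Qed.

Lemma cls_scale a P : cls (scalePD a P) = cst a * cls P.
Proof.
apply: psdP => K M; rewrite cst_mulE /= coef_mkPD; case: ifP => // h.
by rewrite /coefPD h mulr0.
Qed.

Lemma coefPD_top P i j : coefPD P (pd_kb P - i%:Z) (pd_mb P - j%:Z) = pd_c P i j.
Proof. by rewrite /coefPD ifT; [congr pd_c; lia | lia]. Qed.

(** The triangular ranges of [mulPD] consist of the indices at which the second factor is within its
    bounds. Elsewhere [mul_term] vanishes, so the three sums can be widened to one box. *)
Lemma cls_mul P Q : cls (mulPD P Q) = cls P * cls Q.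
Proof.
apply: psdP => K M; rewrite psd_mulE.
have xP : xbound (cls P) (pd_kb P) by move=> K1 M1 h; rewrite /= /coefPD leNgt h.
have dP : dbound (cls P) (pd_mb P).
  by move=> K1 M1 h; rewrite /= /coefPD [M1 <= _]leNgt h andbF.
have xQ : xbound (cls Q) (pd_kb Q) by move=> K1 M1 h; rewrite /= /coefPD leNgt h.
have dQ : dbound (cls Q) (pd_mb Q).
  by move=> K1 M1 h; rewrite /= /coefPD [M1 <= _]leNgt h andbF.
have [h|ne] := boolP ((K <= pd_kb P + pd_kb Q) && (M <= pd_mb P + pd_mb Q)); last first.
  rewrite /= {1}/coefPD (negbTE ne); move: ne; rewrite negb_and -!ltNge.
  case/orP => h; first by rewrite (psd_mul_xbound _ _ _ _ _ xP xQ).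
  by rewrite (psd_mul_dbound _ _ _ _ _ dP dQ).
rewrite [LHS]/= /coefPD ifT // /pd_c /=.
set i := absz (pd_kb P + pd_kb Q - K)%R; set j := absz (pd_mb P + pd_mb Q - M)%R.
pose B := (maxn i j).+1.
have [iB jB] : (i < B)%N /\ (j < B)%N by rewrite /B !ltnS leq_maxl leq_maxr.
rewrite (psd_mul_funE _ _ _ (pd_kb P) (pd_mb P) (pd_kb Q) (pd_mb Q) B) //;
  try by move: h iB jB; rewrite /i /j; lia.
pose T := mul_term A (cls P) (cls Q) K M.
transitivity (\sum_(r < B) \sum_(i1 < B) \sum_(j1 < B)
    T (pd_kb P - i1%:Z) (pd_mb P - j1%:Z) r); last first.
  rewrite /box [LHS]exchange_big /=; apply: eq_bigr => i1 _.
  by rewrite [LHS]exchange_big.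
have T0 (i1 j1 r : nat) : ((i - r) < i1)%N || (i < r)%N || ((j - r) < j1)%N || (j < r)%N ->
    T (pd_kb P - i1%:Z) (pd_mb P - j1%:Z) r = 0.
  move=> hh; rewrite /T /mul_term.
  have [hK|hM] : (pd_kb Q < K - (pd_kb P - i1%:Z) + r%:Z) \/
       (pd_mb Q < M - (pd_mb P - j1%:Z) + r%:Z) by move: h hh; rewrite /i /j; lia.
    by rewrite xQ // mulr0 mul0r.
  by rewrite dQ // mulr0 mul0r.
have rB : ((minn i j).+1 <= B)%N by rewrite /B ltnS geq_min leq_maxl.
rewrite (big_ord_widen B (fun r => \sum_(i1 < (i - r).+1) \sum_(j1 < (j - r).+1)
   P.2 i1 j1 * Q.2 (i - r - i1)%N (j - r - j1)%N *
   (binz (pd_mb P - (j1 : nat)%:Z) r * ffz (pd_kb Q - (i - r - i1)%N%:Z) r)%:~R) rB).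
rewrite big_mkcond; apply: eq_bigr => r _; case: ltnP => hr; last first.
  rewrite big1 // => i1 _; rewrite big1 // => j1 _; apply: T0.
  by move: hr; rewrite gtn_min => /orP[->|->]; rewrite ?orbT.
have ir : ((i - r).+1 <= B)%N by lia.
rewrite (big_ord_widen B (fun i1 => \sum_(j1 < (j - r).+1)
   P.2 i1 j1 * Q.2 (i - r - i1)%N (j - r - j1)%N *
   (binz (pd_mb P - (j1 : nat)%:Z) r * ffz (pd_kb Q - (i - r - i1)%N%:Z) r)%:~R) ir).
rewrite big_mkcond; apply: eq_bigr => i1 _; case: ltnP => hi; last first.
  by rewrite big1 // => j1 _; apply: T0; rewrite hi.
have jr : ((j - r).+1 <= B)%N by lia.
rewrite (big_ord_widen B (fun j1 =>
   P.2 i1 j1 * Q.2 (i - r - i1)%N (j - r - j1)%N *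
   (binz (pd_mb P - (j1 : nat)%:Z) r * ffz (pd_kb Q - (i - r - i1)%N%:Z) r)%:~R) jr).
rewrite big_mkcond; apply: eq_bigr => j1 _; case: ltnP => hj; last first.
  by rewrite T0 // hj !orbT.
rewrite /T /mul_term /wt.
have -> : K - (pd_kb P - i1%:Z) + r%:Z = pd_kb Q - (i - r - i1)%N%:Z.
  by move: h hr hi; rewrite /i; lia.
have -> : M - (pd_mb P - j1%:Z) + r%:Z = pd_mb Q - (j - r - j1)%N%:Z.
  by move: h hr hj; rewrite /j; lia.
by rewrite [cls P _ _]/= [cls Q _ _]/= !coefPD_top.
Qed.

Lemma cls0 : cls zeroPD = 0.
Proof. by apply: psdP => K M; rewrite psc0 /= coef_mkPD; case: ifP. Qed.
Lemma cls1 : cls onePD = 1. Proof. exact: cls_mono. Qed.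
Lemma cls_const a : cls (constPD a) = cst a. Proof. exact: cls_mono. Qed.
Lemma cls_x : cls xPD = psx. Proof. exact: cls_mono. Qed.
Lemma cls_d : cls dPD = psD. Proof. exact: cls_mono. Qed.

Lemma cls_pow P e : cls (powPD P e) = cls P ^+ e.
Proof. by elim: e => [|e IH]; rewrite ?cls1 // exprS -IH -cls_mul. Qed.

Lemma cls_prod (I : Type) (s : seq I) (p : pred I) (F : I -> PsiD A) :
  cls (\big[mulPD/onePD]_(i <- s | p i) F i) = \prod_(i <- s | p i) cls (F i).
Proof. exact: (big_morph _ cls_mul cls1). Qed.

Lemma cls_sum (I : Type) (s : seq I) (p : pred I) (F : I -> PsiD A) :
  cls (\big[addPD/zeroPD]_(i <- s | p i) F i) = \sum_(i <- s | p i) cls (F i).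
Proof. exact: (big_morph _ cls_add cls0). Qed.

Lemma cls_eq P Q : eqPD P Q -> cls P = cls Q.
Proof. by move=> PQ; apply: psdP => K M; apply: PQ. Qed.

Lemma cls_sharp P : cls (sharpPD P) = sharp (cls P).
Proof.
apply: psdP => K M.
have xP : xbound (cls P) (pd_kb P) by move=> K1 M1 h; rewrite /= /coefPD leNgt h.
have dP : dbound (cls P) (pd_mb P).
  by move=> K1 M1 h; rewrite /= /coefPD [M1 <= _]leNgt h andbF.
rewrite [LHS]/= /sharpPD /ddaggerPD coef_mkPD /daggerPD coef_mkPD /=.
rewrite [(M <= _) && _]andbC; case: (boolP ((K <= _) && (M <= _))) => h; last first.
  move: h; rewrite negb_and -!ltNge => /orP[h|h].
    by rewrite (sharp_fun_xbound _ _ _ dP).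
  by rewrite (sharp_fun_dbound _ _ _ xP).
rewrite (sharp_funE _ _ (pd_kb P) (absz (pd_kb P - M)%R).+1) //; last by lia.
by apply: eq_bigr => r _; rewrite /sharp_term /wt mulrA.
Qed.

Definition rdet (R : pzRingType) N (M : 'I_N -> 'I_N -> R) : R :=
  \sum_(s : 'S_N) (-1) ^+ s * \prod_(i < N) M i (s i).

Lemma cls_rdet N (M : 'I_N -> 'I_N -> PsiD A) :
  cls (rdetPD M) = rdet _ N (fun i j => cls (M i j)).
Proof.
rewrite cls_sum; apply: eq_bigr => s _.
by rewrite cls_scale cls_prod rmorph_sign.
Qed.

End Link.

(** * Anticommuting elements and row determinants *)

Section Anticommutation.
Variable R : pzRingType.
Implicit Types x y z : R.

Definition anti x y := x * y + y * x.
Definition brack x y := x * y - y * x.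

Lemma antiC x y : anti x y = anti y x. Proof. exact: addrC. Qed.
Lemma antiDl x y z : anti (x + y) z = anti x z + anti y z.
Proof. by rewrite /anti mulrDl mulrDr addrACA. Qed.
Lemma antiDr x y z : anti z (x + y) = anti z x + anti z y.
Proof. by rewrite antiC antiDl !(antiC z). Qed.
Lemma antiNl x z : anti (- x) z = - anti x z.
Proof. by rewrite /anti mulNr mulrN opprD. Qed.
Lemma antiNr x z : anti z (- x) = - anti z x.
Proof. by rewrite antiC antiNl antiC. Qed.
Lemma anti0l z : anti 0 z = 0. Proof. by rewrite /anti mul0r mulr0 addr0. Qed.
Lemma anti_suml I (s : seq I) (P : pred I) (F : I -> R) z :
  anti (\sum_(i <- s | P i) F i) z = \sum_(i <- s | P i) anti (F i) z.
Proof. by apply: (big_morph (anti^~ z)) => [x y|]; rewrite ?antiDl ?anti0l. Qed.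
Lemma anti_sumr I (s : seq I) (P : pred I) (F : I -> R) z :
  anti z (\sum_(i <- s | P i) F i) = \sum_(i <- s | P i) anti z (F i).
Proof. by rewrite antiC anti_suml; apply: eq_bigr => i _; rewrite antiC. Qed.

Lemma anti0P x y : anti x y = 0 -> x * y = - (y * x).
Proof. by move/eqP; rewrite addr_eq0 => /eqP. Qed.

Lemma anti_mulCl x y z : GRing.comm x y -> anti x (y * z) = y * anti x z.
Proof. by move=> xy; rewrite /anti mulrDr !mulrA xy. Qed.
Lemma anti_mulCr x y z : GRing.comm x z -> anti x (y * z) = anti x y * z.
Proof. by move=> xz; rewrite /anti mulrDl -!mulrA xz. Qed.
Lemma brackDl x y z : brack (x + y) z = brack x z + brack y z.
Proof. by rewrite /brack mulrDl mulrDr opprD addrACA. Qed.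
Lemma brackDr x y z : brack z (x + y) = brack z x + brack z y.
Proof. by rewrite /brack mulrDl mulrDr opprD addrACA. Qed.
Lemma brackNr x z : brack z (- x) = - brack z x.
Proof. by rewrite /brack mulNr mulrN opprB opprK addrC. Qed.
Lemma brack0l z : brack 0 z = 0. Proof. by rewrite /brack mul0r mulr0 subr0. Qed.
Lemma brack0r z : brack z 0 = 0. Proof. by rewrite /brack mul0r mulr0 subr0. Qed.
Lemma brack_suml I (s : seq I) (P : pred I) (F : I -> R) z :
  brack (\sum_(i <- s | P i) F i) z = \sum_(i <- s | P i) brack (F i) z.
Proof. by apply: (big_morph (brack^~ z)) => [x y|]; rewrite ?brackDl ?brack0l. Qed.
Lemma brack_sumr I (s : seq I) (P : pred I) (F : I -> R) z :
  brack z (\sum_(i <- s | P i) F i) = \sum_(i <- s | P i) brack z (F i).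
Proof. by apply: (big_morph (brack z)) => [x y|]; rewrite ?brackDr ?brack0r. Qed.
Lemma brack_comm x y : GRing.comm x y <-> brack x y = 0.
Proof. by rewrite /brack; split=> [->|/eqP]; [rewrite subrr | rewrite subr_eq0 => /eqP]. Qed.
Lemma brack_mul x y z : brack x (y * z) = anti x y * z - y * anti x z.
Proof. by rewrite /brack /anti mulrDl mulrDr opprD addrA !mulrA addrK. Qed.
Lemma comm_anti_mul x y z : anti x y = 0 -> anti x z = 0 -> GRing.comm x (y * z).
Proof. by move=> xy xz; apply/brack_comm; rewrite brack_mul xy xz mul0r mulr0 subrr. Qed.

Lemma prod_mul_comm (I : Type) (s : seq I) (f g : I -> R) :
  (forall i j, GRing.comm (g i) (f j)) ->
  \prod_(i <- s) (f i * g i) = \prod_(i <- s) f i * \prod_(i <- s) g i.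
Proof.
move=> gf; elim: s => [|i s IH]; rewrite ?big_nil ?mulr1 // !big_cons IH -!mulrA.
congr (_ * _); rewrite !mulrA; congr (_ * _).
by apply: commr_prod => j _; apply: gf.
Qed.

(** The sign depends only on the position of [p]. Quantifying [f] and [x] after [e] allows the
    comparison of two products that differ at [p]. *)
Lemma prod_pull (I : eqType) (s : seq I) (P : pred I) p :
  uniq s -> p \in s -> P p -> exists e : nat, forall (f : I -> R) x,
    (forall j, j != p -> anti x (f j) = 0) ->
    \prod_(j <- s | P j) (if j == p then x else f j) =
    (-1) ^+ e * (x * \prod_(j <- s | P j && (j != p)) f j).
Proof.
elim: s => // i s IH /= /andP[nis us]; rewrite in_cons => /predU1P[->|ps] Pp.
  exists 0%N => f x _; rewrite !big_cons Pp !eqxx expr0 mul1r /=; congr (_ * _).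
  rewrite big_seq_cond [RHS]big_seq_cond; apply: eq_big => [j|j].
    by case js : (j \in s) => //=; rewrite (memPn nis) ?andbT.
  by case/andP=> js _; rewrite (negbTE (memPn nis _ js)).
have [e He] := IH us ps Pp; exists (P i + e)%N => f x xf.
have ip : i != p by apply: contraNneq nis => ->.
rewrite !big_cons (negbTE ip) /= andbT He //; case: (P i) => //=.
rewrite exprS mulN1r mulNr.
by rewrite (mulrA x (f i)) (anti0P _ _ (xf i ip)) mulNr mulrN opprK !mulrA commr_sign.
Qed.

Lemma prod_kill_l (I : eqType) (s : seq I) (P : pred I) (f : I -> R) p :
  (forall i j, anti (f i) (f j) = 0) -> (forall i, f i * f i = 0) ->
  p \in s -> P p -> f p * \prod_(j <- s | P j) f j = 0.
Proof.
move=> fa f0; elim: s => // i s IH; rewrite in_cons => /predU1P[<-|ps] Pp.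
  by rewrite big_cons Pp mulrA f0 mul0r.
rewrite big_cons; case: (P i); last exact: IH.
by rewrite mulrA (anti0P _ _ (fa _ _)) mulNr -mulrA IH // mulr0 oppr0.
Qed.

Lemma prod_kill_r (I : eqType) (s : seq I) (f : I -> R) p :
  (forall i j, anti (f i) (f j) = 0) -> (forall i, f i * f i = 0) ->
  p \in s -> (\prod_(j <- s) f j) * f p = 0.
Proof.
move=> fa f0; elim/last_ind: s => // s i IH; rewrite mem_rcons in_cons.
rewrite big_rcons /= -mulrA => /predU1P[<-|ps]; first by rewrite f0 mulr0.
by rewrite (anti0P _ _ (fa _ _)) mulrN mulrA IH // mul0r oppr0.
Qed.

Hypothesis half : forall x : R, x + x = 0 -> x = 0.

Section Wedge.
Variables (N : nat).
Implicit Types g : 'I_N -> R.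

(** Pulling both places to the front produces the same signs on the two sides and leaves
    [g j * g i = - (g i * g j)]. *)
Lemma prod_swap g i j : (forall a b, anti (g a) (g b) = 0) -> i != j ->
  \prod_k g (tperm i j k) = - \prod_k g k.
Proof.
move=> ga ij; have ji : j != i by rewrite eq_sym.
have [e1 H1] := prod_pull 'I_N (index_enum 'I_N) predT i
  (index_enum_uniq _) (mem_index_enum _) isT.
have [e2 H2] := prod_pull 'I_N (index_enum 'I_N) (fun k => k != i) j (index_enum_uniq _)
  (mem_index_enum _) ji.
have F x y : (forall k, anti x (g k) = 0) -> (forall k, anti y (g k) = 0) ->
    anti x y = 0 ->
    \prod_k (if k == i then x else if k == j then y else g k) =
    (-1) ^+ e1 * (x * ((-1) ^+ e2 * (y * \prod_(k | (k != i) && (k != j)) g k))).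
  move=> xg yg xy; rewrite -(H2 g y) => [|k _]; last exact: yg.
  rewrite (H1 (fun k => if k == j then y else g k) x) // => k _.
  by case: eqP.
have -> : \prod_k g k = \prod_k (if k == i then g i else if k == j then g j else g k).
  by apply: eq_bigr => k _; case: eqP => [->|_] //; case: eqP => [->|].
rewrite F //.
have -> : \prod_k g (tperm i j k) =
    \prod_k (if k == i then g j else if k == j then g i else g k).
  by apply: eq_bigr => k _; case: tpermP => [->|->|/eqP/negbTE-> /eqP/negbTE->];
     rewrite ?eqxx ?(negbTE ji).
rewrite F // -mulrN; congr (_ * _); rewrite !mulrA.
rewrite [g j * _]commr_sign [g i * _]commr_sign -!mulrA -mulrN; congr (_ * _).
by rewrite !mulrA (anti0P _ _ (ga j i)) !mulNr.
Qed.

Lemma prod_perm g (s : 'S_N) : (forall a b, anti (g a) (g b) = 0) ->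
  \prod_k g (s k) = (-1) ^+ s * \prod_k g k.
Proof.
move=> ga; have [ts -> dts] := prod_tpermP s.
elim: ts dts => [|[i j] ts IH] /= => [_|/andP[ij dts]].
  rewrite big_nil odd_perm1 mul1r; apply: eq_bigr => k _; by rewrite perm1.
rewrite big_cons /= odd_permM odd_tperm ij.
set t := (\prod_(_ <- ts) _)%g.
transitivity (\prod_k (fun k => g (t k)) (tperm i j k)).
  by apply: eq_bigr => k _; rewrite permM.
by rewrite (prod_swap (fun k => g (t k))) // IH // signr_addb mulN1r mulNr.
Qed.

(** Swapping two equal factors negates the product, so twice the product is zero. *)
Lemma prod_noninj g (f : 'I_N -> 'I_N) : (forall a b, anti (g a) (g b) = 0) ->
  ~~ injectiveb f -> \prod_k g (f k) = 0.
Proof.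
move=> ga /injectivePn[i [j ij fij]]; apply: half.
have := prod_swap (fun k => g (f k)) i j (fun a b => ga _ _) ij.
rewrite (eq_bigr (fun k => g (f k))) => [/eqP|k _]; first by rewrite -addr_eq0 => /eqP.
by case: tpermP => [->|->|] //; rewrite fij.
Qed.

(** The entries keep their row order while the [g]'s move to the right, which is why the row
    determinant appears. Column choices with a repetition vanish; permutations contribute their
    sign. *)
Lemma prod_rdet (M : 'I_N -> 'I_N -> R) g :
  (forall a b, anti (g a) (g b) = 0) -> (forall i j k, GRing.comm (g k) (M i j)) ->
  \prod_i \sum_j M i j * g j = rdet R N M * \prod_k g k.
Proof.
move=> ga gM; rewrite bigA_distr_bigA /=.
under eq_bigr => f _.
  rewrite (prod_mul_comm _ _ (fun i => M i (f i)) (fun i => g (f i))) //; over.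
rewrite (bigID (fun f : {ffun 'I_N -> 'I_N} => injectiveb f)) /= addrC big1 ?add0r => [|f Uf].
  rewrite (reindex (@pval _)) /=; last first.
    pose in_Sn := insubd (1%g : 'S_N).
    by exists in_Sn => /= f Uf; first apply: val_inj; apply: insubdK.
  rewrite /rdet mulr_suml; apply: eq_big => /= [s | s _]; rewrite ?(valP s) //.
  rewrite (eq_bigr (fun i => M i (s i))) => [|i _]; last by rewrite pvalE.
  rewrite [X in _ * X](eq_bigr (fun i => g (s i))) => [|i _]; last by rewrite pvalE.
  by rewrite prod_perm // !mulrA commr_sign.
by rewrite prod_noninj ?mulr0.
Qed.

End Wedge.
End Anticommutation.

Arguments anti {R} x y.
Arguments brack {R} x y.
Arguments rdet {R N} M.

(** * The duality identity *)

Section Duality.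
Variables (E R : pzRingType) (c : {rmorphism E -> R}) (k n : nat).
Variables (s : 'I_n -> R) (ev : R -> E).
Variables (u ui : 'I_k -> E) (y yi : 'I_n -> E).
Variables (xi dd : 'I_k -> 'I_n -> E) (psi : 'I_k -> E) (chi : 'I_n -> E).

Hypothesis halfE : forall x : E, x + x = 0 -> x = 0.
Hypothesis halfR : forall x : R, x + x = 0 -> x = 0.
Hypothesis s_central : forall i x, GRing.comm (s i) x.
Hypothesis s_reg : forall i x, s i * x = 0 -> x = 0.

Hypothesis uu : forall a b, GRing.comm (u a) (u b).
Hypothesis yy : forall i j, GRing.comm (y i) (y j).
Hypothesis uy : forall a i, u a * y i = y i * u a + 1.
Hypothesis uui : forall a, u a * ui a = 1.
Hypothesis uiu : forall a, ui a * u a = 1.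
Hypothesis yyi : forall i, y i * yi i = 1.
Hypothesis yiy : forall i, yi i * y i = 1.
Hypothesis u_xi : forall a b i, GRing.comm (u a) (xi b i).
Hypothesis u_dd : forall a b i, GRing.comm (u a) (dd b i).
Hypothesis u_psi : forall a b, GRing.comm (u a) (psi b).
Hypothesis u_chi : forall a i, GRing.comm (u a) (chi i).
Hypothesis y_xi : forall j b i, GRing.comm (y j) (xi b i).
Hypothesis y_dd : forall j b i, GRing.comm (y j) (dd b i).
Hypothesis y_psi : forall j b, GRing.comm (y j) (psi b).
Hypothesis y_chi : forall j i, GRing.comm (y j) (chi i).
Hypothesis xi_xi : forall a i b j, anti (xi a i) (xi b j) = 0.
Hypothesis dd_dd : forall a i b j, anti (dd a i) (dd b j) = 0.
Hypothesis dd_xi : forall a i b j,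
  anti (dd a i) (xi b j) = ((a == b) && (i == j))%:R.
Hypothesis psi_psi : forall a b, anti (psi a) (psi b) = 0.
Hypothesis chi_chi : forall i j, anti (chi i) (chi j) = 0.
Hypothesis psi_chi : forall a i, anti (psi a) (chi i) = 0.
Hypothesis psi_xi : forall a b i, anti (psi a) (xi b i) = 0.
Hypothesis psi_dd : forall a b i, anti (psi a) (dd b i) = 0.
Hypothesis chi_xi : forall j b i, anti (chi j) (xi b i) = 0.
Hypothesis chi_dd : forall j b i, anti (chi j) (dd b i) = 0.

Definition Xi i : E := \sum_b xi b i * psi b.
Definition Xc b : E := \sum_i xi b i * chi i.
Definition Kmat (a b : 'I_k) : E :=
  (if a == b then u a else 0) - \sum_i yi i * (xi b i * dd a i).
Definition Lmat (i j : 'I_n) : E :=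
  (if i == j then y i else 0) - \sum_a ui a * (dd a i * xi a j).

(** [R] stands for the polynomial ring over [E] in the [s i], and [ev] for the substitution of
    [yi i * Xi i], written to the left of the coefficients. [ev_row] is the restricted
    multiplicativity that such a substitution retains. *)
Hypothesis evD : forall p q, ev (p + q) = ev p + ev q.
Hypothesis evMr : forall p e, ev (p * c e) = ev p * e.
Hypothesis ev1 : ev 1 = 1.
Hypothesis ev_row : forall (e : E) (b : 'I_n -> E),
  (forall j, GRing.comm (e + \sum_i (yi i * Xi i) * b i) (yi j * Xi j)) ->
  forall p, ev ((c e + \sum_i s i * c (b i)) * p) =
     (e + \sum_i (yi i * Xi i) * b i) * ev p.
Hypothesis ev_s : forall i p, ev (s i * p) = (yi i * Xi i) * ev p.

(** * Commutation relations among the even and odd elements *)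

Lemma comm_inv (x z zi : E) : z * zi = 1 -> zi * z = 1 -> GRing.comm x z -> GRing.comm x zi.
Proof.
move=> h1 h2 xz; rewrite /GRing.comm -[x * zi]mul1r -h2 -!mulrA (mulrA z) -xz.
by rewrite -!mulrA h1 mulr1.
Qed.

Lemma ui_ui a b : GRing.comm (ui a) (ui b).
Proof.
apply: (comm_inv _ _ _ (uui b) (uiu b)); apply/commr_sym.
by apply: (comm_inv _ _ _ (uui a) (uiu a)).
Qed.
Lemma ui_xi a b i : GRing.comm (ui a) (xi b i).
Proof. by apply/commr_sym/(comm_inv _ _ _ (uui a) (uiu a))/commr_sym. Qed.
Lemma ui_dd a b i : GRing.comm (ui a) (dd b i).
Proof. by apply/commr_sym/(comm_inv _ _ _ (uui a) (uiu a))/commr_sym. Qed.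
Lemma ui_psi a b : GRing.comm (ui a) (psi b).
Proof. by apply/commr_sym/(comm_inv _ _ _ (uui a) (uiu a))/commr_sym. Qed.
Lemma ui_chi a b : GRing.comm (ui a) (chi b).
Proof. by apply/commr_sym/(comm_inv _ _ _ (uui a) (uiu a))/commr_sym. Qed.
Lemma yi_y i j : GRing.comm (yi i) (y j).
Proof. by apply/commr_sym/(comm_inv _ _ _ (yyi i) (yiy i)). Qed.
Lemma yi_yi i j : GRing.comm (yi i) (yi j).
Proof. by apply: (comm_inv _ _ _ (yyi j) (yiy j)); apply: yi_y. Qed.
Lemma yi_xi a b i : GRing.comm (yi a) (xi b i).
Proof. by apply/commr_sym/(comm_inv _ _ _ (yyi a) (yiy a))/commr_sym. Qed.
Lemma yi_dd a b i : GRing.comm (yi a) (dd b i).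
Proof. by apply/commr_sym/(comm_inv _ _ _ (yyi a) (yiy a))/commr_sym. Qed.
Lemma yi_psi a b : GRing.comm (yi a) (psi b).
Proof. by apply/commr_sym/(comm_inv _ _ _ (yyi a) (yiy a))/commr_sym. Qed.
Lemma brack_u_y a i : brack (u a) (y i) = 1.
Proof. by rewrite /brack uy addrC addrA addNr add0r. Qed.

Lemma brack_y_ui i a : brack (y i) (ui a) = ui a * ui a.
Proof.
have : ui a * (u a * y i) * ui a = ui a * (y i * u a + 1) * ui a by rewrite uy.
rewrite mulrDr mulr1 mulrDl !mulrA uiu mul1r -[_ * u a * ui a]mulrA uui mulr1.
by rewrite /brack => ->; rewrite addrC addrA addNr add0r.
Qed.

Lemma brack_u_yi a i : brack (u a) (yi i) = - (yi i * yi i).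
Proof.
have : yi i * (u a * y i) * yi i = yi i * (y i * u a + 1) * yi i by rewrite uy.
rewrite mulrDr mulr1 mulrDl !mulrA yiy mul1r -[_ * y i * yi i]mulrA yyi mulr1.
by rewrite /brack => ->; rewrite opprD addrA subrr add0r.
Qed.

Lemma dd_psi a b i : anti (dd b i) (psi a) = 0.
Proof. by rewrite antiC psi_dd. Qed.
Lemma dd_chi a b i : anti (dd b i) (chi a) = 0.
Proof. by rewrite antiC chi_dd. Qed.

Lemma dd_Xi a i j : brack (dd a j) (Xi i) = if i == j then psi a else 0.
Proof.
rewrite /Xi brack_sumr (bigD1 a) //= big1 ?addr0 => [|b ne].
  rewrite brack_mul dd_psi mulr0 subr0 dd_xi eqxx eq_sym /=.
  by case: (i == j); rewrite ?mul1r ?mul0r.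
by rewrite brack_mul dd_xi dd_psi mulr0 subr0 eq_sym (negbTE ne) mul0r.
Qed.

Lemma dd_Xc a b j : brack (dd a j) (Xc b) = if a == b then chi j else 0.
Proof.
rewrite /Xc brack_sumr (bigD1 j) //= big1 ?addr0 => [|i ne].
  rewrite brack_mul dd_chi mulr0 subr0 dd_xi eqxx andbT /=.
  by case: (a == b); rewrite ?mul1r ?mul0r.
rewrite brack_mul dd_xi dd_chi mulr0 subr0 eq_sym (eq_sym j).
by rewrite (negbTE ne) andbF mul0r.
Qed.

Lemma Xi_even x : (forall b i, anti x (xi b i) = 0) -> (forall b, anti x (psi b) = 0) ->
  forall i, GRing.comm x (Xi i).
Proof. by move=> xx xp i; apply: commr_sum => b _; apply: comm_anti_mul. Qed.

Lemma Xc_even x : (forall b i, anti x (xi b i) = 0) -> (forall b, anti x (chi b) = 0) ->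
  forall i, GRing.comm x (Xc i).
Proof. by move=> xx xp i; apply: commr_sum => b _; apply: comm_anti_mul. Qed.

Lemma Xi_Xi i j : GRing.comm (Xi i) (Xi j).
Proof.
apply/commr_sym/commr_sum => b _; apply: commrM; apply/commr_sym.
  by apply: Xi_even => *; rewrite ?xi_xi // antiC psi_xi.
by apply: Xi_even => *; rewrite ?psi_xi ?psi_psi.
Qed.

Lemma Xc_Xc i j : GRing.comm (Xc i) (Xc j).
Proof.
apply/commr_sym/commr_sum => b _; apply: commrM; apply/commr_sym.
  by apply: Xc_even => *; rewrite ?xi_xi // antiC chi_xi.
by apply: Xc_even => *; rewrite ?chi_xi ?chi_chi.
Qed.

Definition kap j : E := y j * chi j - \sum_b ui b * (dd b j * Xc b).

Lemma kapE j : kap j = \sum_i Lmat j i * chi i.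
Proof.
rewrite /kap /Lmat; under [RHS]eq_bigr => i _ do rewrite mulrBl.
rewrite sumrB; congr (_ - _).
  rewrite (bigD1 j) //= eqxx big1 ?addr0 // => i ne.
  by rewrite eq_sym (negbTE ne) mul0r.
under [RHS]eq_bigr => i _ do rewrite mulr_suml.
rewrite exchange_big; apply: eq_bigr => b _; rewrite /Xc !mulr_sumr.
by apply: eq_bigr => i _; rewrite !mulrA.
Qed.

Lemma ui_Xc a b : GRing.comm (ui a) (Xc b).
Proof. by apply: commr_sum => i _; apply: commrM; [apply: ui_xi | apply: ui_chi]. Qed.
Lemma y_Xc a b : GRing.comm (y a) (Xc b).
Proof. by apply: commr_sum => i _; apply: commrM. Qed.
Lemma chi_Xc a b : GRing.comm (chi a) (Xc b).
Proof. by apply: Xc_even. Qed.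
Lemma chi_ddXc a b j : anti (chi a) (dd b j * Xc b) = 0.
Proof. by rewrite anti_mulCr ?chi_dd ?mul0r //; apply: chi_Xc. Qed.

(** Moving [Xc] past [dd] costs a contraction to a [chi], and only for equal row indices; the
    uncontracted terms cancel because the [dd]'s anticommute. *)
Lemma anti_ddXc b i d j : anti (dd b i * Xc b) (dd d j * Xc d) =
  if b == d then chi j * (dd b i * Xc b) + chi i * (dd b j * Xc b) else 0.
Proof.
have E1 e f i' j' : (dd e i' * Xc e) * (dd f j' * Xc f) =
    dd e i' * dd f j' * (Xc e * Xc f) - dd e i' * (if f == e then chi j' else 0) * Xc f.
  by rewrite -(dd_Xc f e j') /brack mulrBr mulrBl opprB !mulrA addrCA subrr addr0.
rewrite /anti !E1 addrACA (Xc_Xc d b) -mulrDl -/(anti _ _) dd_dd mul0r add0r.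
have [->|_] := eqVneq b d; last by rewrite !mulr0 !mul0r oppr0 addr0.
by rewrite -opprD !(anti0P _ _ _ (dd_chi _ _ _)) !mulNr opprD !opprK !mulrA.
Qed.

Lemma chi_ui a b : GRing.comm (chi a) (ui b).
Proof. exact/commr_sym/ui_chi. Qed.
Lemma ui_ddXc a b i d : GRing.comm (ui a) (dd b i * Xc d).
Proof. by apply: commrM; [apply: ui_dd | apply: ui_Xc]. Qed.

(** The mixed terms contribute [Z i j + Z j i] through [[y_i, u_b^-1] = u_b^-2]; the quadratic terms
    contribute the same amount with the opposite sign through the contractions in [anti_ddXc]. *)
Lemma anti_kap i j : anti (kap i) (kap j) = 0.
Proof.
pose Z i j := \sum_b ui b * ui b * (chi i * (dd b j * Xc b)).
have AB i' j' : anti (y i' * chi i') (\sum_b ui b * (dd b j' * Xc b)) = Z i' j'.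
  rewrite anti_sumr; apply: eq_bigr => b _; set o := dd b j' * Xc b.
  have yo : GRing.comm (y i') o by apply: commrM; [apply: y_dd | apply: y_Xc].
  have uo : GRing.comm (ui b) o by apply: ui_ddXc.
  have co := anti0P _ _ _ (chi_ddXc i' b j'); rewrite -/o in co.
  clearbody o.
  rewrite -(brack_y_ui i' b) /anti /brack mulrBl.
  have -> : y i' * chi i' * (ui b * o) = y i' * ui b * (chi i' * o).
    by rewrite -!mulrA; congr (_ * _); rewrite !mulrA (ui_chi b i').
  congr (_ + _); rewrite -!mulrA (mulrA o) -yo -!mulrA co mulrN mulrN opprK.
  by [].
have BB : anti (\sum_b ui b * (dd b i * Xc b)) (\sum_b ui b * (dd b j * Xc b)) = Z j i + Z i j.
  rewrite anti_suml -big_split; apply: eq_bigr => b _.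
  have E1 d : anti (ui b * (dd b i * Xc b)) (ui d * (dd d j * Xc d)) =
      ui b * ui d * anti (dd b i * Xc b) (dd d j * Xc d).
    rewrite anti_mulCl; last by apply/commr_sym; apply: commrM; [apply: ui_ui | apply: ui_ddXc].
    rewrite antiC anti_mulCl; last exact/commr_sym/ui_ddXc.
    by rewrite antiC mulrA (ui_ui d b).
  rewrite anti_sumr (bigD1 b) //= big1 ?addr0 => [|d ne]; rewrite E1 anti_ddXc.
    by rewrite eqxx mulrDr.
  by rewrite eq_sym (negbTE ne) mulr0.
have AA : anti (y i * chi i) (y j * chi j) = 0.
  rewrite anti_mulCl ?[anti (y i * _) _]antiC ?anti_mulCl ?chi_chi ?mulr0 //.
    exact/commr_sym/y_chi.
  by apply/commr_sym/commrM; [apply: yy | apply: y_chi].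
rewrite /kap antiDl !antiDr !antiNl !antiNr opprK AB BB AA.
rewrite [anti (\sum_b _) (y j * _)]antiC AB add0r addKr addNr //.
Qed.

Lemma chi_kap i j : anti (chi i) (kap j) = 0.
Proof.
rewrite /kap antiDr antiNr anti_sumr big1 => [|b _].
  by rewrite subr0 anti_mulCl ?chi_chi ?mulr0 //; apply/commr_sym/y_chi.
by rewrite anti_mulCl ?chi_ddXc ?mulr0 //; apply: chi_ui.
Qed.

(** The value of [phi n a] under [s i |-> yi i * Xi i], as [phiKE] makes visible. *)
Definition phiK a : E := \sum_b Kmat a b * psi b.

Lemma Xi_dd a i : (yi i * Xi i) * dd a i = - \sum_b yi i * (xi b i * dd a i) * psi b.
Proof.
rewrite -sumrN /Xi mulr_sumr mulr_suml; apply: eq_bigr => b _.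
by rewrite -!mulrA -mulrN -mulrN (anti0P _ _ _ (dd_psi b a i)) opprK.
Qed.

Lemma phiKE a : phiK a = u a * psi a + \sum_i (yi i * Xi i) * dd a i.
Proof.
rewrite /phiK /Kmat; under eq_bigr => b _ do rewrite mulrBl.
rewrite sumrB; congr (_ + _).
  rewrite (bigD1 a) //= eqxx big1 ?addr0 // => b ne.
  by rewrite eq_sym (negbTE ne) mul0r.
under [RHS]eq_bigr => i _ do rewrite Xi_dd.
rewrite sumrN; congr (- _); rewrite exchange_big /=.
by apply: eq_bigr => b _; rewrite mulr_suml.
Qed.

Lemma psi_Xi a i : GRing.comm (psi a) (Xi i).
Proof. exact: Xi_even. Qed.
Lemma yi_Xi i j : GRing.comm (yi i) (Xi j).
Proof. by apply: commr_sum => b _; apply: commrM; [apply: yi_xi | apply: yi_psi]. Qed.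
Lemma y_Xi i j : GRing.comm (y i) (Xi j).
Proof. by apply: commr_sum => b _; apply: commrM. Qed.
Lemma u_Xi i j : GRing.comm (u i) (Xi j).
Proof. by apply: commr_sum => b _; apply: commrM. Qed.

Lemma yiXi_comm i j : GRing.comm (yi i * Xi i) (yi j * Xi j).
Proof.
apply: commrM; apply/commr_sym; apply: commrM.
- exact: yi_yi.
- exact: yi_Xi.
- exact/commr_sym/yi_Xi.
- exact: Xi_Xi.
Qed.

Lemma brackM2 (x z w : E) : brack x (z * w) = brack x z * w + z * brack x w.
Proof. by rewrite /brack mulrBl mulrBr !mulrA addrA subrK. Qed.
Lemma brackM1 (x z w : E) : brack (x * z) w = brack x w * z + x * brack z w.
Proof. by rewrite /brack mulrBl mulrBr !mulrA [RHS]addrC addrA subrK. Qed.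

(** The condition under which [ev_row] applies to [phi n a]. Two terms survive, from [[u_a, y_j^-1]
    = - y_j^-2] and from [[dd_aj, Xi_j] = psi_a], and they are opposite. *)
Lemma phiK_comm a j : GRing.comm (u a * psi a + \sum_i (yi i * Xi i) * dd a i) (yi j * Xi j).
Proof.
apply/brack_comm; rewrite brackDl brack_suml (bigD1 j) //= big1 ?addr0 => [|i ne].
  rewrite (brackM1 (u a)) (brackM1 (yi j * Xi j)).
  rewrite (proj1 (brack_comm _ _ _) (yiXi_comm j j)) mul0r add0r.
  rewrite !brackM2 brack_u_yi (proj1 (brack_comm _ _ _) (u_Xi a j)) mulr0 addr0.
  have -> : brack (psi a) (yi j) = 0 by apply/brack_comm/commr_sym/yi_psi.
  have -> : brack (psi a) (Xi j) = 0 by apply/brack_comm/psi_Xi.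
  have -> : brack (dd a j) (yi j) = 0 by apply/brack_comm/commr_sym/yi_dd.
  rewrite !mul0r !mulr0 dd_Xi eqxx !add0r mulr0 addr0 !mulNr -!mulrA addrC.
  by rewrite (mulrA (Xi j)) -(yi_Xi j j) -!mulrA subrr.
rewrite (brackM1 (yi i * Xi i)) (proj1 (brack_comm _ _ _) (yiXi_comm i j)) mul0r add0r brackM2.
have -> : brack (dd a i) (yi j) = 0 by apply/brack_comm/commr_sym/yi_dd.
by rewrite dd_Xi eq_sym (negbTE ne) mul0r mulr0 addr0 mulr0.
Qed.

(** * The stages of the product and the right ideal of the [theta i] *)

Definition phi (p : nat) a : R := c (u a * psi a) + \sum_(i < n | (i < p)%N) c (dd a i) * s i.
Definition Phi p : R := \prod_a phi p a.
Definition theta i : R := c (y i) * s i - c (Xi i).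

Lemma antiR (x z : E) : anti (c x) (c z) = c (anti x z).
Proof. by rewrite /anti rmorphD !rmorphM. Qed.
Lemma brackR (x z : E) : brack (c x) (c z) = c (brack x z).
Proof. by rewrite /brack rmorphB !rmorphM. Qed.
Lemma anti_sl i (x z : R) : anti (x * s i) z = anti x z * s i.
Proof. by rewrite /anti mulrDl -!mulrA (s_central i z). Qed.
Lemma anti_sr i (x z : R) : anti x (z * s i) = anti x z * s i.
Proof. by rewrite antiC anti_sl antiC. Qed.
Lemma brack_sl i (x z : R) : brack (x * s i) z = brack x z * s i.
Proof. by rewrite /brack mulrBl -!mulrA (s_central i z). Qed.
Lemma brack_sr i (x z : R) : brack x (z * s i) = brack x z * s i.
Proof. by rewrite /brack mulrBl -!mulrA (s_central i x). Qed.

Lemma anti_upsi a z : GRing.comm (u a) z -> anti (psi a) z = 0 -> anti (u a * psi a) z = 0.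
Proof. by move=> /commr_sym uz pz; rewrite antiC anti_mulCl // antiC pz mulr0. Qed.

Lemma anti_phi p a b : anti (phi p a) (phi p b) = 0.
Proof.
rewrite /phi antiDl !antiDr !anti_suml !anti_sumr antiR.
rewrite anti_upsi ?rmorph0 ?add0r; last 2 first.
- by apply: commrM; [apply: uu | apply: u_psi].
- by rewrite antiC anti_upsi //; apply: commr_sym.
rewrite big1 ?add0r => [|i _]; last by rewrite anti_sr antiR anti_upsi ?rmorph0 ?mul0r.
rewrite big1 ?add0r => [|i _]; last by rewrite anti_sl antiR antiC anti_upsi ?rmorph0 ?mul0r.
rewrite big1 // => i _; rewrite anti_sumr big1 // => j _.
by rewrite anti_sl anti_sr antiR dd_dd rmorph0 !mul0r.
Qed.

Lemma brack_u_psi_y a i : brack (u a * psi a) (y i) = psi a.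
Proof.
rewrite brackM1 brack_u_y mul1r (proj1 (brack_comm _ _ _) _) ?mulr0 ?addr0 //.
exact/commr_sym/y_psi.
Qed.

Lemma phi_Xi p a (i : 'I_n) : brack (phi p a) (c (Xi i)) = if (i < p)%N then c (psi a) * s i else 0.
Proof.
rewrite /phi brackDl brackR brackM1 (proj1 (brack_comm _ _ _) (u_Xi a i)).
rewrite (proj1 (brack_comm _ _ _) (psi_Xi a i)) mul0r mulr0 addr0 rmorph0 add0r.
rewrite brack_suml big_mkcond (bigD1 i) //= big1 ?addr0 => [|j ne].
  by rewrite brack_sl brackR dd_Xi eqxx.
rewrite brack_sl brackR dd_Xi eq_sym (negbTE ne) rmorph0 mul0r; by case: ifP.
Qed.

(** [[u_a psi_a, y_i s_i]] and [[dd_ai s_i, Xi_i]] are both [psi_a s_i] and cancel; the second one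
    is present once [s_i] is switched on. *)
Lemma phi_theta p a (i : 'I_n) : (i < p)%N -> GRing.comm (theta i) (phi p a).
Proof.
move=> ip; apply/commr_sym/brack_comm; rewrite /theta brackDr brackNr phi_Xi ip.
rewrite brack_sr /phi brackDl brackR brack_u_psi_y brack_suml big1 ?addr0 ?subrr // => j _.
rewrite brack_sl brackR (proj1 (brack_comm _ _ _) _) ?rmorph0 ?mul0r //.
exact/commr_sym/y_dd.
Qed.

(** Since [Phi p * phi p b = 0], to the right of [Phi p] the term [u_b psi_b] may be replaced by
    [- sum_(j < p) dd_bj s_j]. *)
Lemma Phi_Xi p i : Phi p * c (Xi i) =
  \sum_(j < n | (j < p)%N) Phi p * c (\sum_b ui b * (dd b j * xi b i)) * s j.
Proof.
have Phi0 b : Phi p * phi p b = 0.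
  apply: prod_kill_r; rewrite ?mem_index_enum //; first exact: anti_phi.
  by move=> a; apply: halfR; apply: anti_phi.
have E1 b : Phi p * c (u b * psi b) = - \sum_(j < n | (j < p)%N) Phi p * c (dd b j) * s j.
  have -> : \sum_(j < n | (j < p)%N) Phi p * c (dd b j) * s j =
      Phi p * \sum_(j < n | (j < p)%N) c (dd b j) * s j.
    by rewrite mulr_sumr; apply: eq_bigr => j _; rewrite mulrA.
  by apply/eqP; rewrite -addr_eq0 -mulrDr; apply/eqP/Phi0.
(* Inserting [u_b * ui_b = 1] creates the term [u_b psi_b] to be replaced. *)
have -> : Xi i = - \sum_b u b * psi b * (ui b * xi b i).
  rewrite -sumrN; apply: eq_bigr => b _.
  rewrite -mulrA (mulrA (psi b)) -(ui_psi b b) -mulrA mulrA uui mul1r.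
  by rewrite (anti0P _ _ _ (psi_xi _ _ _)) opprK.
rewrite rmorphN mulrN rmorph_sum mulr_sumr -sumrN.
under eq_bigr => b _ do rewrite rmorphM mulrA E1 mulNr opprK mulr_suml.
rewrite exchange_big /=; apply: eq_bigr => j _.
rewrite rmorph_sum mulr_sumr mulr_suml; apply: eq_bigr => b _.
rewrite -!mulrA (s_central j) (mulrA (c (dd b j))) -rmorphM.
by rewrite [dd b j * _]mulrA -(ui_dd b b j) -[ui b * _ * _]mulrA.
Qed.

Lemma theta_Phi p (i : 'I_n) : theta i * Phi p =
  (if (i < p)%N then Phi p * c (y i) * s i else c (y i) * s i * Phi p) - Phi p * c (Xi i).
Proof.
case: ifP => ip.
  have -> : theta i * Phi p = Phi p * theta i.
    by apply: commr_prod => a _; apply: phi_theta.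
  by rewrite /theta mulrBr mulrA.
have -> : Phi p * c (Xi i) = c (Xi i) * Phi p; last by rewrite /theta mulrBl.
apply/esym/commr_prod => a _; by apply/commr_sym/brack_comm; rewrite phi_Xi ip.
Qed.

(** This is where [kap] comes from: summed against the [chi i], the [Xi] terms of all [theta i]
    collect on the indices [j < p], where they complete [y_j chi_j] to [kap j]. *)
Lemma theta_Phi_chi p : \sum_i theta i * Phi p * c (chi i) =
  \sum_(j < n) if (j < p)%N then Phi p * c (kap j) * s j
                else c (y j) * s j * (Phi p * c (chi j)).
Proof.
have E1 : \sum_i Phi p * c (Xi i) * c (chi i) =
   \sum_(j < n | (j < p)%N) Phi p * c (\sum_b ui b * (dd b j * Xc b)) * s j.
  under eq_bigr => i _ do rewrite Phi_Xi mulr_suml.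
  rewrite exchange_big /=; apply: eq_bigr => j _.
  under eq_bigr => i _ do rewrite -mulrA (s_central j) mulrA -[Phi p * _ * c _]mulrA -rmorphM.
  rewrite -mulr_suml; congr (_ * _); rewrite -mulr_sumr -rmorph_sum.
  congr (_ * c _).
  rewrite (eq_bigr (fun i => \sum_b ui b * (dd b j * xi b i) * chi i)) => [|i _];
    last by rewrite mulr_suml.
  rewrite exchange_big; apply: eq_bigr => b _; rewrite /Xc !mulr_sumr.
  by apply: eq_bigr => i _; rewrite !mulrA.
under eq_bigr => i _ do rewrite theta_Phi mulrBl.
rewrite sumrB E1 [X in _ - X]big_mkcond -sumrB; apply: eq_bigr => j _.
case: ifP => jp; last by rewrite subr0 !mulrA.
by rewrite /kap rmorphB mulrBr mulrBl; congr (_ - _); rewrite rmorphM -!mulrA s_central.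
Qed.

Definition gfam (p : nat) (j : 'I_n) : E := if (j < p)%N then kap j else chi j.

Lemma anti_gfam p i j : anti (gfam p i) (gfam p j) = 0.
Proof.
rewrite /gfam; case: ifP => _; case: ifP => _; rewrite ?anti_kap ?chi_chi ?chi_kap //.
by rewrite antiC chi_kap.
Qed.

Definition ynat (j : nat) : E := if insub j is Some i then y i else 1.
Definition Ytail (p : nat) : E := \prod_(p <= j < n) ynat j.

Lemma Ytail_comm x p : (forall j, GRing.comm x (y j)) -> GRing.comm x (Ytail p).
Proof.
move=> xy; apply: commr_prod => j _; rewrite /ynat.
by case: insub => [i|]; [apply: xy | apply: commr1].
Qed.

(** Interpolates between the two sides of [duality_products]. The [y_j] belonging to the remaining
    [chi_j] are gathered on the far left. *)
Definition stage p : R := c (Ytail p) * Phi p * c (\prod_j gfam p j).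

Lemma Phi_step (p : 'I_n) : exists eps, Phi p.+1 = Phi p + s p * eps.
Proof.
rewrite /Phi; elim/big_rec2: _ => [|a x z _ [eps ->]]; first by exists 0; rewrite mulr0 addr0.
have E1 : phi p.+1 a = phi p a + s p * c (dd a p).
  rewrite /phi -addrA; congr (_ + _); rewrite (bigD1 p) //= addrC s_central; congr (_ + _).
  by apply: eq_bigl => j; rewrite ltnS -val_eqE /=; lia.
exists (phi p.+1 a * eps + c (dd a p) * x).
rewrite mulrDr {1}E1 mulrDl -addrA; congr (_ + _).
rewrite mulrDr addrC !mulrA; by rewrite (s_central p (phi p.+1 a)).
Qed.

(** Multiplied by [s p], the two stages become one and the same expression, evaluated at [Phi p.+1]
    and at [Phi p]. These differ by a multiple of [s p], which is then cancelled by regularity. *)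
Lemma stage_step (p : 'I_n) : exists w : 'I_n -> R,
  stage p.+1 = stage p + \sum_i theta i * w i.
Proof.
have [eps Peps] := Phi_step p.
have [e He] := prod_pull E 'I_n (index_enum 'I_n) predT p
  (index_enum_uniq _) (mem_index_enum _) isT.
(* [Q] collects the factors shared by both stages. *)
pose Q := \prod_(j | j != p) gfam p j.
have gE (q : nat) x : (q == p) || (q == p.+1) -> gfam q p = x ->
    \prod_j gfam q j = (-1) ^+ e * (x * Q).
  move=> hq gq; rewrite -(He (gfam p) x); last first.
    move=> j jp; rewrite -gq /gfam; case: ifP => _; case: ifP => _;
      by rewrite ?anti_kap ?chi_chi ?chi_kap // antiC chi_kap.
  apply: eq_bigr => j _; case: eqVneq => [->//|jp]; rewrite /gfam.
  suff -> : (j < q)%N = (j < p)%N by [].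
  by case/orP: hq => /eqP->; rewrite ?ltnS // ltn_neqAle -val_eqE in jp *; rewrite ?jp.
(* Such a factor already occurs in [Q]; hence multiplication by [Q] leaves only the summand [j = p]
   of [theta_Phi_chi]. *)
have kQ (j : 'I_n) : j != p -> gfam p j * Q = 0.
  move=> jp; apply: prod_kill_l; rewrite ?mem_index_enum //; first exact: anti_gfam.
  by move=> i; apply: halfE; apply: anti_gfam.
have Yp : Ytail p = y p * Ytail p.+1.
  by rewrite /Ytail big_ltn // /ynat valK.
pose Y1 := c (Ytail p.+1).
(* The coefficient of [theta i] that remains when [Phi p.+1 - Phi p = s p * eps] is divided by
   [s p]. *)
exists (fun i => (-1) ^+ e * Y1 * eps * c (chi i) * c Q).
have gp : gfam p p = chi p by rewrite /gfam ltnn.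
have gp1 : gfam p.+1 p = kap p by rewrite /gfam ltnSn.
have F1 : (\sum_i theta i * Phi p.+1 * c (chi i)) * c Q = Phi p.+1 * c (kap p) * s p * c Q.
  rewrite theta_Phi_chi mulr_suml (bigD1 p) //= ltnSn big1 ?addr0 // => j jp.
  have := kQ j jp; rewrite /gfam; case: ltnP => jlt h.
    have -> : (j < p.+1)%N by rewrite ltnS ltnW.
    by rewrite -mulrA (s_central j) mulrA -[_ * c _ * c _]mulrA -rmorphM h rmorph0 mulr0 mul0r.
  rewrite ifF; last by apply/negbTE; rewrite -leqNgt ltn_neqAle eq_sym val_eqE jp.
  by rewrite -!mulrA -rmorphM h rmorph0 !mulr0.
have F2 : (\sum_i theta i * Phi p * c (chi i)) * c Q = c (y p) * s p * (Phi p * c (chi p)) * c Q.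
  rewrite theta_Phi_chi mulr_suml (bigD1 p) //= ltnn big1 ?addr0 // => j jp.
  have := kQ j jp; rewrite /gfam; case: ltnP => jlt h.
    by rewrite -mulrA (s_central j) mulrA -[_ * c _ * c _]mulrA -rmorphM h rmorph0 mulr0 mul0r.
  by rewrite -!mulrA -rmorphM h rmorph0 !mulr0.
have S1 : s p * stage p.+1 = (-1) ^+ e * (Y1 * ((\sum_i theta i * Phi p.+1 * c (chi i)) * c Q)).
  rewrite F1 /stage (gE p.+1 _ _ gp1) ?eqxx ?orbT // rmorphM rmorph_sign rmorphM.
  by rewrite s_central -/Y1 -!mulrA (s_central p (c Q)) !mulrA commr_sign !mulrA.
have S2 : s p * stage p = (-1) ^+ e * (Y1 * ((\sum_i theta i * Phi p * c (chi i)) * c Q)).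
  rewrite F2 /stage (gE p _ _ gp) ?eqxx // rmorphM rmorph_sign rmorphM Yp rmorphM -/Y1.
  have yY : c (y p) * Y1 = Y1 * c (y p).
    by rewrite /Y1 -!rmorphM; congr (c _); apply: Ytail_comm.
  rewrite yY !mulrA commr_sign -!mulrA; congr (_ * _).
  by rewrite !mulrA -[s p * Y1 * _]mulrA s_central.
(* [theta i] has to reach the far left for the difference to lie in the right ideal. *)
have thY i : Y1 * theta i = theta i * Y1.
  rewrite /theta mulrBr mulrBl; congr (_ - _).
    rewrite -mulrA (s_central i Y1) !mulrA; congr (_ * _).
    by rewrite -!rmorphM; congr (c _); apply/esym/Ytail_comm.
  rewrite -!rmorphM; congr (c _); apply/esym/Ytail_comm => j; exact/commr_sym/y_Xi.
apply/eqP; rewrite -subr_eq0; apply/eqP/(s_reg p).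
rewrite mulrBr mulrDr S1 S2 opprD addrA -mulrBr -mulrBr -mulrBl -sumrB.
rewrite !mulr_suml !mulr_sumr -sumrB big1 // => i _.
rewrite Peps mulrDr mulrDl [_ + _ - _]addrAC subrr add0r.
apply/eqP; rewrite subr_eq0; apply/eqP; rewrite !mulrA.
rewrite (s_central p (theta i)) -[theta i * s p * _ in RHS]mulrA (s_central p) !mulrA.
rewrite commr_sign -!mulrA; congr (_ * _).
by rewrite !mulrA thY -!mulrA; congr (_ * _); rewrite !mulrA s_central.
Qed.

(** [ev] kills the right ideal of the [theta i], so it takes the same value on the first and on the
    last stage. *)
Lemma duality_products :
  \prod_a phiK a * \prod_j kap j = \prod_i y i * \prod_a (u a * psi a) * \prod_j chi j.
Proof.
have ev0 : ev 0 = 0 by apply: (addrI (ev 0)); rewrite -evD !addr0.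
have evN p : ev (- p) = - ev p by apply/eqP; rewrite -addr_eq0 -evD addNr ev0.
(* Both [y i] and [Xi i] commute with the substituted elements, so they pass through [ev], and
   [y_i (y_i^-1 Xi_i) = Xi_i]. *)
have ev_theta i p : ev (theta i * p) = 0.
  rewrite /theta mulrBl evD evN.
  have -> : c (y i) * s i * p = s i * (c (y i) * p) by rewrite -s_central mulrA.
  have evc e q : (forall j, GRing.comm e (yi j * Xi j)) -> ev (c e * q) = e * ev q.
    have E0 : \sum_i (yi i * Xi i) * 0 = 0 by rewrite big1 // => j _; rewrite mulr0.
    have E1 : \sum_i s i * c 0 = 0 by rewrite big1 // => j _; rewrite rmorph0 mulr0.
    by move=> h; have := ev_row e (fun=> 0); rewrite E0 E1 !addr0; apply.
  rewrite ev_s !evc.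
  - by rewrite mulrA -[yi i * _ * _]mulrA -y_Xi mulrA yiy mul1r subrr.
  - by move=> j; apply: commrM; [apply/commr_sym/commr_sym; exact/commr_sym/yi_Xi | exact: Xi_Xi].
  by move=> j; apply: commrM; [apply/commr_sym/yi_y | apply: y_Xi].
have ev_stage p : (p <= n)%N -> ev (stage p) = ev (stage 0).
  elim: p => // p IH pn; have [w Hw] := stage_step (Ordinal pn).
  rewrite [stage _]Hw evD (big_morph ev evD ev0) big1 ?addr0 => [|i _]; first exact/IH/ltnW.
  exact: ev_theta.
have := ev_stage n (leqnn n); rewrite /stage /Ytail big_geq // rmorph1 mul1r evMr.
have -> : \prod_j gfam n j = \prod_j kap j by apply: eq_bigr => j _; rewrite /gfam ltn_ord.
(* The factors are evaluated one by one from the left; [phiK_comm] provides the side condition of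
   [ev_row]. *)
have -> : ev (Phi n) = \prod_a phiK a.
  rewrite /Phi; elim/big_rec2: _ => [|a x z _ <-]; first exact: ev1.
  rewrite phiKE -ev_row; last exact: phiK_comm.
  congr (ev (_ * _)); rewrite /phi; congr (_ + _).
  by rewrite (eq_bigl predT) => [|i]; [apply: eq_bigr => i _; rewrite s_central | rewrite ltn_ord].
move=> ->.
have -> : Phi 0 = c (\prod_a (u a * psi a)).
  by rewrite rmorph_prod; apply: eq_bigr => a _; rewrite /phi big_pred0 ?addr0.
rewrite -!rmorphM -[c _]mul1r evMr ev1 mul1r big_mkord; congr (_ * _ * _).
by apply: eq_bigr => i _; rewrite /ynat valK.
Qed.

Lemma Lmat_even x i j : (forall a, GRing.comm x (ui a)) -> (forall i, GRing.comm x (y i)) ->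
  (forall a i, anti x (dd a i) = 0) -> (forall a i, anti x (xi a i) = 0) ->
  GRing.comm x (Lmat i j).
Proof.
move=> xu xy xd xx; apply: commrB; first by case: ifP => _; [apply: xy | apply: commr0].
by apply: commr_sum => a _; apply: commrM; [apply: xu | apply: comm_anti_mul].
Qed.

Lemma Kmat_even x a b : (forall a, GRing.comm x (u a)) -> (forall i, GRing.comm x (yi i)) ->
  (forall a i, anti x (dd a i) = 0) -> (forall a i, anti x (xi a i) = 0) ->
  GRing.comm x (Kmat a b).
Proof.
move=> xu xy xd xx; apply: commrB; first by case: ifP => _; [apply: xu | apply: commr0].
by apply: commr_sum => i _; apply: commrM; [apply: xy | apply: comm_anti_mul].
Qed.

Lemma comm_rdet N (x : E) (M : 'I_N -> 'I_N -> E) :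
  (forall i j, GRing.comm x (M i j)) -> GRing.comm x (rdet M).
Proof.
move=> xM; apply: commr_sum => t _; apply: commrM; first exact: commr_sign.
exact: commr_prod.
Qed.

(** [prod_rdet] expands both products of row sums; the entries of [Lmat] are even, so [rdet Lmat]
    moves past the [psi]'s. *)
Theorem duality_wedge :
  rdet Kmat * rdet Lmat * (\prod_a psi a * \prod_j chi j) =
  \prod_i y i * \prod_a u a * (\prod_a psi a * \prod_j chi j).
Proof.
have psiL : GRing.comm (\prod_a psi a) (rdet Lmat).
  apply/commr_sym/commr_prod => a _; apply/commr_sym/comm_rdet => i j.
  by apply: Lmat_even => *; rewrite ?psi_dd ?psi_xi //;
    apply/commr_sym; (apply: ui_psi || apply: y_psi).
have := duality_products.
rewrite (eq_bigr (fun j => \sum_i Lmat j i * chi i)) => [|j _]; last exact: kapE.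
rewrite prod_rdet //; last first.
  move=> i j a; apply: Kmat_even => *; rewrite ?psi_dd ?psi_xi //;
    by apply/commr_sym; (apply: u_psi || apply: yi_psi).
rewrite prod_rdet //; last first.
  move=> i j a; apply: Lmat_even => *; rewrite ?chi_dd ?chi_xi //;
    by apply/commr_sym; (apply: ui_chi || apply: y_chi).
rewrite prod_mul_comm; last by move=> i j; apply/commr_sym/u_psi.
rewrite !mulrA => <-; congr (_ * _).
by rewrite -!mulrA psiL.
Qed.

End Duality.

(** * Substitution into polynomials with noncommuting coefficients *)

Section MPolyEvaluation.
Variables (E : nzRingType) (n : nat) (X : 'I_n -> E).
Hypothesis XX : forall i j, GRing.comm (X i) (X j).
Implicit Types (p q : {mpoly E[n]}).

(* Substitution of [X] for the indeterminates, placed to the LEFT of the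
   coefficients. *)
Definition leval p : E := \sum_(m <- msupp p) mmap1 X m * p@_m.

Lemma levalE p (b : nat) : (msize p <= b)%N ->
  leval p = \sum_(m : 'X_{1..n < b}) mmap1 X m * p@_m.
Proof.
move=> le_pb; set I : subFinType _ := 'X_{1..n < b}.
rewrite /leval (ssrcomplements.big_mksub I) ?msupp_uniq //=; last first.
  by move=> x /msize_mdeg_lt /leq_trans; apply.
by rewrite big_rmcond //= => j /memN_msupp_eq0 ->; rewrite mulr0.
Qed.

Lemma levalD p q : leval (p + q) = leval p + leval q.
Proof.
pose b := maxn (msize (p + q)) (maxn (msize p) (msize q)).
rewrite !(levalE _ b) ?leq_max ?leqnn ?orbT // -big_split; apply: eq_bigr => m _.
by rewrite mcoeffD mulrDr.
Qed.

Lemma leval0 : leval 0 = 0.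
Proof. by rewrite /leval msupp0 big_nil. Qed.

Lemma levalZX e m : leval (e *: 'X_[m]) = mmap1 X m * e.
Proof.
have [->|nz] := eqVneq e 0; first by rewrite scale0r leval0 mulr0.
pose b := maxn (msize (e *: 'X_[m])) (mdeg m).+1.
have mb : (mdeg m < b)%N by rewrite /b leq_max leqnn orbT.
rewrite (levalE _ b) ?leq_maxl // (bigD1 (BMultinom mb)) //= big1 ?addr0.
  by rewrite mcoeffZ mcoeffX eqxx mulr1.
move=> m' ne; rewrite mcoeffZ mcoeffX; case: eqP => [E'|]; last by rewrite !mulr0.
by case/eqP: ne; apply/val_inj.
Qed.

Lemma mmap1D m1 m2 : mmap1 X (m1 + m2) = mmap1 X m1 * mmap1 X m2.
Proof.
rewrite /mmap1 -prod_mul_comm => [|i j]; last by apply/commrX/commr_sym/commrX.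
by apply: eq_bigr => i _; rewrite mnmDE exprD.
Qed.

Lemma leval_X i p : leval ('X_i * p) = X i * leval p.
Proof.
elim/mpolyind: p => [|e m p _ _ IH]; first by rewrite mulr0 leval0 mulr0.
rewrite mulrDr !levalD mulrDr IH; congr (_ + _).
have -> : 'X_i * (e *: 'X_[m]) = e *: 'X_[U_(i) + m] :> {mpoly E[n]}.
  by rewrite mpolyXD scalerAl -!mul_mpolyC !mulrA; congr (_ * _); apply/esym/commr_mpolyX.
by rewrite !levalZX mmap1D mmap1U mulrA.
Qed.

Lemma leval_Cr p e : leval (p * e%:MP) = leval p * e.
Proof.
elim/mpolyind: p => [|a m p _ _ IH]; first by rewrite mul0r leval0 mul0r.
rewrite mulrDl !levalD mulrDl IH; congr (_ + _).
have -> : a *: 'X_[m] * e%:MP = (a * e) *: 'X_[m] :> {mpoly E[n]}.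
  by rewrite -!mul_mpolyC mpolyCM -!mulrA; congr (_ * _); apply/esym/commr_mpolyX.
by rewrite !levalZX mulrA.
Qed.

Lemma leval1 : leval 1 = 1.
Proof.
have -> : (1 : {mpoly E[n]}) = 1 *: 'X_[0%MM] by rewrite scale1r mpolyX0.
by rewrite levalZX mmap11 mulr1.
Qed.

Lemma leval_C e : leval e%:MP = e.
Proof. by rewrite -[e%:MP]mul1r leval_Cr leval1 mul1r. Qed.

(** The indeterminates of [p] are central and can be peeled off to the left of the affine factor;
    their values can follow because the value of that factor commutes with every [X j]. *)
Lemma leval_row e (b : 'I_n -> E) :
  (forall j, GRing.comm (e + \sum_i X i * b i) (X j)) ->
  forall p, leval ((e%:MP + \sum_i 'X_i * (b i)%:MP) * p) =
            (e + \sum_i X i * b i) * leval p.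
Proof.
set L := _%:MP + _; set l := e + _ => lX.
have LX i p : L * ('X_i * p) = 'X_i * (L * p) by rewrite !mulrA (commr_mpolyX _ L).
have L1 : leval L = l.
  rewrite /L levalD leval_C (big_morph leval levalD leval0); congr (_ + _).
  by apply: eq_bigr => i _; rewrite leval_X leval_C.
have step i p : leval (L * p) = l * leval p -> leval (L * ('X_i * p)) = l * leval ('X_i * p).
  by move=> H; rewrite LX !leval_X H !mulrA lX.
have stepn i r p : leval (L * p) = l * leval p ->
    leval (L * ('X_i ^+ r * p)) = l * leval ('X_i ^+ r * p).
  by move=> H; elim: r => [|r IH]; rewrite ?expr0 ?mul1r // exprS -mulrA; apply: step.
move=> p; elim/mpolyind: p => [|a m p _ _ IH]; first by rewrite mulr0 leval0 mulr0.
rewrite mulrDr !levalD mulrDr IH; congr (_ + _).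
rewrite -mul_mpolyC commr_mpolyX mpolyXE_id.
elim/big_rec: _ => [|i q _ IHq]; first by rewrite mul1r leval_Cr L1 leval_C.
by rewrite -mulrA; apply: stepn.
Qed.

End MPolyEvaluation.

Lemma mpolyX_reg (E : nzRingType) n (i : 'I_n) (p : {mpoly E[n]}) : 'X_i * p = 0 -> p = 0.
Proof.
move=> h; apply/mpolyP => m; rewrite mcoeff0 -(mcoeffMX p U_(i)).
by rewrite (commr_mpolyX U_(i) p) h mcoeff0.
Qed.

(** * Creation and annihilation matrices *)

Section GrassmannMatrices.
Variables (C : fieldType) (k n : nat).
Local Notation I := (Idx k n).
Local Notation g := (gdim k n).
Implicit Types (c d : I) (Q : {set I}) (D : pred {set I}) (f : {set I} -> {set I})
  (s : {set I} -> C).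

(** Each monomial goes to a signed monomial or to zero. Keeping domain, set map and sign apart makes
    composition formal. *)
Definition basis_op (dom : pred {set I}) (f : {set I} -> {set I}) (sg : {set I} -> C) : 'M[C]_g :=
  \matrix_(p, q) (if dom (gset q) && (gset p == f (gset q)) then sg (gset q) else 0).

Lemma gset_inj : injective (@gset k n). Proof. exact: enum_val_inj. Qed.

Lemma gset_rank Q : gset (enum_rank Q) = Q. Proof. exact: enum_rankK. Qed.

Lemma basis_opM D1 f1 s1 D2 f2 s2 :
  basis_op D1 f1 s1 *m basis_op D2 f2 s2 =
  basis_op (fun Q => D2 Q && D1 (f2 Q)) (fun Q => f1 (f2 Q)) (fun Q => s1 (f2 Q) * s2 Q).
Proof.
apply/matrixP => p q; rewrite !mxE; set Q := gset q.
rewrite (bigD1 (enum_rank (f2 Q))) //= big1 ?addr0 => [|r ne].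
  rewrite !mxE gset_rank -/Q eqxx andbT; case: (D2 Q); rewrite /= ?mulr0 //.
  by case: ifP => _; rewrite ?mul0r.
rewrite !mxE -/Q; case: ifP => _; rewrite ?mul0r //; case: ifP; rewrite ?mulr0 //.
by case/andP=> _ /eqP h; case/eqP: ne; rewrite -h /gset enum_valK.
Qed.

Lemma basis_op_eq D1 f1 s1 D2 f2 s2 :
  (forall Q, D1 Q = D2 Q) -> (forall Q, D1 Q -> f1 Q = f2 Q) -> (forall Q, D1 Q -> s1 Q = s2 Q) ->
  basis_op D1 f1 s1 = basis_op D2 f2 s2.
Proof.
move=> hD hf hs; apply/matrixP => p q; rewrite !mxE -hD.
by case: (boolP (D1 _)) => //= h; rewrite hf // hs.
Qed.

Lemma basis_opN D f s : - basis_op D f s = basis_op D f (fun Q => - s Q).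
Proof. by apply/matrixP => p q; rewrite !mxE; case: ifP => _; rewrite ?oppr0. Qed.

Lemma basis_op_compl D f s : 
  (forall Q, f Q = Q) -> basis_op D f (fun=> 1) + basis_op (fun Q => ~~ D Q) f s =
    basis_op xpredT id (fun Q => if D Q then 1 else s Q).
Proof.
move=> fQ; apply/matrixP => p q; rewrite !mxE fQ.
by case: (D _); rewrite /= ?addr0 ?add0r.
Qed.

Lemma basis_op1 : basis_op xpredT id (fun=> 1) = 1%:M.
Proof. by apply/matrixP => p q; rewrite !mxE /= (inj_eq gset_inj); case: eqP. Qed.

Lemma xiME c : xiM C c = basis_op (fun Q => c \notin Q) (fun Q => c |: Q) (fun Q => gsign C Q c).
Proof. by []. Qed.
Lemma dME c : dM C c = basis_op (fun Q => c \in Q) (fun Q => Q :\ c) (fun Q => gsign C Q c).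
Proof. by []. Qed.

Definition below c d : bool := (enum_rank c < enum_rank d)%N.

Lemma belowC c d : c != d -> below d c = ~~ below c d.
Proof.
move=> cd; by rewrite /below -leqNgt ltn_neqAle val_eqE (inj_eq enum_rank_inj) eq_sym cd.
Qed.

Lemma gsignU Q c d : c \notin Q -> gsign C (c |: Q) d = (-1) ^+ below c d * gsign C Q d.
Proof.
move=> cQ; suff E : #|[set c' in c |: Q | (enum_rank c' < enum_rank d)%N]| =
    (below c d + #|[set c' in Q | (enum_rank c' < enum_rank d)%N]|)%N.
  by rewrite /gsign E exprD.
rewrite /below; case cd: (_ < _)%N.
  rewrite (_ : [set _ in c |: Q | _] = c |: [set c' in Q | (enum_rank c' < enum_rank d)%N]).
    by rewrite cardsU1 inE (negbTE cQ).
  by apply/setP => e; rewrite !inE; case: eqP => [->|].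
rewrite add0n; apply: eq_card => e; rewrite !inE; case: eqP => [->|] //=.
by rewrite cd andbF.
Qed.

Lemma gsignD Q c d : c \in Q -> gsign C (Q :\ c) d = (-1) ^+ below c d * gsign C Q d.
Proof.
move=> cQ; rewrite -{2}(setD1K cQ) gsignU ?setD11 // mulrA -expr2 sqrr_sign mul1r //.
Qed.

Lemma gsign2 Q c : gsign C Q c * gsign C Q c = 1.
Proof. by rewrite /gsign -expr2 sqrr_sign. Qed.

(** Of two distinct indices exactly one is below the other, so the two orders of insertion differ by
    one sign; for [c = d] the domain is empty. *)
Lemma xiM_anti c d : xiM C c *m xiM C d + xiM C d *m xiM C c = 0.
Proof.
apply/eqP; rewrite addr_eq0; apply/eqP; rewrite !xiME !basis_opM basis_opN.
have [->|cd] := eqVneq c d.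
  by apply/matrixP => p q; rewrite !mxE !inE eqxx /= andbF.
apply: basis_op_eq => Q.
- by rewrite !in_setU1 !negb_or cd eq_sym cd andbC.
- by rewrite setUCA.
rewrite !in_setU1 !negb_or cd /= => /andP[dQ cQ].
rewrite !gsignU // (belowC _ _ cd) signrN !mulNr; congr (- _).
by rewrite mulrAC.
Qed.

Lemma dM_anti c d : dM C c *m dM C d + dM C d *m dM C c = 0.
Proof.
apply/eqP; rewrite addr_eq0; apply/eqP; rewrite !dME !basis_opM basis_opN.
have [->|cd] := eqVneq c d.
  by apply/matrixP => p q; rewrite !mxE !inE eqxx /= andbF.
apply: basis_op_eq => Q.
- by rewrite !in_setD1 cd eq_sym cd andbC.
- by move=> _; apply/setP => e; rewrite !inE andbCA.
rewrite !in_setD1 cd /= => /andP[dQ cQ].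
rewrite !gsignD // (belowC _ _ cd) signrN !mulNr; congr (- _).
by rewrite mulrAC.
Qed.

Lemma dM_xiM c d : dM C c *m xiM C d + xiM C d *m dM C c = (c == d)%:R%:M.
Proof.
rewrite xiME dME !basis_opM; have [->|cd] := eqVneq c d.
  set X := basis_op _ _ _; set Y := basis_op _ _ _.
  have -> : X = basis_op (fun Q => d \notin Q) id (fun=> 1).
    apply: basis_op_eq => Q; first by rewrite setU11 andbT.
      by move=> /andP[dQ _]; rewrite setU1K.
    by move=> /andP[dQ _]; rewrite gsignU // /below ltnn mul1r gsign2.
  have -> : Y = basis_op (fun Q => ~~ (d \notin Q)) id (fun=> 1).
    apply: basis_op_eq => Q; first by rewrite negbK setD11 andbT.
      by move=> /andP[dQ _]; rewrite setD1K.
    by move=> /andP[dQ _]; rewrite gsignD // /below ltnn mul1r gsign2.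
  rewrite basis_op_compl // -basis_op1.
  by apply: basis_op_eq => // Q _; case: ifP.
rewrite mulr0n raddf0; apply/eqP; rewrite addr_eq0 basis_opN; apply/eqP.
apply: basis_op_eq => Q.
- by rewrite !inE (negbTE cd) (eq_sym d) (negbTE cd) /= andbC.
- rewrite !inE (negbTE cd) /= => /andP[dQ cQ].
  by apply/setP => e; rewrite !inE; case: (e =P d) => [->|] //=; rewrite eq_sym cd.
rewrite !inE (negbTE cd) /= => /andP[dQ cQ].
rewrite gsignU // gsignD // (belowC _ _ cd) signrN !mulNr; congr (- _).
by rewrite mulrAC.
Qed.

(** It provides the element [G] of the duality: it squares to one and anticommutes with all [xiM]
    and [dM]. *)
Definition parityM : 'M[C]_g := basis_op xpredT id (fun Q => (-1) ^+ #|Q|).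

Lemma parityM2 : parityM *m parityM = 1%:M.
Proof.
by rewrite basis_opM -basis_op1; apply: basis_op_eq => // Q _; rewrite -expr2 sqrr_sign.
Qed.

Lemma parityM_xi c : parityM *m xiM C c + xiM C c *m parityM = 0.
Proof.
apply/eqP; rewrite addr_eq0; apply/eqP; rewrite xiME !basis_opM basis_opN.
apply: basis_op_eq => // Q; first by rewrite andbT.
by rewrite andbT => cQ; rewrite cardsU1 cQ exprS mulN1r mulNr mulrC.
Qed.

Lemma parityM_d c : parityM *m dM C c + dM C c *m parityM = 0.
Proof.
apply/eqP; rewrite addr_eq0; apply/eqP; rewrite dME !basis_opM basis_opN.
apply: basis_op_eq => // Q; first by rewrite andbT.
by rewrite andbT => cQ; rewrite [#|Q|](cardsD1 c) cQ exprS mulN1r mulrN opprK mulrC.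
Qed.

(** On the empty monomial the product of distinct generators gives a signed basis vector. A unit
    entry, rather than just a nonzero matrix, is what cancelling a wedge requires. *)
Lemma prod_xiM_neq0 (s : seq I) : uniq s ->
  exists p q (b : bool), (\prod_(c <- s) (xiM C c : 'M_g)) p q = (-1) ^+ b.
Proof.
move=> us; suff [b H] : exists b : bool, forall p,
    (\prod_(c <- s) (xiM C c : 'M_g)) p (enum_rank set0) =
    if gset p == [set c in s] then (-1) ^+ b else 0.
  by exists (enum_rank [set c in s]), (enum_rank set0), b; rewrite H gset_rank eqxx.
elim: s us => [_|c s IH /= /andP[cs us]].
  exists false => p; rewrite big_nil expr0 mxE -(inj_eq gset_inj) gset_rank.
  rewrite (_ : [set c in [::]] = set0); last by apply/setP => c; rewrite !inE.
  by case: eqP.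
have [b H] := IH us.
exists (odd #|[set c' in [set c in s] | (enum_rank c' < enum_rank c)%N]| (+) b) => p.
rewrite big_cons; move: (\prod_(j <- s) _) H => P H.
rewrite mxE (bigD1 (enum_rank [set c in s])) //= big1 ?addr0 => [|r ne]; last first.
  rewrite H; case: ifP => [/eqP h|]; last by rewrite mulr0.
  by case/eqP: ne; rewrite -h /gset enum_valK.
rewrite H gset_rank eqxx mxE gset_rank inE cs /= set_cons.
by case: ifP => _; rewrite ?mul0r // /gsign signr_addb signr_odd.
Qed.

End GrassmannMatrices.

(** * Realisation of the odd elements, and the identity freed from them *)

Section DualityWithoutAuxiliaries.
Variables (W : pzRingType) (C : fieldType) (kappa : {rmorphism C -> W}) (k n : nat).
Hypothesis two_neq0 : (2%:R : C) != 0.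
Hypothesis kappaC : forall e w, GRing.comm (kappa e) w.
Variables (u ui : 'I_k -> W) (y yi : 'I_n -> W) (xi dd : 'I_k -> 'I_n -> W) (G : W).
Hypothesis uu : forall a b, GRing.comm (u a) (u b).
Hypothesis yy : forall i j, GRing.comm (y i) (y j).
Hypothesis uy : forall a i, u a * y i = y i * u a + 1.
Hypothesis uui : forall a, u a * ui a = 1.
Hypothesis uiu : forall a, ui a * u a = 1.
Hypothesis yyi : forall i, y i * yi i = 1.
Hypothesis yiy : forall i, yi i * y i = 1.
Hypothesis u_xi : forall a b i, GRing.comm (u a) (xi b i).
Hypothesis u_dd : forall a b i, GRing.comm (u a) (dd b i).
Hypothesis u_G : forall a, GRing.comm (u a) G.
Hypothesis y_xi : forall j b i, GRing.comm (y j) (xi b i).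
Hypothesis y_dd : forall j b i, GRing.comm (y j) (dd b i).
Hypothesis y_G : forall j, GRing.comm (y j) G.
Hypothesis xi_xi : forall a i b j, anti (xi a i) (xi b j) = 0.
Hypothesis dd_dd : forall a i b j, anti (dd a i) (dd b j) = 0.
Hypothesis dd_xi : forall a i b j,
  anti (dd a i) (xi b j) = ((a == b) && (i == j))%:R.
Hypothesis G_xi : forall a i, anti G (xi a i) = 0.
Hypothesis G_dd : forall a i, anti G (dd a i) = 0.
Hypothesis GG : G * G = 1.

Local Notation h := (gdim 1 (k + n)).
Local Notation E := 'M[W]_h.

(** Generators of a second Grassmann algebra, the first [k] for the [psi]'s and the last [n] for the
    [chi]'s. Their entries are central in [W], so they commute with lifted elements. *)
Definition theta_aux (c : 'I_(k + n)) : E := map_mx kappa (xiM C (ord0 : 'I_1, c)).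
Definition lift_mx (w : W) : E := w%:M.

Lemma lift_mxB : {morph lift_mx : a b / a - b}. Proof. exact: raddfB. Qed.
Lemma lift_mxM : {morph lift_mx : a b / a * b}. Proof. exact: scalar_mxM. Qed.
HB.instance Definition _ := GRing.isZmodMorphism.Build _ _ lift_mx lift_mxB.
HB.instance Definition _ :=
  GRing.isMonoidMorphism.Build _ _ lift_mx (conj (erefl : lift_mx 1 = 1) lift_mxM).

Lemma lift_theta w c : GRing.comm (lift_mx w) (theta_aux c).
Proof.
apply/matrixP => p q; rewrite /GRing.comm !mxE.
rewrite (bigD1 p) //= big1 ?addr0 => [|r ne]; last first.
  by rewrite !mxE eq_sym (negbTE ne) mulr0n mul0r.
rewrite [RHS](bigD1 q) //= [in RHS]big1 ?addr0 => [|r ne]; last first.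
  by rewrite !mxE (negbTE ne) mulr0n mulr0.
by rewrite !mxE !eqxx !mulr1n; apply/esym/kappaC.
Qed.

Lemma theta_anti c d : anti (theta_aux c) (theta_aux d) = 0.
Proof.
rewrite /anti /theta_aux -[_ * _]/(_ *m _) -[X in _ + X]/(_ *m _) -!map_mxM -map_mxD.
by rewrite xiM_anti map_mx0.
Qed.

Lemma halfW (x : W) : x + x = 0 -> x = 0.
Proof.
move=> xx; rewrite -[x]mul1r -(rmorph1 kappa) -(mulVf two_neq0) rmorphM -mulrA.
by rewrite -natr1 rmorphD rmorph1 mulrDl mul1r xx mulr0.
Qed.

(* The parity [G] makes the auxiliary odd elements anticommute with [xi], [dd]. *)
Definition psi_aux (a : 'I_k) : E := lift_mx G * theta_aux (lshift n a).
Definition chi_aux (i : 'I_n) : E := lift_mx G * theta_aux (rshift k i).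

Lemma lift_comm a b : GRing.comm a b -> GRing.comm (lift_mx a) (lift_mx b).
Proof. by move=> ab; rewrite /GRing.comm -!rmorphM ab. Qed.
Lemma lift_anti a b : anti (lift_mx a) (lift_mx b) = lift_mx (anti a b).
Proof. by rewrite /anti rmorphD !rmorphM. Qed.
Lemma Gtheta_anti c d : anti (lift_mx G * theta_aux c) (lift_mx G * theta_aux d) = 0.
Proof.
have E1 a b : lift_mx G * theta_aux a * (lift_mx G * theta_aux b) = theta_aux a * theta_aux b.
  by rewrite -mulrA (mulrA (theta_aux a)) -(lift_theta G a) !mulrA -rmorphM GG rmorph1 mul1r.
by rewrite /anti !E1; apply: theta_anti.
Qed.
Lemma Gtheta_comm w c : GRing.comm w G -> GRing.comm (lift_mx w) (lift_mx G * theta_aux c).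
Proof. by move=> wG; apply: commrM; [apply: lift_comm | apply: lift_theta]. Qed.
Lemma Gtheta_odd w c : anti G w = 0 -> anti (lift_mx G * theta_aux c) (lift_mx w) = 0.
Proof.
move=> Gw; rewrite antiC anti_mulCr; last exact: lift_theta.
by rewrite antiC lift_anti Gw rmorph0 mul0r.
Qed.

Lemma rdet_lift N (M : 'I_N -> 'I_N -> W) :
  rdet (fun i j => lift_mx (M i j)) = lift_mx (rdet M).
Proof.
rewrite /rdet rmorph_sum; apply: eq_bigr => t _.
by rewrite rmorphM rmorph_sign rmorph_prod.
Qed.

(** The wedge of all generators has a unit entry, up to sign [G ^+ (k + n)], so a lifted element can
    be recovered from its product with the wedge. *)
Lemma wedge_aux : exists p q (e : W), e * e = 1 /\
  forall w, (lift_mx w * (\prod_a psi_aux a * \prod_j chi_aux j)) p q = w * e.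
Proof.
have [|p [q [b H]]] := prod_xiM_neq0 C 1 (k + n) [seq (ord0, c) | c <- index_enum 'I_(k + n)].
  by rewrite map_inj_uniq ?index_enum_uniq // => c d [].
have -> : \prod_a psi_aux a * \prod_j chi_aux j =
    lift_mx (G ^+ (k + n)) * \prod_c theta_aux c.
  have -> : \prod_a psi_aux a * \prod_j chi_aux j = \prod_(c < k + n) (lift_mx G * theta_aux c).
    by rewrite big_split_ord.
  rewrite prod_mul_comm; last by move=> c d; apply/commr_sym/lift_theta.
  by rewrite prodr_const card_ord rmorphXn.
exists p, q, (G ^+ (k + n) * kappa ((-1) ^+ b)); split.
  rewrite -mulrA (kappaC _ (G ^+ _ * _)) -mulrA -rmorphM -expr2 sqrr_sign rmorph1 mulr1.
  by rewrite -exprMn_comm // GG expr1n.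
move=> w; rewrite mulrA -rmorphM.
have -> : \prod_c theta_aux c =
    map_mx kappa (\prod_(c <- [seq (ord0, c) | c <- index_enum 'I_(k + n)])
     (xiM C c : 'M_h)).
  rewrite big_map (big_morph (map_mx kappa) (id1 := 1) (op1 := *%R)) //.
    by move=> A B; apply: map_mxM.
  by apply: map_mx1.
by rewrite -[lift_mx _ * _]/(_ *m _) mul_scalar_mx !mxE H mulrA.
Qed.

Theorem duality :
  rdet (Kmat W k n u yi xi dd) * rdet (Lmat W k n ui y xi dd) = \prod_i y i * \prod_a u a.
Proof.
pose K' := Kmat E k n (fun a => lift_mx (u a)) (fun i => lift_mx (yi i))
   (fun a i => lift_mx (xi a i)) (fun a i => lift_mx (dd a i)).
pose L' := Lmat E k n (fun a => lift_mx (ui a)) (fun i => lift_mx (y i))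
   (fun a i => lift_mx (xi a i)) (fun a i => lift_mx (dd a i)).
have [p [q [e [ee wedge]]]] := wedge_aux.
(* Polynomials are formed over a nonzero ring; in the zero ring both sides are equal anyway. *)
have [triv|nz] := eqVneq (1 : E) 0.
  have W0 (w : W) : w = 0.
    have /matrixP/(_ p p) : lift_mx w = 0 by rewrite -[lift_mx w]mulr1 triv mulr0.
    by rewrite !mxE eqxx.
  by rewrite [LHS]W0 [RHS]W0.
suff : rdet K' * rdet L' * (\prod_a psi_aux a * \prod_j chi_aux j) =
   \prod_i lift_mx (y i) * \prod_a lift_mx (u a) * (\prod_a psi_aux a * \prod_j chi_aux j).
  have -> : rdet K' = lift_mx (rdet (Kmat W k n u yi xi dd)).
    rewrite -rdet_lift; apply: eq_bigr => t _; congr (_ * _); apply: eq_bigr => a _.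
    rewrite /K' /Kmat rmorphB rmorph_sum; congr (_ - _); first by case: ifP => _; rewrite ?rmorph0.
    by apply: eq_bigr => i _; rewrite !rmorphM.
  have -> : rdet L' = lift_mx (rdet (Lmat W k n ui y xi dd)).
    rewrite -rdet_lift; apply: eq_bigr => t _; congr (_ * _); apply: eq_bigr => a _.
    rewrite /L' /Lmat rmorphB rmorph_sum; congr (_ - _); first by case: ifP => _; rewrite ?rmorph0.
    by apply: eq_bigr => i _; rewrite !rmorphM.
  rewrite -!rmorph_prod -!rmorphM => /matrixP/(_ p q); rewrite !wedge.
  by move/(congr1 ( *%R^~ e)); rewrite -!mulrA ee !mulr1.
pose nzE : nzRingType := HB.pack E (GRing.PzSemiRing_isNonZero.Build E nz).
have halfE (x : E) : x + x = 0 -> x = 0.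
  move=> /matrixP xx; apply/matrixP => i j; rewrite !mxE; apply: halfW.
  by have := xx i j; rewrite !mxE.
pose X i : nzE := lift_mx (yi i) * Xi E k n (fun a i => lift_mx (xi a i)) psi_aux i.
have XX i j : GRing.comm (X i) (X j).
  apply: (yiXi_comm E k n (fun i => lift_mx (y i)) (fun i => lift_mx (yi i))) => //.
  all: try (by move=> *; rewrite -!rmorphM -?rmorph1 -?rmorphD; congr lift_mx; auto).
  all: try (by move=> *; apply: lift_comm).
  all: try (by move=> *; apply: Gtheta_comm).
  all: try (by move=> *; apply: Gtheta_anti).
  all: try (by move=> *; apply: Gtheta_odd).
  all: try (by move=> *; rewrite lift_anti ?xi_xi ?dd_dd ?rmorph0).
  all: try (by move=> *; rewrite lift_anti dd_xi rmorph_nat).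
have halfR (x : {mpoly nzE[n]}) : x + x = 0 -> x = 0.
  move=> xx; apply/mpolyP => r; rewrite mcoeff0; apply: halfE.
  by have := congr1 (mcoeff r) xx; rewrite mcoeffD mcoeff0.
apply: (duality_wedge nzE {mpoly nzE[n]} (@mpolyC n nzE) k n (fun i => 'X_i) (leval nzE n X)
   _ (fun a => lift_mx (ui a)) _ (fun i => lift_mx (yi i))) => //.
all: try (by move=> *; rewrite -!rmorphM -?rmorph1 -?rmorphD; congr lift_mx; auto).
all: try (by move=> *; apply: lift_comm).
all: try (by move=> *; apply: Gtheta_comm).
all: try (by move=> *; apply: Gtheta_anti).
all: try (by move=> *; apply: Gtheta_odd).
all: try (by move=> *; rewrite lift_anti ?xi_xi ?dd_dd ?rmorph0).
all: try (by move=> *; rewrite lift_anti dd_xi rmorph_nat).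
- by move=> i x; apply/commr_sym/commr_mpolyX.
- by move=> i x; apply: mpolyX_reg.
- exact: levalD.
- by move=> p0 e0; apply: leval_Cr.
- exact: leval1.
- exact: leval_row.
- exact: leval_X.
Qed.

End DualityWithoutAuxiliaries.

(** * Change of coefficients, monic operators, annihilators *)

Section CoefficientMap.
Variables (A B : pzRingType) (f : {rmorphism A -> B}).

Lemma psd_map_bounded (P : psd A) :
  exists k m, xbound (fun K M => f (P K M)) k /\ dbound (fun K M => f (P K M)) m.
Proof.
have [k [m [Pk Pm]]] := psc_bounded A P.
by exists k, m; split=> K M h; [rewrite Pk | rewrite Pm] => //; rewrite rmorph0.
Qed.
Definition psd_map (P : psd A) : psd B := Psd B _ (psd_map_bounded P).

Lemma psd_mapE P K M : psd_map P K M = f (P K M). Proof. by []. Qed.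

Lemma psd_mapB : {morph psd_map : P Q / P - Q}.
Proof. by move=> P Q; apply: psdP => K M; rewrite pscD pscN !psd_mapE -rmorphB. Qed.

Lemma psd_map_mono a i j : psd_map (mono a i j) = mono (f a) i j.
Proof. by apply: psdP => K M /=; case: ifP; rewrite ?rmorph0. Qed.

Lemma psd_mapM : {morph psd_map : P Q / P * Q}.
Proof.
move=> P Q; apply: psdP => K M; rewrite psd_mapE !psd_mulE.
have [k [m H]] := common_bounds A [:: P; Q].
have [|Pk Pm] := H P; first by rewrite !inE eqxx.
have [|Qk Qm] := H Q; first by rewrite !inE eqxx orbT.
have fP : xbound (psd_map P) k /\ dbound (psd_map P) m.
  by split=> K1 M1 h; rewrite psd_mapE; [rewrite Pk | rewrite Pm] => //; rewrite rmorph0.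
have fQ : xbound (psd_map Q) k /\ dbound (psd_map Q) m.
  by split=> K1 M1 h; rewrite psd_mapE; [rewrite Qk | rewrite Qm] => //; rewrite rmorph0.
pose b := (absz (k + k - K)%R + absz (m + m - M)%R).+1%N.
rewrite [LHS](_ : _ = f (psd_mul_fun A P Q K M)) //.
rewrite [RHS](_ : _ = psd_mul_fun B (psd_map P) (psd_map Q) K M) //.
rewrite (psd_mul_funE _ _ _ k m k m b) //; try lia.
rewrite (psd_mul_funE _ _ _ k m k m b) //; try lia;
  do ?[exact: (proj1 fP) | exact: (proj2 fP) | exact: (proj1 fQ) | exact: (proj2 fQ)].
rewrite /box rmorph_sum; apply: eq_bigr => i _; rewrite rmorph_sum; apply: eq_bigr => j _.
rewrite rmorph_sum; apply: eq_bigr => r _; by rewrite /mul_term !psd_mapE 2!(rmorphM f) rmorph_int.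
Qed.

Lemma psd_map1 : psd_map 1 = 1.
Proof. by rewrite psd_1E psd_map_mono rmorph1. Qed.

HB.instance Definition _ := GRing.isZmodMorphism.Build _ _ psd_map psd_mapB.
HB.instance Definition _ :=
  GRing.isMonoidMorphism.Build _ _ psd_map (conj psd_map1 psd_mapM).

Lemma psd_map_sharp P : psd_map (sharp P) = sharp (psd_map P).
Proof.
apply: psdP => K M; have [k [m [Pk Pm]]] := psc_bounded A P.
have fP : xbound (psd_map P) k by move=> K1 M1 h; rewrite psd_mapE Pk ?rmorph0.
have kb : k - M < (absz (k - M)%R).+1%N%:Z by lia.
rewrite psd_mapE (sharpE _ _ _ _ _ _ Pk kb) (sharpE _ _ _ _ _ _ fP kb) rmorph_sum.
by apply: eq_bigr => r _; rewrite /sharp_term (rmorphM f) rmorph_int.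
Qed.

End CoefficientMap.

(** * Monic differential operators *)

Section Monic.
Variable A : pzRingType.
Implicit Types P Q : psd A.

Definition differential P := forall K M, M < 0 -> P K M = 0.

Definition monic_op (p : nat) P :=
  differential P /\ dbound (P - mono 1 0 p%:Z) (p%:Z - 1).

Lemma dbound_le P a b : a <= b -> dbound P a -> dbound P b.
Proof. by move=> ab Pa K M h; apply: Pa; apply: le_lt_trans h. Qed.

Lemma dboundD P Q a : dbound P a -> dbound Q a -> dbound (P + Q) a.
Proof. by move=> Pa Qa K M h; rewrite pscD Pa // Qa // addr0. Qed.

(** A natural power [(d/dx)^p] admits at most [p] contractions, so no negative order can arise. *)
Lemma differentialM P Q : differential P -> differential Q -> differential (P * Q).
Proof.
move=> dP dQ K M h; rewrite psd_mulE /= /psd_mul_fun /box big1 // => i _.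
rewrite big1 // => j _; rewrite big1 // => r _; rewrite /mul_term.
set M1 := _ - j%:Z; have [h1|h1] := ltP M1 0; first by rewrite dP // !mul0r.
have [h2|h2] := ltP (M - M1 + r%:Z) 0; first by rewrite dQ // mulr0 mul0r.
have -> : M1 = (absz M1)%:Z by lia.
by rewrite wt_nat_gt ?mulr0 //; lia.
Qed.

Lemma dbound_mono (a : A) i j : dbound (mono a i j) j.
Proof. by case: (mono_bound A a i j). Qed.

Lemma monic_dbound p P : monic_op p P -> dbound P p%:Z.
Proof.
move=> [_ h]; rewrite -(subrK (mono 1 0 p%:Z) P); apply: dboundD (dbound_mono _ _ _).
by apply: dbound_le h; lia.
Qed.

Lemma monicM p q P Q : monic_op p P -> monic_op q Q -> monic_op (p + q) (P * Q).
Proof.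
move=> mP mQ; split; first exact: differentialM (proj1 mP) (proj1 mQ).
have -> : P * Q - mono 1 0 (p + q)%N%:Z =
    (P - mono 1 0 p%:Z) * Q + mono 1 0 p%:Z * (Q - mono 1 0 q%:Z).
  by rewrite mulrBl mulrBr addrA subrK mono_mul0r mul1r.
apply: dboundD.
  by apply: dbound_le (mul_dbound _ _ _ _ _ (proj2 mP) (monic_dbound _ _ mQ)); lia.
by apply: dbound_le (mul_dbound _ _ _ _ _ (@dbound_mono _ _ _) (proj2 mQ)); lia.
Qed.

Lemma monic1 : monic_op 0 1.
Proof.
split; last by move=> K M _; rewrite subrr psc0.
by move=> K M h; rewrite /= (lt_eqF h) andbF.
Qed.

Lemma monic_prod (I : Type) (s : seq I) (p : pred I) (d : I -> nat) (F : I -> psd A) :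
  (forall i, p i -> monic_op (d i) (F i)) ->
  monic_op (\sum_(i <- s | p i) d i)%N (\prod_(i <- s | p i) F i).
Proof.
by move=> mF; elim/big_rec2: _ => [|i x q pi mx]; [apply: monic1 | apply: monicM (mF i pi) mx].
Qed.

Lemma monic_linear a : monic_op 1 (psD - cst a).
Proof.
split=> [K M h|].
  have [h1 h2] : (M == 1) = false /\ (M == 0) = false by split; apply/eqP; lia.
  by rewrite pscD pscN /= h1 h2 !andbF subr0.
have -> : psD - cst a - mono 1 0 1%N%:Z = - cst a by rewrite addrAC subrr add0r.
move=> K M h.
by rewrite pscN /= (gt_eqF h) andbF oppr0.
Qed.

Lemma differentialD P Q : differential P -> differential Q -> differential (P + Q).
Proof. by move=> dP dQ K M h; rewrite pscD dP // dQ // addr0. Qed.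
Lemma differential_sign (b : nat) P : differential P -> differential ((-1) ^+ b * P).
Proof.
move=> dP K M h; rewrite -signr_odd; case: odd; rewrite ?expr1 ?mulN1r ?pscN ?mul1r dP ?oppr0 //.
Qed.
Lemma dbound_sign (b : nat) P d : dbound P d -> dbound ((-1) ^+ b * P) d.
Proof.
move=> dP K M h; rewrite -signr_odd; case: odd; rewrite ?expr1 ?mulN1r ?pscN ?mul1r dP ?oppr0 //.
Qed.

Lemma dbound_prod (I : Type) (s : seq I) (d : I -> nat) (F : I -> psd A) :
  (forall i, dbound (F i) (d i)%:Z) ->
  dbound (\prod_(i <- s) F i) (\sum_(i <- s) d i)%N%:Z.
Proof.
move=> dF; elim/big_rec2: _ => [|i x q _ dx]; first exact: dbound_mono.
by rewrite PoszD; apply: mul_dbound.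
Qed.

Lemma differential_prod (I : Type) (s : seq I) (F : I -> psd A) :
  (forall i, differential (F i)) -> differential (\prod_(i <- s) F i).
Proof.
move=> dF; apply: big_ind => //; last exact: differentialM.
exact: (proj1 monic1).
Qed.

(** Only the identity permutation reaches order [N]; any other one picks an off-diagonal entry, of
    order at most zero. *)
Lemma monic_rdet N (T : 'I_N -> 'I_N -> psd A) :
  (forall i, monic_op 1 (T i i)) ->
  (forall i j, i != j -> differential (T i j) /\ dbound (T i j) 0) ->
  monic_op N (rdet T).
Proof.
move=> mT oT; rewrite /rdet (bigD1 1%g) //= odd_perm1 mul1r.
have mD : monic_op N (\prod_i T i ((1%g : 'S_N) i)).
  have := monic_prod 'I_N (index_enum 'I_N) predT (fun=> 1%N) (fun i => T i ((1%g : 'S_N) i)).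
  by rewrite sum1_card card_ord; apply=> i _; rewrite perm1.
have dT i j : differential (T i j).
  by have [<-|/oT[]//] := eqVneq i j; case: (mT i).
split.
  apply: differentialD (proj1 mD) _; apply: big_ind => [|P Q|t _].
  - by move=> K M _; rewrite psc0.
  - exact: differentialD.
  by apply/differential_sign/differential_prod.
rewrite addrAC; apply: dboundD (proj2 mD) _.
apply: (big_ind (fun P : psd A => dbound P (N%:Z - 1))) => [|P Q|t t1].
- by move=> K M _; rewrite psc0.
- exact: dboundD.
apply: dbound_sign; pose d i := (t i == i : nat).
apply: (dbound_le _ (\sum_i d i)%N%:Z); last first.
  apply: dbound_prod => i; rewrite /d; case: eqP => [->|/eqP ti]; first exact: monic_dbound.
  have it : i != t i by rewrite eq_sym.
  exact: (proj2 (oT _ _ it)).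
have [i ti] : exists i, t i != i.
  apply/existsP; apply: contraNT t1; rewrite negb_exists => /forallP h; apply/eqP/permP => i.
  by rewrite perm1; apply/eqP; have := h i; rewrite negbK.
suff : (\sum_i d i < N)%N by lia.
rewrite (bigD1 i) //= /d (negbTE ti) add0n -[X in (_ < X)%N](card_ord N) -sum1_card.
rewrite [X in (_ < X)%N](bigD1 i) //= add1n ltnS; apply: leq_sum => j _.
by case: eqP.
Qed.

End Monic.

Arguments monic_op {A} p P.
Arguments psd_map {A B} f P.

(** Settles the coefficients outside the orders [0, ..., p - 1], about which the eigenvalue
    equations say nothing. *)
Lemma coef_monic (A : pzRingType) p (P : psd A) K M : monic_op p P ->
  (M < 0) || (p%:Z <= M) -> P K M = ((K == 0) && (M == p%:Z))%:R.
Proof.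
move=> [dP bP] h; have [M0|M0] := ltP M 0.
  by rewrite dP // andbC lt_eqF //; lia.
rewrite -(subrK (mono 1 0 p%:Z) P) pscD bP ?add0r /=; last by lia.
by case: ifP.
Qed.

(** * Operators whose coefficients kill a vector *)

Section Annihilator.
Variables (C : fieldType) (g : nat) (v : 'cV[C]_g).
Local Notation A := ('M[C]_g).
Implicit Types P Q : psd A.

Definition scal (c : C) : A := c%:M.
Lemma scalB : {morph scal : a b / a - b}. Proof. exact: raddfB. Qed.
Lemma scalM : {morph scal : a b / a * b}. Proof. exact: scalar_mxM. Qed.
HB.instance Definition _ := GRing.isZmodMorphism.Build _ _ scal scalB.
HB.instance Definition _ :=
  GRing.isMonoidMorphism.Build _ _ scal (conj (erefl : scal 1 = 1) scalM).

Lemma scal_comm c (B : A) : GRing.comm (scal c) B.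
Proof. by apply/esym; exact: scalar_mxC. Qed.

Definition annih P := forall K M, P K M *m v = 0.

(** In every coefficient of [P * Q] the coefficients of [Q] stand on the right and meet [v]
    first. *)
Lemma annihM P Q : annih Q -> annih (P * Q).
Proof.
move=> hQ K M; rewrite psd_mulE /= /psd_mul_fun /box mulmx_suml big1 // => i _.
rewrite mulmx_suml big1 // => j _; rewrite mulmx_suml big1 // => r _.
by rewrite /mul_term -intr_comm -mulmxA -mulmxA hQ !mulmx0.
Qed.

(** Scalar coefficients can be moved to the left of those of [P]. *)
Lemma annihMr P (q : psd C) : annih P -> annih (P * psd_map scal q).
Proof.
move=> hP K M; rewrite psd_mulE /= /psd_mul_fun /box mulmx_suml big1 // => i _.
rewrite mulmx_suml big1 // => j _; rewrite mulmx_suml big1 // => r _.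
rewrite /mul_term psd_mapE -intr_comm -mulmxA -(scal_comm _ (P _ _)).
rewrite -[_ * P _ _]/(_ *m _) -(mulmxA _ (P _ _)).
by rewrite hP !mulmx0.
Qed.

Lemma annih_sharp P : annih P -> annih (sharp P).
Proof.
move=> hP K M; rewrite /= /sharp_fun mulmx_suml big1 // => r _.
by rewrite /sharp_term -mulmxA hP mulmx0.
Qed.

End Annihilator.

Arguments annih {C g} v P.
Arguments scal {C g} c.

Lemma prod_comm_inv (W : pzRingType) (I : Type) (s : seq I) (p : pred I) (f fi : I -> W) :
  (forall i, f i * fi i = 1) ->
  exists q, \prod_(i <- s | p i) f i * q = 1.
Proof.
move=> ff; elim/big_rec: _ => [|i x _ [q xq]]; first by exists 1; rewrite mulr1.
by exists (q * fi i); rewrite -mulrA (mulrA x) xq mul1r ff.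
Qed.

Lemma prod_split_cond (W : pzRingType) N (f : 'I_N -> W) (p q : pred 'I_N) :
  (forall i j, GRing.comm (f i) (f j)) -> (forall i, q i = ~~ p i) ->
  \prod_i f i = \prod_i f i ^+ p i * \prod_(i | q i) f i.
Proof.
move=> ff qp; rewrite [X in _ * X]big_mkcond -prod_mul_comm => [|i j].
  by apply: eq_bigr => i _; rewrite qp; case: (p i); rewrite /= ?mulr1 ?expr0 ?mul1r.
by apply: commrX; case: ifP => _; [apply: ff | apply/commr_sym/commr1].
Qed.

(** [U] passes through the ordered product one row at a time. *)
Lemma rdet_conj (W : pzRingType) N (T T' : 'I_N -> 'I_N -> W) U :
  (forall i j, T' i j * U = U * T i j) -> rdet T' * U = U * rdet T.
Proof.
move=> TU; rewrite /rdet mulr_suml mulr_sumr; apply: eq_bigr => t _.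
rewrite mulrA commr_sign -!mulrA; congr (_ * _).
elim/big_rec2: _ => [|i x q _ IH]; first by rewrite mulr1 mul1r.
by rewrite -mulrA IH !mulrA TU.
Qed.

Lemma rdetN (W : pzRingType) N (T : 'I_N -> 'I_N -> W) :
  rdet (fun i j => - T i j) = (-1) ^+ N * rdet T.
Proof.
rewrite /rdet mulr_sumr; apply: eq_bigr => t _.
rewrite mulrA commr_sign -!mulrA; congr (_ * _).
under eq_bigr => i _ do rewrite -mulN1r.
rewrite prod_mul_comm ?prodr_const ?card_ord //.
by move=> i j; apply: commrN1.
Qed.

(** * The Bethe operators *)

Section Operators.
Variables (C : fieldType) (k n : nat) (al : 'I_n -> C) (z : 'I_k -> C).
Local Notation g := (gdim k n).
Local Notation A := ('M[C]_g).
Local Notation W := (psd A).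

Lemma series_bounded (c : nat -> A) :
  let f K M := if (K < 0) && (M == 0) then c (absz (K + 1)%R) else 0 in
  exists k m, xbound f k /\ dbound f m.
Proof.
exists 0, 0; split=> K M h /=; last by rewrite andbC gt_eqF.
by rewrite ltNge ltW.
Qed.
Definition series c : W := Psd A _ (series_bounded c).

(** The geometric series [sum_s t^s x^(-s-1) = 1/(x - t)], for each summand. *)
Lemma series_sum N (t : 'I_N -> C) (B : 'I_N -> A) :
  series (fun s => \sum_i t i ^+ s *: B i) = \sum_i psinv (scal (t i)) * cst (B i).
Proof.
apply: psdP => K M; rewrite psc_sum.
under [RHS]eq_bigr => i _ do rewrite mul_cstE /= /inv_fun.
rewrite /=; case: ifP => _; last by rewrite big1 // => i _; rewrite mul0r.
by apply: eq_bigr => i _; rewrite -rmorphXn /= -mul_scalar_mx.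
Qed.

Lemma cls_bethe N (beta : 'I_N -> A) (E : 'I_N -> 'I_N -> nat -> A) i j :
  cls A (betheEntry beta E i j) =
  (if i == j then psD - cst (beta i) else 0) - series (E j i).
Proof.
apply: psdP => K M; rewrite [LHS]/= coef_mkPD pscD pscN.
have -> : (if i == j then psD - cst (beta i) else 0 : W) K M =
    if i == j then (if (K == 0) && (M == 1) then 1 else 0) -
      (if (K == 0) && (M == 0) then beta i else 0) else 0.
  by case: ifP => _; rewrite ?pscD ?pscN ?psc0.
rewrite /=; have [M1|M1] := eqVneq M 1.
  rewrite M1 /= !andbF !andbT subr0; case: (ltrgt0P K) => hK; case: (i == j) => //=;
    by rewrite subr0.
have [M0|M0] := eqVneq M 0; last first.
  by rewrite !andbF !subr0 !if_same.
rewrite M0 /= !andbT !andbF sub0r; case: (ltrgt0P K) => hK; case: (i == j) => //=;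
  by rewrite ?oppr0 ?subr0 ?sub0r ?addr0.
Qed.

Definition uW a : W := psD - cst (scal (z a)).
(** # carries [x - z_a] to [d/dx - z_a], hence the expansion of [1/(x - z_a)] to an inverse of
    [uW a]. *)
Definition uiW a : W := sharp (psinv (scal (z a))).
Definition yW i : W := psx + cst (scal (al i)).
Definition yiW i : W := psinv (scal (- al i)).
Definition xiW a i : W := cst (xiM C (a, i)).
Definition ddW a i : W := cst (dM C (a, i)).
Definition DnW : W := cls A (rdetPD (betheEntry (fun j => (al j)%:M) (piN z))).
Definition DkW : W := cls A (rdetPD (betheEntry (fun b => (z b)%:M) (piK al))).

Lemma yWE i : yW i = psx - cst (scal (- al i)).
Proof. by rewrite /yW !rmorphN opprK. Qed.
Lemma uW_sharp a : uW a = sharp (psx - cst (scal (z a))).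
Proof. by rewrite rmorphB /= sharp_const /psx sharp_x. Qed.

Lemma DkW_rdet : DkW = rdet (Kmat W k n uW yiW xiW ddW).
Proof.
rewrite /DkW cls_rdet; apply: eq_bigr => t _; congr (_ * _); apply: eq_bigr => a _.
rewrite cls_bethe /Kmat; congr (_ - _).
rewrite (series_sum _ (fun i => - al i) (fun i => xiM C (t a, i) *m dM C (a, i))).
by apply: eq_bigr => i _; rewrite /xiW /ddW -rmorphM.
Qed.

(** Minus the image under # of the matrix defining [DnW]. Its terms have [xi] to the left of [dd],
    those of [Lmat] the opposite order and sign. *)
Definition Nmat (i j : 'I_n) : W :=
  (if i == j then yW i else 0) + \sum_a uiW a * (xiW a j * ddW a i).

Lemma DnW_sharp : sharp DnW = (-1) ^+ n * rdet Nmat.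
Proof.
rewrite -rdetN /DnW cls_rdet rmorph_sum; apply: eq_bigr => t _.
rewrite rmorphM rmorph_sign rmorph_prod; congr (_ * _); apply: eq_bigr => i _.
rewrite cls_bethe /Nmat opprD rmorphB; congr (_ - _).
  case: ifP => _; last by rewrite rmorph0 oppr0.
  by rewrite rmorphB /= sharp_const sharp_d /yW opprD.
rewrite (series_sum _ z (fun a => xiM C (a, t i) *m dM C (a, i))) rmorph_sum.
by apply: eq_bigr => a _; rewrite rmorphM /= sharp_const /xiW /ddW -rmorphM.
Qed.

Lemma cst_scal_comm c (P : W) : GRing.comm (cst (scal c)) P.
Proof. by apply: psdP => K M; rewrite cst_mulE mul_cstE scal_comm. Qed.

Lemma uW_cst a B : GRing.comm (uW a) (cst B).
Proof.
apply/commr_sym/commrB; first by apply/esym/psD_cst.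
by apply/commr_sym/cst_scal_comm.
Qed.
Lemma yW_cst i B : GRing.comm (yW i) (cst B).
Proof.
apply/commr_sym/commrD; first by apply/esym/psx_cst.
by apply/commr_sym/cst_scal_comm.
Qed.
Lemma uW_uW a b : GRing.comm (uW a) (uW b).
Proof.
apply: commrB; last by apply: uW_cst.
by apply/commr_sym/commrB; [apply: commr_refl | apply: psD_cst].
Qed.
Lemma yW_yW a b : GRing.comm (yW a) (yW b).
Proof.
apply: commrD; last by apply: yW_cst.
by apply/commr_sym/commrD; [apply: commr_refl | apply: psx_cst].
Qed.
Lemma uW_yW a i : uW a * yW i = yW i * uW a + 1.
Proof.
have -> : uW a * yW i = psD * psx + psD * cst (scal (al i)) - cst (scal (z a)) * yW i.
  by rewrite /uW mulrBl /yW mulrDr.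
have -> : yW i * uW a = psx * psD + cst (scal (al i)) * psD - yW i * cst (scal (z a)).
  by rewrite /uW mulrBr /yW mulrDl.
by rewrite psD_psx psD_cst (cst_scal_comm (z a)) -!addrA; congr (_ + _); rewrite addrC -!addrA.
Qed.
Lemma uiW_uW a : uiW a * uW a = 1.
Proof. by rewrite uW_sharp /uiW -rmorphM psinvKr rmorph1. Qed.
Lemma uW_uiW a : uW a * uiW a = 1.
Proof. by rewrite uW_sharp /uiW -rmorphM psinvK rmorph1. Qed.
Lemma yW_yiW i : yW i * yiW i = 1. Proof. by rewrite yWE psinvK. Qed.
Lemma yiW_yW i : yiW i * yW i = 1. Proof. by rewrite yWE psinvKr. Qed.

Lemma anti_cst B B' : anti (cst B : W) (cst B') = cst (anti B B').
Proof. by rewrite /anti rmorphD !rmorphM. Qed.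

Hypothesis two_neq0 : (2%:R : C) != 0.

Lemma dualityW : DkW * rdet (Lmat W k n uiW yW xiW ddW) = \prod_i yW i * \prod_a uW a.
Proof.
rewrite DkW_rdet.
apply: (duality W C (cst \o scal : {rmorphism C -> W}) k n two_neq0 _ uW uiW yW yiW xiW ddW
   (cst (parityM C k n))).
- by move=> c w; apply: cst_scal_comm.
- exact: uW_uW.
- exact: yW_yW.
- exact: uW_yW.
- exact: uW_uiW.
- exact: uiW_uW.
- exact: yW_yiW.
- exact: yiW_yW.
- by move=> *; apply: uW_cst.
- by move=> *; apply: uW_cst.
- by move=> *; apply: uW_cst.
- by move=> *; apply: yW_cst.
- by move=> *; apply: yW_cst.
- by move=> *; apply: yW_cst.
all: rewrite /xiW /ddW; try (by move=> *; rewrite anti_cst /anti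
    ?xiM_anti ?dM_anti ?parityM_xi ?parityM_d rmorph0).
- move=> a i b j; rewrite anti_cst /anti dM_xiM xpair_eqE.
  by case: (_ && _); rewrite ?rmorph0 ?rmorph1.
by rewrite -rmorphM /= -[_ * _]/(_ *m _) parityM2 rmorph1.
Qed.

(** Reordering [xi dd] into [dd xi] in [Nmat] adds [sum_a u_a^-1] to the diagonal. Conjugating [y_i]
    by [U] has the same effect, so [Nmat] is the conjugate of [Lmat] by [U]. *)
Lemma dual_operators : exists Ui : W, Ui * \prod_a uW a = 1 /\
  DkW * Ui * sharp DnW = (-1) ^+ n * \prod_i yW i.
Proof.
set U := \prod_a uW a.
have [Ui UUi] := prod_comm_inv W _ (index_enum 'I_k) predT uW uiW uW_uiW.
(* A left inverse exists as well, so the right inverse [Ui] is two-sided. *)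
have UiU : Ui * U = 1.
  have [V VU] : exists V, V * U = 1.
    rewrite /U; elim/big_rec: _ => [|a x _ [V Vx]]; first by exists 1; rewrite mulr1.
    by exists (V * uiW a); rewrite -mulrA (mulrA (uiW a)) uiW_uW mul1r.
  by rewrite -[Ui]mul1r -VU -(mulrA V) UUi mulr1.
exists Ui; split=> //.
have U_cst B : GRing.comm U (cst B).
  by apply/commr_sym/commr_prod => a _; apply/commr_sym/uW_cst.
have ui_u a b : GRing.comm (uiW a) (uW b).
  by apply/commr_sym/(comm_inv W _ _ _ (uW_uiW a) (uiW_uW a)); apply: uW_uW.
have Uui a : GRing.comm U (uiW a) by apply/commr_sym/commr_prod => b _.
have Uy i : U * yW i = (yW i + \sum_a uiW a) * U.
  rewrite /U; elim: (index_enum 'I_k) => [|a s IH]; first by rewrite !big_nil addr0 mul1r mulr1.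
  rewrite !big_cons; move: IH.
  set S := \sum_(b <- s) _; set P := \prod_(b <- s) _ => IH.
  have uS : uW a * S = S * uW a by apply: commr_sum => b _; apply/commr_sym/ui_u.
  rewrite -mulrA IH !mulrA; congr (_ * P).
  by rewrite mulrDr uW_yW uS !mulrDl uiW_uW addrA.
have NE i j : Nmat i j = (if i == j then yW i + \sum_a uiW a else 0) -
    \sum_a uiW a * (ddW a i * xiW a j).
  have E1 a : uiW a * (xiW a j * ddW a i) =
      (if i == j then uiW a else 0) - uiW a * (ddW a i * xiW a j).
    have H : anti (ddW a i) (xiW a j) = (i == j)%:R.
      rewrite anti_cst /anti dM_xiM xpair_eqE eqxx /=.
      by case: (_ == _); rewrite ?rmorph0 ?rmorph1.
    have -> : xiW a j * ddW a i = (i == j)%:R - ddW a i * xiW a j.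
      by rewrite -H /anti addrAC subrr add0r.
    by rewrite mulrBr; case: (i == j); rewrite ?mulr1 ?mulr0.
  rewrite /Nmat; under eq_bigr => a _ do rewrite E1.
  by rewrite sumrB addrA; case: (i == j) => //; rewrite big1_eq addr0.
have U_ddxi i j : GRing.comm U (\sum_a uiW a * (ddW a i * xiW a j)).
  by apply: commr_sum => a _; apply: commrM => //; apply: commrM; apply: U_cst.
have NU i j : Nmat i j * U = U * Lmat W k n uiW yW xiW ddW i j.
  rewrite NE /Lmat mulrBl mulrBr U_ddxi; congr (_ - _).
  by case: (i == j); rewrite ?Uy // mul0r mulr0.
have NL := rdet_conj _ _ _ _ _ NU.
rewrite DnW_sharp mulrA commr_sign -!mulrA; congr (_ * _).
rewrite -[rdet Nmat]mulr1 -UUi (mulrA (rdet Nmat)) NL -!mulrA (mulrA Ui) UiU mul1r.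
by rewrite mulrA dualityW -!mulrA UUi mulr1.
Qed.

Lemma monic_DnW : monic_op n DnW.
Proof.
rewrite /DnW cls_rdet.
have ds c : differential A (series c).
  by move=> K M h; rewrite /= (lt_eqF h) andbF.
have bs c : dbound (series c) 0.
  by move=> K M h; rewrite /= (gt_eqF h) andbF.
have nd P : differential A P -> differential A (- P).
  by move=> dP K M h; rewrite pscN dP ?oppr0.
have nb (P : W) d : dbound P d -> dbound (- P) d.
  by move=> dP K M h; rewrite pscN dP ?oppr0.
apply: monic_rdet => [i|i j ij]; rewrite cls_bethe.
  have [d b] := monic_linear A (al i)%:M; rewrite eqxx; split.
    by apply: differentialD => //; apply/nd/ds.
  by rewrite addrAC; apply: dboundD => //; apply/nb/bs.
by rewrite (negbTE ij) sub0r; split; [apply/nd/ds | apply/nb/bs].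
Qed.

Lemma annih_transfer (v : 'cV[C]_g) (DV T : psd C) :
  sharp DV * T = 1 -> annih v (DnW - psd_map scal DV) ->
  annih v (DkW - (-1) ^+ n * psd_map scal
    (\prod_i (psx + cst (al i)) * T * \prod_a (psD - cst (z a)))).
Proof.
move=> DVT ann; have [Ui [UiU dual]] := dual_operators.
have mapx : psd_map scal psx = psx :> W by rewrite /psx psd_map_mono rmorph1.
have mapd : psd_map scal psD = psD :> W by rewrite /psD psd_map_mono rmorph1.
have mapY : psd_map scal (\prod_i (psx + cst (al i))) = \prod_i yW i.
  by rewrite rmorph_prod; apply: eq_bigr => i _; rewrite rmorphD /= mapx psd_map_mono.
have mapU : psd_map scal (\prod_a (psD - cst (z a))) = \prod_a uW a.
  by rewrite rmorph_prod; apply: eq_bigr => i _; rewrite rmorphB /= mapd psd_map_mono.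
(* The relation is transported by #, multiplied on the left by [DkW * Ui], and on the right by
   [T * prod_a u_a], which has scalar coefficients; a final factor [-1] orients the difference. *)
have := annih_sharp _ _ _ _ ann.
rewrite rmorphB /= -psd_map_sharp => /(annihM _ _ _ (DkW * Ui)).
rewrite mulrBr dual => /(annihMr _ _ _ _ (T * \prod_a (psD - cst (z a)))).
rewrite mulrBl -(mulrA (DkW * Ui)) -rmorphM /= (mulrA (sharp DV)) DVT mul1r mapU.
rewrite -(mulrA DkW) UiU mulr1 => /(annihM _ _ _ (-1)).
by rewrite mulN1r opprB -mapY -!mulrA -rmorphM !mulrA.
Qed.

End Operators.

Lemma signed_prod (W : pzRingType) N (p : pred 'I_N) (f : 'I_N -> W) :
  \prod_(i | p i) - f i = (-1) ^+ #|p| * \prod_(i | p i) f i.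
Proof. exact: prodrN. Qed.

(** * Factors and signs coming from the indices of zero weight *)

Section Augmentation.
Variables (C : fieldType) (k n : nat) (l : 'I_k -> nat) (m : 'I_n -> nat).
Variables (al : 'I_n -> C) (z : 'I_k -> C) (D Di : psd C).
Hypothesis DDi : D * Di = 1.
Let y i : psd C := psx + cst (al i).
Let u a : psd C := psD - cst (z a).

Lemma card_pos_zero : (#|[set i | (0 < m i)%N]| + #|[pred i | m i == 0%N]|)%N = n.
Proof.
rewrite -[RHS](card_ord n) -(cardC [pred i | m i == 0%N]) addnC; congr (_ + _)%N.
by apply: eq_card => i; rewrite !inE lt0n.
Qed.

(** # turns each extra factor [d/dx - alpha_i] into [- y_i]. Its inverse removes the [y_i] with
    [m_i = 0] from the full product, and the signs reduce [(-1)^n] to [(-1)^(dim V)]. *)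
Lemma augmentation : exists T,
  sharp (D * \prod_(i | m i == 0%N) (psD - cst (al i))) * T = 1 /\
  (-1) ^+ n * (\prod_i y i * T * \prod_a u a) =
  (-1) ^+ #|[set i | (0 < m i)%N]| *
   (\prod_i y i ^+ (0 < m i)%N * sharp Di * \prod_a u a ^+ (0 < l a)%N) *
   \prod_(a | l a == 0%N) u a.
Proof.
have cc (b c : C) : GRing.comm (cst b) (cst c) by rewrite /GRing.comm -!rmorphM mulrC.
have yy i j : GRing.comm (y i) (y j).
  apply: commrD; last by apply/commr_sym/commrD; [apply/esym/psx_cst | apply: cc].
  by apply/commr_sym/commrD; [apply: commr_refl | apply: psx_cst].
have uu i j : GRing.comm (u i) (u j).
  apply: commrB; last by apply/commr_sym/commrB; [apply/esym/psD_cst | apply: cc].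
  by apply/commr_sym/commrB; [apply: commr_refl | apply: psD_cst].
have yyi i : y i * psinv (- al i) = 1.
  by rewrite -(psinvK C (- al i)) /y rmorphN opprK.
have [Q YQ] := prod_comm_inv _ _ (index_enum 'I_n) (fun i => m i == 0%N) y _ yyi.
pose e := (-1) ^+ #|[pred i | m i == 0%N]| : psd C.
have ee : e * e = 1 by rewrite -expr2 sqrr_sign.
(* The inverses in reverse order: [Q] for the product of the [y_i] with [m_i = 0], [e] for its sign,
   [sharp Di] for [sharp D]. *)
exists (Q * e * sharp Di); split.
  have -> : sharp (D * \prod_(i | m i == 0%N) (psD - cst (al i))) =
     sharp D * (e * \prod_(i | m i == 0%N) y i).
    rewrite rmorphM rmorph_prod; congr (_ * _); rewrite /e -signed_prod.
    by apply: eq_bigr => i _; rewrite rmorphB /= sharp_const /psD sharp_d opprD.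
  rewrite -!mulrA (mulrA (\prod_(i | _) y i)) YQ mul1r (mulrA e) ee mul1r.
  by rewrite -rmorphM DDi rmorph1.
rewrite (prod_split_cond _ _ y (fun i => (0 < m i)%N) (fun i => m i == 0%N)) //; last first.
  by move=> i; rewrite eqn0Ngt.
rewrite (prod_split_cond _ _ u (fun i => (0 < l i)%N) (fun i => l i == 0%N)) //; last first.
  by move=> i; rewrite eqn0Ngt.
rewrite -!mulrA (mulrA (\prod_(i | _) y i) Q) YQ mul1r.
set Yp := \prod_i y i ^+ (0 < m i)%N.
have key : (-1) ^+ n * Yp * e = (-1) ^+ #|[set i | (0 < m i)%N]| * Yp.
  have -> : (-1) ^+ n = (-1) ^+ #|[set i | (0 < m i)%N]| * e by rewrite -exprD card_pos_zero.
  rewrite -!mulrA; congr (_ * _).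
  have -> : Yp * e = e * Yp by rewrite /e commr_sign.
  by rewrite mulrA ee mul1r.
by rewrite !mulrA key.
Qed.

Lemma monic_augmentation : monic_op #|[set i | (0 < m i)%N]| D ->
  monic_op n (D * \prod_(i | m i == 0%N) (psD - cst (al i))).
Proof.
move=> mD.
have mP : monic_op (\sum_(i < n | m i == 0%N) 1)%N
    (\prod_(i | m i == 0%N) (psD - cst (al i))).
  by apply: monic_prod => i _; apply: monic_linear.
have := monicM _ _ _ _ _ mD mP.
have -> : (\sum_(i < n | m i == 0%N) 1)%N = #|[pred i | m i == 0%N]| by rewrite sum1_card.
by rewrite card_pos_zero.
Qed.

End Augmentation.

(** * Transfer of the eigenvector between the two Bethe algebras *)

Theorem theorem5p7 (R : realType) (k n : nat) (l : 'I_k -> nat) (m : 'I_n -> nat) :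
  (0 < k)%N -> (0 < n)%N ->
  (forall a, (l a <= n)%N) -> (forall i, (m i <= k)%N) ->
  (\sum_(a < k) l a = \sum_(i < n) m i)%N ->
  exists P : {mpoly R[i][n + k]}, P != 0 /\
  forall (al : 'I_n -> R[i]) (z : 'I_k -> R[i]),
    injective al -> injective z ->
    meval (fun j : 'I_(n + k) =>
                   match split j with inl i => al i | inr a => z a end) P != 0 ->
  forall (q : 'I_n -> {poly R[i]}), is_qe_space al z m l q ->
  forall (D Dinv : PsiD R[i]), is_DV D al m q ->
    eqPD (mulPD D Dinv) onePD -> eqPD (mulPD Dinv D) onePD ->
  forall v : 'cV[R[i]]_(gdim k n), v != 0 -> in_weight l m v ->
  let DVaug := mulPD D (\big[mulPD/onePD]_(i < n | m i == 0%N)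
                           addPD dPD (constPD (- al i))) in
  (forall i : nat, (1 <= i <= n)%N -> forall K : int,
     BetheN al z i K *m v = coefPD DVaug K (n - i)%N%:Z *: v) ->
  let Dt := scalePD ((-1) ^+ dimV m)
              (mulPD (mulPD (\big[mulPD/onePD]_(i < n)
                               powPD (addPD xPD (constPD (al i))) (0 < m i)%N)
                            (sharpPD Dinv))
                     (\big[mulPD/onePD]_(a < k)
                               powPD (addPD dPD (constPD (- z a))) (0 < l a)%N)) in
  let Dtaug := mulPD Dt (\big[mulPD/onePD]_(a < k | l a == 0%N)
                           addPD dPD (constPD (- z a))) in
  forall a : nat, (1 <= a <= k)%N -> forall K : int,
     BetheK al z a K *m v = coefPD Dtaug K (k - a)%N%:Z *: v.
Proof.
move=> _ _ _ _ _; exists 1; split; first exact: oner_neq0.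
move=> al z _ _ _ q _ D Dinv [DM Dtop _ _] DDinv _ v _ _ DVaug eig Dt Dtaug a /andP[a_gt0 ak] K.
have two : (2%:R : R[i]) != 0 by rewrite pnatr_eq0.
have mD : monic_op (dimV m) (cls _ D).
  split=> K0 M0 h; first by apply: DM; rewrite h.
  rewrite pscD pscN [cls _ D _ _]/=; have [->|ne] := eqVneq M0 (dimV m)%:Z.
    by rewrite Dtop /= eqxx andbT; case: (K0 == 0); rewrite subrr.
  rewrite DM /= ?(negbTE ne) ?andbF ?subr0 //.
  by apply/orP; right; rewrite lt_neqAle eq_sym ne; lia.
have DDi : cls _ D * cls _ Dinv = 1 by rewrite -cls_mul (cls_eq _ _ _ DDinv) cls1.
have clsV : cls _ DVaug = cls _ D * \prod_(i | m i == 0%N) (psD - cst (al i)).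
  rewrite cls_mul cls_prod; congr (_ * _); apply: eq_bigr => i _.
  by rewrite cls_add cls_d cls_const rmorphN.
have mV : monic_op n (cls _ DVaug) by rewrite clsV; apply: monic_augmentation.
have mN := monic_DnW R[i] k n al z.
have ann : annih v (DnW R[i] k n al z - psd_map scal (cls _ DVaug)).
  move=> K0 M0; rewrite pscD pscN psd_mapE mulmxBl mul_scalar_mx.
  (* Outside the orders [0, ..., n - 1] both operators are known by monicity; inside, the eigenvalue
     equation with [i = n - M0] applies. *)
  have [h|h] := boolP ((M0 < 0) || (n%:Z <= M0)).
    rewrite (coef_monic _ _ _ _ _ mN h) (coef_monic _ _ _ _ _ mV h).
    by case: (_ && _); rewrite ?mul1mx ?scale1r ?mul0mx ?scale0r subrr.
  have i1 : (1 <= n - absz M0 <= n)%N by move: h; rewrite negb_or -leNgt -ltNge; lia.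
  have -> : M0 = (n - (n - absz M0))%N%:Z by move: h; rewrite negb_or -leNgt -ltNge; lia.
  by rewrite -(eig _ i1 K0) subrr.
have [T [VT TE]] := augmentation _ _ _ l m al z _ _ DDi.
have clsT : cls _ Dtaug = (-1) ^+ dimV m *
   (\prod_i (psx + cst (al i)) ^+ (0 < m i)%N * sharp (cls _ Dinv) *
      \prod_a (psD - cst (z a)) ^+ (0 < l a)%N) * \prod_(a | l a == 0%N) (psD - cst (z a)).
  have linz b : cls _ (addPD dPD (constPD (- z b))) = psD - cst (z b).
    by rewrite cls_add cls_d cls_const rmorphN.
  have prodx : \prod_(i < n) cls _ (powPD (addPD xPD (constPD (al i))) (0 < m i)%N) =
      \prod_i (psx + cst (al i)) ^+ (0 < m i)%N.
    by apply: eq_bigr => i _; rewrite cls_pow cls_add cls_x cls_const.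
  have prodd : \prod_(b < k) cls _ (powPD (addPD dPD (constPD (- z b))) (0 < l b)%N) =
      \prod_b (psD - cst (z b)) ^+ (0 < l b)%N.
    by apply: eq_bigr => b _; rewrite cls_pow linz.
  have prod0 : \prod_(b < k | l b == 0%N) cls _ (addPD dPD (constPD (- z b))) =
      \prod_(b | l b == 0%N) (psD - cst (z b)) by apply: eq_bigr => b _; apply: linz.
  rewrite /Dtaug cls_mul cls_prod prod0 /Dt cls_scale !cls_mul !cls_prod prodx prodd.
  by rewrite cls_sharp rmorph_sign.
rewrite -clsV in VT.
(* The annihilated difference is read off at order [k - a]; [TE] identifies its scalar part with
   [Dtaug]. *)
have := annih_transfer _ _ _ al z two v _ _ VT ann K (k - a)%N%:Z.
rewrite -(rmorph_sign (psd_map scal)) -rmorphM TE -clsT pscD pscN psd_mapE mulmxBl mul_scalar_mx.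
by move/eqP; rewrite subr_eq0 => /eqP.
Qed.
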